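(* Let $P=P(d,\mathbf m)$, $P'=P(d,\mathbf m+(1,\dots,1))$, and let $I\subset P$ be a color-squarefree monomial ideal. Put $$I'=I+\mathfrak m_1^{[2]}+\cdots+\mathfrak m_d^{[2]}=I+(x_{i,j}x_{i,k}:1\le i\le d,\ 1\le j<k\le m_i).$$ Then (with ideals of $P$ also denoting their extensions to $P'$): (a) There is an exact sequence of $\mathbb Z^{d+|\mathbf m|}$-graded $P'$-modules $$0\to G_d\to\cdots\to G_1\to G_0=P'/I'\to P'/\Big(I'+\sum_{i=1}^d x_{i,m_i+1}\mathfrak m_i\Big)\to0,$$ where $$G_k=\bigoplus_{u\in[\mathrm{Mon}_{\mathrm{c\text{-}sqfree}}(P)]_k}\big(P'/(I':u)\big)\Big(-\deg\big(u\prod_{i\in\mathrm{cSupp}(u)}x_{i,m_i+1}\big)\Big),$$ and the maps are induced by those of the exact sequence $0\to F_d\to\cdots\to F_0\to P'/(\sum_i\mathfrak m_i^{[2]}+\sum_i x_{i,m_i+1}\mathfrak m_i)\to 0$ described in the context. (b) $P'/(I'+\sum_{i=1}^d x_{i,m_i+1}\mathfrak m_i)$ is minimally resolved over $P'$ by iterated mapping cones from the exact sequence in (a). (c) The $\mathbb Z^{d+|\mathbf m|}$-graded Betti numbers are $$\beta_{k,a}\Big(P'/\big(I'+\sum_{i=1}^d x_{i,m_i+1}\mathfrak m_i\big)\Big)=\sum_{j=0}^d\ \sum_{u\in[\mathrm{Mon}_{\mathrm{c\text{-}sqfree}}(P)]_j}\beta_{k-j,\,a-\deg(u\prod_{i\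in\mathrm{cSupp}(u)}x_{i,m_i+1})}\big(P'/(I':u)\big).$$
   Context: $P(d,\mathbf m)$, $d\ge1$, $\mathbf m=(m_1,\dots,m_d)\in\mathbb N^d$, is the polynomial ring over a field $\mathbb K$ in variables $x_{i,j}$, $1\le i\le d$, $1\le j\le m_i$; $x_{i,j}$ has color $i$; $|\mathbf m|=m_1+\dots+m_d$. $P'$ has the extra variables $x_{i,m_i+1}$ and the fine $\mathbb Z^{d+|\mathbf m|}$-grading in which each variable has degree a standard basis vector. $\mathfrak m_i=(x_{i,1},\dots,x_{i,m_i})$ and $\mathfrak m_i^{[2]}=(x_{i,j}x_{i,k}:1\le j<k\le m_i)$. A monomial is color-squarefree if it is squarefree and divisible by at most one variable of each color; $[\mathrm{Mon}_{\mathrm{c\text{-}sqfree}}(P)]_k$ is the set of color-squarefree monomials of $P$ of total degree $k$. A monomial ideal is color-squarefree if its minimal monomial generators are. $\mathrm{cSupp}(u)$ is the set of colors of variables dividing $u$. The sequence $F_\bullet$: with $F_k=\bigoplus_{u\in[\mathrm{Mon}_{\mathrm{c\text{-}sqfree}}(P)]_k}(P'/((\sum_i\mathfrak m_i^{[2]}):u))(-\deg(u\prod_{i\in\mathrm{cSupp}(u)}x_{i,m_i+1}))$, it is the tensor product over $\mathbb K$, for $i=1,\dots,d$, of the complexes of $R_i=\mathbb K[x_{i,1},\dots,x_{i,m_i+1}]$-modules $0\to\bigoplus_{j=1}^{m_i}(R_i/(\mathfrak m_i^{[2]}:x_{i,j}))(-\deg(x_{i,j}x_{i,m_i+1}))\to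 R_i/\mathfrak m_i^{[2]}\to0$ whose map sends the generator of the $j$-th summand to $x_{i,j}x_{i,m_i+1}$, followed by the canonical projection from $F_0=P'/\sum_i\mathfrak m_i^{[2]}$. Thus, up to sign conventions, for $u=x_{i_1,j_1}\cdots x_{i_k,j_k}$ ($i_1<\dots<i_k$) the generator $e_u$ maps to $\sum_p(-1)^{p-1}x_{i_p,j_p}x_{i_p,m_{i_p}+1}\,e_{u/x_{i_p,j_p}}$. ''Minimally resolved by iterated mapping cones'' means: breaking the exact sequence into short exact sequences and successively forming mapping cones of lifted comparison maps, starting with minimal graded free resolutions of the modules $G_k$, yields a minimal graded free resolution of the last module. $\beta_{k,a}(M)=\dim_{\mathbb K}[\mathrm{Tor}_k^{P'}(M,\mathbb K)]_a$, zero for $k<0$. *)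

(* Defs.v *)
From HB Require Import structures.
From mathcomp Require Import all_boot all_order all_algebra.
From mathcomp Require Import ring_quotient generic_quotient.
From mathcomp Require Import boolp classical_sets.
From mathcomp Require Import mpoly.

Set Implicit Arguments.
Unset Strict Implicit.
Unset Printing Implicit Defensive.

Import GRing.Theory.
Local Open Scope ring_scope.
Local Open Scope quotient_scope.

Section ModuleQuotient.
Variables (S : nzRingType) (V : lmodType S) (W : V -> Prop).

Definition spanned (v : V) : Prop :=
  exists (n : nat) (a : 'I_n -> S) (w : 'I_n -> V),
    (forall i, W (w i)) /\ v = \sum_i a i *: w i.

Lemma spanned0 : spanned 0.
Proof.
exists 0%N, (fun _ => 0), (fun _ => 0); split; first by case.
by rewrite big_ord0.
Qed.

Lemma spannedD u v : spanned u -> spanned v -> spanned (u + v).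
Proof.
move=> [p [a [x [Wx ->]]]] [q [b [y [Wy ->]]]].
exists (p + q)%N,
  (fun i => match split i with inl j => a j | inr j => b j end),
  (fun i => match split i with inl j => x j | inr j => y j end).
split=> [i|]; first by case: (split i).
rewrite big_split_ord /=; congr (_ + _); apply: eq_bigr => i _.
  by rewrite -[lshift q i]/(unsplit (inl i)) unsplitK.
by rewrite -[rshift p i]/(unsplit (inr i)) unsplitK.
Qed.

Lemma spannedZ c v : spanned v -> spanned (c *: v).
Proof.
move=> [p [a [x [Wx ->]]]]; exists p, (fun i => c * a i), x; split=> //.
by rewrite scaler_sumr; apply: eq_bigr => i _; rewrite scalerA.
Qed.

Definition spannedb : V -> bool := fun v => `[< spanned v >].

Lemma spannedb_zmod_closed : zmod_closed spannedb.
Proof.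
split=> [|u v /asboolP su /asboolP sv]; first exact/asboolP/spanned0.
by apply/asboolP/spannedD => //; rewrite -scaleN1r; apply: spannedZ.
Qed.

HB.instance Definition _ :=
  GRing.isZmodClosed.Build V spannedb spannedb_zmod_closed.

Definition spanned_closed := GRing.ZmodClosed.clone V spannedb _.

(* The quotient of V by the submodule generated by W, with \pi_mquot the
   canonical projection. *)
Definition mquot : Type := Quotient.quot spanned_closed.
HB.instance Definition _ := EqQuotient.on mquot.
HB.instance Definition _ := Choice.on mquot.
HB.instance Definition _ := GRing.Zmodule.on mquot.

Definition mq_scale (c : S) (x : mquot) : mquot := \pi_mquot (c *: repr x).

Lemma mq_piP (u v : V) : (\pi_mquot u = \pi_mquot v) <-> spanned (u - v).
Proof.
have E : (u - v \in spannedb) = (\pi_mquot u == \pi_mquot v).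
  exact: (Quotient.idealrBE spanned_closed u v).
by split=> [/eqP|h]; [rewrite -E => /asboolP|apply/eqP; rewrite -E; apply/asboolP].
Qed.

Lemma mq_piD (u v : V) : \pi_mquot (u + v) = \pi_mquot u + \pi_mquot v.
Proof. exact: (Quotient.pi_add spanned_closed u v). Qed.

Lemma mq_scale_pi c (u : V) : mq_scale c (\pi_mquot u) = \pi_mquot (c *: u).
Proof.
apply: (iffRL (mq_piP _ _)); rewrite -scalerBr; apply: spannedZ.
by apply: (iffLR (mq_piP _ _)); rewrite reprK.
Qed.

Lemma mq_piE (x : mquot) : exists u : V, x = \pi_mquot u.
Proof. by exists (repr x); rewrite reprK. Qed.

Lemma mq_scaleA a b x : mq_scale a (mq_scale b x) = mq_scale (a * b) x.
Proof. by have [u ->] := mq_piE x; rewrite !mq_scale_pi scalerA. Qed.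

Lemma mq_scale1 : left_id 1 mq_scale.
Proof. by move=> x; have [u ->] := mq_piE x; rewrite mq_scale_pi scale1r. Qed.

Lemma mq_scaleDr : right_distributive mq_scale +%R.
Proof.
move=> c x y; have [u ->] := mq_piE x; have [v ->] := mq_piE y.
by rewrite -mq_piD !mq_scale_pi -mq_piD scalerDr.
Qed.

Lemma mq_scaleDl x : {morph mq_scale^~ x : a b / a + b}.
Proof.
by move=> a b; have [u ->] := mq_piE x; rewrite !mq_scale_pi -mq_piD scalerDl.
Qed.

HB.instance Definition _ := GRing.Zmodule_isLmodule.Build S mquot
  mq_scaleA mq_scale1 mq_scaleDr mq_scaleDl.

End ModuleQuotient.

Arguments mquot {S V} W.

Definition ideal_gen (S : nzRingType) (A : S -> Prop) : S -> Prop :=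
  @spanned S S^o A.

Definition multideg (n : nat) := {ffun 'I_n -> int}.

Definition degm n (u : 'X_{1..n}) : multideg n := [ffun i => (u i)%:Z].

Section Graded.
Variables (K : fieldType) (n : nat).
Local Notation S := {mpoly K[n]}.
Local Notation deg := (multideg n).

Definition mhomog (a : deg) (p : S) : Prop :=
  forall u : 'X_{1..n}, p@_u != 0 -> degm u = a.

(* A module with a candidate family of graded pieces; is_graded states that
   these pieces are a grading. *)
Record gmodule := GModule {
  gcar :> lmodType S;
  gpiece : deg -> gcar -> Prop }.

Definition is_graded (M : gmodule) : Prop :=
  [/\ forall a, gpiece a (0 : M) /\
        (forall x y : M, gpiece a x -> gpiece a y -> gpiece a (x + y)),
      forall a b p (x : M), mhomog a p -> gpiece b x -> gpiece (a + b) (p *: x),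
      forall x : M, exists (s : seq deg) (y : deg -> M),
        (forall a, gpiece a (y a)) /\ x = \sum_(a <- s) y a
    & forall (s : seq deg) (y : deg -> M), uniq s ->
        (forall a, gpiece a (y a)) -> \sum_(a <- s) y a = 0 ->
        {in s, forall a, y a = 0}].

Definition graded_map (M N : gmodule) (f : M -> N) : Prop :=
  forall a x, gpiece a x -> gpiece a (f x).

(* 0 -> M_len -> ... -> M_1 -> M_0 -> 0 is exact, for len > 0. *)
Definition exact_sequence (M : nat -> gmodule)
    (D : forall k, {linear M k.+1 -> M k}) (len : nat) : Prop :=
  [/\ injective (D len.-1),
      forall k, (k.+1 < len)%N ->
        forall x, D k x = 0 <-> exists y, D k.+1 y = x
    & forall x, exists y, D 0%N y = x].

(* A sequence of finitely generated graded free modules and homogeneous maps: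
   the k-th module is the space of row vectors of length rk k, its i-th basis
   vector has degree gdeg k i, and maps act by right multiplication. *)
Record gfree := GFree {
  rk : nat -> nat;
  gdeg : forall k, 'I_(rk k) -> deg;
  dif : forall k, 'M[S]_(rk k.+1, rk k) }.
Arguments gdeg : clear implicits.
Arguments dif : clear implicits.

Definition graded_gfree (C : gfree) : Prop :=
  forall k i j, mhomog (gdeg C k.+1 i - gdeg C k j) (dif C k i j).

(* C, with augmentation e, is a graded free resolution of the submodule Z
   of M. *)
Definition resolves (M : gmodule) (Z : M -> Prop) (C : gfree)
    (e : 'rV[S]_(rk C 0) -> M) : Prop :=
  [/\ graded_gfree C,
      linear e /\ (forall i, gpiece (gdeg C 0 i) (e (delta_mx 0 i))),
      forall x, Z x <-> exists v, e v = x,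
      forall v, e v = 0 <-> exists w, v = w *m dif C 0
    & forall k (v : 'rV_(rk C k.+1)),
        v *m dif C k = 0 <-> exists w, v = w *m dif C k.+1].

Definition resolution (M : gmodule) (C : gfree) (e : 'rV[S]_(rk C 0) -> M) :=
  resolves (fun _ => True) e.

(* All differentials have their image in (x_0, ..., x_(n-1)) times the target. *)
Definition minimal (C : gfree) : Prop :=
  forall k i j, (dif C k i j)@_0%MM = 0.

Definition minimal_resolution (M : gmodule) (C : gfree)
    (e : 'rV[S]_(rk C 0) -> M) : Prop := resolution e /\ minimal C.

(* f is a homogeneous morphism of complexes C -> C' that commutes with the
   augmentations e and e' into the same module. *)
Definition lifting (M : gmodule) (C C' : gfree)
    (e : 'rV[S]_(rk C 0) -> M) (e' : 'rV[S]_(rk C' 0) -> M)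
    (f : forall k, 'M[S]_(rk C k, rk C' k)) : Prop :=
  [/\ forall k i j, mhomog (gdeg C k i - gdeg C' k j) (f k i j),
      forall v, e' (v *m f 0%N) = e v
    & forall k, dif C k *m f k = f k.+1 *m dif C' k].

Definition cone_rk (C C' : gfree) (k : nat) : nat :=
  match k with 0 => rk C' 0 | k'.+1 => (rk C' k'.+1 + rk C k')%N end.

Definition cone_gdeg (C C' : gfree) (k : nat) : 'I_(cone_rk C C' k) -> deg :=
  match k with
  | 0 => gdeg C' 0
  | k'.+1 => fun i => match split i with
                      | inl j => gdeg C' k'.+1 j
                      | inr j => gdeg C k' j
                      end
  end.

Definition cone_dif (C C' : gfree) (f : forall k, 'M[S]_(rk C k, rk C' k))
    (k : nat) : 'M[S]_(cone_rk C C' k.+1, cone_rk C C' k) :=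
  match k with
  | 0 => col_mx (dif C' 0) (f 0%N)
  | k'.+1 => block_mx (dif C' k'.+1) 0 (f k'.+1) (- dif C k')
  end.

Definition cone (C C' : gfree) (f : forall k, 'M[S]_(rk C k, rk C' k)) : gfree :=
  @GFree (cone_rk C C') (@cone_gdeg C C') (cone_dif f).

(* Break 0 -> M_len -> ... -> M_0 -> 0 into 0 -> Z_k.+1 -> M_k.+1 -> Z_k -> 0
   with Z_k := im (D k) a submodule of M_k, so that Z_0 = M_0.  Given
   resolutions (C k, e k) of M_k, [iterated_cone D e len g] says that
   (R, g), with g : R_0 -> M_k of image Z_k, is obtained by iterated mapping
   cones: M_len is isomorphic to Z_(len.-1), and the step to Z_k is the cone
   of a lift to C k.+1 of the inclusion of Z_k.+1 in M_k.+1. *)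
Inductive iterated_cone (M : nat -> gmodule)
    (D : forall k, {linear M k.+1 -> M k}) (C : nat -> gfree)
    (e : forall k, 'rV[S]_(rk (C k) 0) -> M k) (len : nat) :
    forall (k : nat) (R : gfree), ('rV[S]_(rk R 0) -> M k) -> Prop :=
| iterated_cone_top k : len = k.+1 ->
    @iterated_cone M D C e len k (C k.+1) (fun v => D k (e k.+1 v))
| iterated_cone_step k R (g : 'rV[S]_(rk R 0) -> M k.+1)
    (f : forall i, 'M[S]_(rk R i, rk (C k.+1) i)) :
    @iterated_cone M D C e len k.+1 R g ->
    lifting g (e k.+1) f ->
    @iterated_cone M D C e len k (cone f) (fun v => D k (e k.+1 v)).

(* Minimal graded free resolutions of M_1, ..., M_len exist and, whichever are
   chosen, all the lifts can be chosen, and every choice of the lifts produces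
   a minimal graded free resolution of M_0. *)
Definition minimally_resolved_by_iterated_cones (M : nat -> gmodule)
    (D : forall k, {linear M k.+1 -> M k}) (len : nat) : Prop :=
  (exists (C : nat -> gfree) (e : forall k, 'rV[S]_(rk (C k) 0) -> M k),
     forall k, (0 < k <= len)%N -> minimal_resolution (e k)) /\
  (forall (C : nat -> gfree) (e : forall k, 'rV[S]_(rk (C k) 0) -> M k),
     (forall k, (0 < k <= len)%N -> minimal_resolution (e k)) ->
     (exists R (g : 'rV[S]_(rk R 0) -> M 0%N), iterated_cone D e len g) /\
     (forall R (g : 'rV[S]_(rk R 0) -> M 0%N),
        iterated_cone D e len g -> minimal_resolution g)).

(* The differentials of C tensored with K = S / (x_0, ..., x_(n-1)), and the
   projection onto its part of degree a. *)
Definition red_dif (C : gfree) (k : nat) : 'M[K]_(rk C k.+1, rk C k) :=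
  map_mx (mcoeff 0%MM) (dif C k).

Definition deg_part (C : gfree) (k : nat) (a : deg) : 'M[K]_(rk C k) :=
  diag_mx (\row_i (gdeg C k i == a)%:R).

Definition cycles (C : gfree) (k : nat) (a : deg) : 'M[K]_(rk C k) :=
  match k with
  | 0 => deg_part C 0 a
  | k'.+1 => (deg_part C k'.+1 a :&: kermx (red_dif C k'))%MS
  end.

Definition boundaries (C : gfree) (k : nat) (a : deg) :
    'M[K]_(rk C k.+1, rk C k) :=
  deg_part C k.+1 a *m red_dif C k.

(* The dimension of the degree a part of H_k (C (x) K). *)
Definition homology_dim (C : gfree) (k : nat) (a : deg) : nat :=
  (\rank (cycles C k a) - \rank (boundaries C k a))%N.

(* dim [Tor_k (M, K)]_a, where Tor is computed by some graded free resolution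
   of M; Tor_k is 0 for k < 0. *)
Definition betti (M : gmodule) (k : int) (a : deg) : nat :=
  match k with
  | Posz k' => xget 0%N [set b | exists (C : gfree) (e : 'rV[S]_(rk C 0) -> M),
                             resolution e /\ b = homology_dim C k' a]%classic
  | Negz _ => 0%N
  end.

Definition cyclic_mod (J : S -> Prop) : gmodule :=
  @GModule (mquot (J : S^o -> Prop))
    (fun a x => exists2 p : S^o, mhomog a p & x = \pi_(mquot (J : S^o -> Prop)) p).

Definition colon (J : S -> Prop) (u : 'X_{1..n}) : S -> Prop :=
  fun p => J (p * 'X_[u]).

(* The direct sum over u in U of (S / (J u)) (- sh u), as the quotient of the
   free module with basis U. *)
Definition sum_rel (U : finType) (J : U -> S -> Prop) : {ffun U -> S^o} -> Prop :=
  fun f => forall u, J u (f u).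

Definition sum_cyclic (U : finType) (J : U -> S -> Prop) (sh : U -> deg) :
    gmodule :=
  @GModule (mquot (sum_rel J))
    (fun a x => exists2 f : {ffun U -> S^o},
       forall u, mhomog (a - sh u) (f u) & x = \pi_(mquot (sum_rel J)) f).

End Graded.

Arguments gdeg {K n} C k i : rename.
Arguments dif {K n} C k : rename.

Section Colored.
Variables (K : fieldType) (d : nat).

(* The variable x_{i,j} is [Tagged _ j : var m] with j : 'I_(m i), so that
   indices start at 0 and, in var (msucc m), x_{i, m_i + 1} has index m i. *)
Definition var (m : 'I_d -> nat) : finType := {i : 'I_d & 'I_(m i)}.
Definition nvar (m : 'I_d -> nat) : nat := #|{: var m}|.
Definition vidx (m : 'I_d -> nat) (t : var m) : 'I_(nvar m) := enum_rank t.

Definition cpoly (m : 'I_d -> nat) := {mpoly K[nvar m]}.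

Definition msucc (m : 'I_d -> nat) : 'I_d -> nat := fun i => (m i).+1.

Variable m : 'I_d -> nat.
Local Notation P := (cpoly m).
Local Notation P' := {mpoly K[nvar (msucc m)]}.
Local Notation mon := 'X_{1..nvar m}.
Local Notation mon' := 'X_{1..nvar (msucc m)}.

Definition old_var (t : var m) : var (msucc m) :=
  Tagged (fun i => 'I_(msucc m i)) (widen_ord (leqnSn (m (tag t))) (tagged t)).
Definition new_var (i : 'I_d) : var (msucc m) :=
  Tagged (fun i => 'I_(msucc m i)) (ord_max : 'I_(m i).+1).

Definition xvar (t : var (msucc m)) : P' := 'X_(vidx t).

(* The inclusion of P in P', on polynomials and on monomials. *)
Definition incl (p : P) : P' :=
  p \mPo [tuple xvar (old_var (enum_val i)) | i < nvar m].
Definition incl_mon (u : mon) : mon' :=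
  \big[@mnm_add _/0%MM]_(t : var m) (U_(vidx (old_var t)) *+ u (vidx t))%MM.

Definition csqfree (u : mon) : bool :=
  [forall t : var m, u (vidx t) <= 1]%N &&
  [forall s : var m, forall t : var m,
     [&& tag s == tag t, 0 < u (vidx s) & 0 < u (vidx t)]%N ==> (s == t)].

Definition cSupp (u : mon) : {set 'I_d} :=
  [set tag t | t : var m & (0 < u (vidx t))%N].

Definition is_ideal (I : P -> Prop) : Prop :=
  [/\ I 0, forall p q, I p -> I q -> I (p + q) & forall p q, I q -> I (p * q)].

Definition monomial_ideal (I : P -> Prop) : Prop :=
  is_ideal I /\
  forall p, I p <-> ideal_gen (fun q => I q /\ exists u : mon, q = 'X_[u]) p.

Definition minimal_generator (I : P -> Prop) (u : mon) : Prop :=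
  I 'X_[u] /\ forall v : mon, I 'X_[v] -> (v <= u)%MM -> v = u.

Definition csqfree_ideal (I : P -> Prop) : Prop :=
  monomial_ideal I /\ forall u, minimal_generator I u -> csqfree u.

(* Generators of m_1^[2] + ... + m_d^[2] in P'. *)
Definition sq_gen (p : P') : Prop :=
  exists (i : 'I_d) (j k : 'I_(m i)), (j < k)%N /\
    p = xvar (old_var (Tagged (fun i => 'I_(m i)) j)) *
        xvar (old_var (Tagged (fun i => 'I_(m i)) k)).

Definition sq_ideal : P' -> Prop := ideal_gen sq_gen.

(* I' = I + m_1^[2] + ... + m_d^[2] *)
Definition sq_extension (I : P -> Prop) : P' -> Prop :=
  ideal_gen (fun p => (exists2 q, I q & p = incl q) \/ sq_gen p).

(* J + sum_i x_{i, m_i + 1} m_i *)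
Definition add_new (J : P' -> Prop) : P' -> Prop :=
  ideal_gen (fun p => J p \/
    exists t : var m, p = xvar (new_var (tag t)) * xvar (old_var t)).

(* The color-squarefree monomials of P of total degree k. *)
Definition csmon (k : nat) : finType :=
  {u : bmultinom (nvar m) k.+1 | (mdeg u == k) && csqfree u}.
Definition csval (k : nat) (u : csmon k) : mon := bmnm (val u).

(* deg (u prod_{i in cSupp u} x_{i, m_i + 1}) *)
Definition cshift (k : nat) (u : csmon k) : multideg (nvar (msucc m)) :=
  degm (incl_mon (csval u) +
        \big[@mnm_add _/0%MM]_(i in cSupp (csval u)) U_(vidx (new_var i)))%MM.

(* The k-th term for the ideal J of P': G_k for J = I', F_k for
   J = m_1^[2] + ... + m_d^[2]. *)
Definition sq_mod (J : P' -> Prop) (k : nat) : gmodule K (nvar (msucc m)) :=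
  sum_cyclic (fun u : csmon k => colon J (incl_mon (csval u)))
             (@cshift k).

Definition sq_class (J : P' -> Prop) (k : nat) (f : {ffun csmon k -> P'^o}) :
    sq_mod J k :=
  \pi_(mquot (sum_rel (fun u : csmon k => colon J (incl_mon (csval u))))) f.

Definition basis_elt (k : nat) (u : csmon k) : {ffun csmon k -> P'^o} :=
  [ffun v => (v == u)%:R].

(* The augmented sequence: term 0 is P' / (J + sum_i x_{i, m_i + 1} m_i) and
   term k.+1 is sq_mod J k.  The only color-squarefree monomial of degree 0
   is 1, so that sq_mod J 0 is P' / J. *)
Definition aug_seq (J : P' -> Prop) (k : nat) : gmodule K (nvar (msucc m)) :=
  match k with
  | 0 => cyclic_mod (add_new J)
  | k'.+1 => sq_mod J k'
  end.

Definition maps_of (J : P' -> Prop) :=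
  forall k, {linear aug_seq J k.+1 -> aug_seq J k}.

Definition aug_class (J : P' -> Prop) (p : P'^o) : aug_seq J 0 :=
  \pi_(mquot (add_new J : P'^o -> Prop)) p.

(* The maps of F: in e_u |-> sum_p (-1)^(p-1) x_{i_p,j_p} x_{i_p,m_{i_p}+1}
   e_{u/x_{i_p,j_p}}, the number p - 1 counts the colors of u that are smaller
   than i_p; F_0 -> P' / (...) is the canonical projection. *)
Definition F_maps (D : maps_of sq_ideal) : Prop :=
  (forall k (u : csmon k.+1),
     D k.+1 (sq_class sq_ideal (basis_elt u)) =
     \sum_(t : var m)
       \sum_(v : csmon k | csval u == (csval v + U_(vidx t))%MM)
          ((-1) ^+ #|[set i in cSupp (csval u) | (i < tag t)%N]| *
             xvar (old_var t) * xvar (new_var (tag t)))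
            *: sq_class sq_ideal (basis_elt v)) /\
  (forall u : csmon 0,
     D 0%N (sq_class sq_ideal (basis_elt u)) = aug_class sq_ideal 1).

(* The maps DG are induced by the maps DF, along the canonical projections
   that send the class of f in a term of F to its class in G. *)
Definition induced_maps (J : P' -> Prop) (DF : maps_of sq_ideal)
    (DG : maps_of J) : Prop :=
  (forall k f g, DF k.+1 (sq_class sq_ideal f) = sq_class sq_ideal g ->
                 DG k.+1 (sq_class J f) = sq_class J g) /\
  (forall f p, DF 0%N (sq_class sq_ideal f) = aug_class sq_ideal p ->
               DG 0%N (sq_class J f) = aug_class J p).

End Colored.

(* Main.v *)
Require Import Defs.
From HB Require Import structures.
From mathcomp Require Import all_boot all_order all_algebra.
From mathcomp Require Import ring_quotient generic_quotient.
From mathcomp Require Import boolp.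
From mathcomp Require classical_sets.
From mathcomp Require Import mpoly.

(** Everything is graded by the exponent vectors of monomials, and a polynomial
    ring has at most one monomial in each degree. So the sequence of part (a)
    can be examined one degree [W] at a time. If the monomial of [W] lies in
    I', every term vanishes in degree [W], because I' is extended from the old
    variables and the shift of the summand of [u] restores exactly [u] and new
    variables. Otherwise at most one old variable of each color divides [W],
    and the summand of [u] contributes a line exactly when [u] is a product of
    variables x such that both x and the new variable of its color divide [W].
    These x are the vertices of a simplex, the [u] are its faces, and the strand
    of the sequence is its augmented chain complex ([dmap_strand]). It is exact
    since a simplex with a vertex is a cone ([bdry_exact]); if there is no
    vertex, only the term of index 0 and the module to be resolved survive, and
    they agree ([daug_exact]).

    For part (b), the cone of a lift of an inclusion of resolved modules
    resolves the quotient ([cone_resolves]), so only minimality is at stake.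
    Let the weight of a degree be its part in the new variables. The ideals
    I' : u have squarefree minimal generators in the old variables, hence
    resolutions whose generators have squarefree degrees in the old variables
    ([cyclic_resolution]); after the shift all generators of the resolution of
    G_k have weight k. As Tor does not depend on the resolution
    ([homology_dim_le]), the same holds for every minimal resolution of G_k
    ([minimal_gens_degrees]). A cone that resolves the image of G_(k+1) in G_k
    is built from generators of weight at least k+1, while its lift goes to
    generators of weight k; being homogeneous, the lift has no unit entry, and
    the next cone is again minimal ([iterated_cone_resolves]).

    For part (c), the Betti numbers of a module count the generators of a
    minimal resolution ([betti_minimal]), and the generators of an iterated
    cone are those of the resolutions that it was built from
    ([iterated_cone_gens]). For G_k one takes the direct sum of the shifted
    resolutions of its summands ([dsum_resolution], [dsum_gens]).

    The existence of minimal resolutions is obtained without a general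
    finiteness theorem. The syzygy modules that occur are determined by their
    components in the finitely many squarefree degrees ([determined]), this
    passes to kernels ([kernel_determined]), and a smallest set of homogeneous
    generators is minimal ([minimal_generates]). *)

Set Implicit Arguments.
Unset Strict Implicit.
Unset Printing Implicit Defensive.

Import Order.TTheory GRing.Theory Num.Theory.
Local Open Scope ring_scope.
Local Open Scope quotient_scope.

(** * Homogeneous polynomials, vectors and matrices *)

Section Degrees.
Variables (K : fieldType) (n : nat).
Local Notation S := {mpoly K[n]}.
Local Notation deg := (multideg n).
Implicit Types (a b c : deg) (p q : S) (u v w : 'X_{1..n}).

Lemma degmD u v : degm (u + v)%MM = degm u + degm v.
Proof. by apply/ffunP => i; rewrite !ffunE mnmDE PoszD. Qed.

Lemma degm0 : degm (0%MM : 'X_{1..n}) = 0.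
Proof. by apply/ffunP => i; rewrite !ffunE mnm0E. Qed.

Lemma degm_inj : injective (@degm n).
Proof.
move=> u v /ffunP e; apply/mnmP => i.
by have := e i; rewrite !ffunE => -[].
Qed.

Lemma mcoeff_mulX p w u :
  (p * 'X_[w])@_u = if (w <= u)%MM then p@_(u - w)%MM else 0.
Proof.
case: ifP => [le_wu|nle]; first by rewrite -{1}(submK le_wu) addmC mcoeffMX.
apply/eqP; rewrite mcoeff_eq0 (perm_mem (msuppMX _ _)).
by apply/negP => /mapP [v _ uE]; rewrite uE lem_addr in nle.
Qed.

Lemma mhomog0 a : mhomog a (0 : S).
Proof. by move=> u; rewrite mcoeff0 eqxx. Qed.

Lemma mhomogD a p q : mhomog a p -> mhomog a q -> mhomog a (p + q).
Proof.
move=> hp hq u; rewrite mcoeffD; have [pu|/hp //] := eqVneq p@_u 0.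
by rewrite pu add0r => /hq.
Qed.

Lemma mhomogZ a (k : K) p : mhomog a p -> mhomog a (k *: p).
Proof. by move=> hp u; rewrite mcoeffZ mulf_eq0 negb_or => /andP [_ /hp]. Qed.

Lemma mhomogN a p : mhomog a p -> mhomog a (- p).
Proof. by rewrite -scaleN1r; apply: mhomogZ. Qed.

Lemma mhomog_sum a (T : Type) (r : seq T) (P : pred T) (F : T -> S) :
  (forall i, P i -> mhomog a (F i)) -> mhomog a (\sum_(i <- r | P i) F i).
Proof.
move=> h; elim/big_ind: _ => //; first exact: mhomog0.
by move=> p q; apply: mhomogD.
Qed.

Lemma mhomogX u : mhomog (degm u) ('X_[u] : S).
Proof. by move=> v; rewrite mcoeffX; have [->|_] := eqVneq u v; rewrite ?eqxx. Qed.

Lemma mhomog1 : mhomog 0 (1 : S).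
Proof. by rewrite -mpolyX0 -degm0; apply: mhomogX. Qed.

(** The fine grading has one-dimensional pieces: this is what lets every
    graded argument below be run on single monomials. *)
Lemma mhomog_degm u p : mhomog (degm u) p -> p = p@_u *: 'X_[u].
Proof.
move=> hp; apply/mpolyP => v; rewrite mcoeffZ mcoeffX.
have [->|nuv] := eqVneq u v; first by rewrite mulr1.
have [->|/hp /degm_inj E] := eqVneq p@_v 0; first by rewrite mulr0.
by rewrite E eqxx in nuv.
Qed.

Lemma mhomog_cases a p : mhomog a p ->
  p = 0 \/ exists2 u, degm u = a & p = p@_u *: 'X_[u].
Proof.
move=> hp; have [->|p0] := eqVneq p 0; [by left|right].
have [u up] : exists u, u \in msupp p.
  case E : (msupp p) => [|u s]; last by exists u; rewrite mem_head.
  by rewrite (msuppnil0 E) eqxx in p0.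
have ua : degm u = a by apply: hp; rewrite -mcoeff_msupp.
by exists u => //; apply: mhomog_degm; rewrite ua.
Qed.

Lemma mhomogM a b p q : mhomog a p -> mhomog b q -> mhomog (a + b) (p * q).
Proof.
move=> /mhomog_cases [->|[u <- ->]]; first by rewrite mul0r => _; apply: mhomog0.
move=> /mhomog_cases [->|[v <- ->]]; first by rewrite mulr0; apply: mhomog0.
rewrite -scalerAl -scalerAr -mpolyXD -degmD.
by do 2 apply: mhomogZ; apply: mhomogX.
Qed.

Lemma mhomog_coef0 a p : mhomog a p -> a != 0 -> p@_0%MM = 0.
Proof.
move=> hp a0; apply/eqP; apply: contraNT a0 => /hp <-.
by rewrite degm0.
Qed.

Lemma mhomog_const p : mhomog 0 p -> p = p@_0%MM *: 1.
Proof. by rewrite -degm0 -mpolyX0 => /mhomog_degm. Qed.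

Definition phomog a p : S := \sum_(u <- msupp p | degm u == a) p@_u *: 'X_[u].

Lemma mcoeff_phomog a p u : (phomog a p)@_u = if degm u == a then p@_u else 0.
Proof.
rewrite /phomog raddf_sum /=; have [up|up] := boolP (u \in msupp p); last first.
  rewrite (memN_msupp_eq0 up) if_same big1_seq // => v /andP [_ vp].
  rewrite mcoeffZ mcoeffX; case: eqP => [vu|]; last by rewrite mulr0.
  by rewrite -vu vp in up.
rewrite big_mkcond (bigD1_seq u) ?msupp_uniq //= big1 => [|v vu].
  by rewrite addr0; case: eqP => // _; rewrite mcoeffZ mcoeffX eqxx mulr1.
by case: eqP => // _; rewrite mcoeffZ mcoeffX (negPf vu) mulr0.
Qed.

Lemma phomog_homog a p : mhomog a (phomog a p).
Proof. by move=> u; rewrite mcoeff_phomog; case: (degm u =P a) => // _; rewrite eqxx. Qed.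

Lemma phomog_id a p : mhomog a p -> phomog a p = p.
Proof.
move=> hp; apply/mpolyP => u; rewrite mcoeff_phomog; case: eqP => // ua.
by apply/eqP; rewrite eq_sym; apply/negPn/negP => /hp.
Qed.

Lemma phomog_neq a b p : mhomog a p -> a != b -> phomog b p = 0.
Proof.
move=> hp ab; apply/mpolyP => u; rewrite mcoeff_phomog mcoeff0.
case: eqP => // ub; apply/eqP; apply: contraNT ab => /hp <-.
by rewrite ub.
Qed.

Lemma phomogD a p q : phomog a (p + q) = phomog a p + phomog a q.
Proof.
apply/mpolyP => u; rewrite mcoeffD !mcoeff_phomog mcoeffD.
by case: eqP; rewrite ?addr0.
Qed.

Lemma phomog0 a : phomog a 0 = 0.
Proof. by rewrite phomog_id //; apply: mhomog0. Qed.

Lemma phomogZ a (k : K) p : phomog a (k *: p) = k *: phomog a p.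
Proof.
apply/mpolyP => u; rewrite mcoeffZ !mcoeff_phomog mcoeffZ.
by case: eqP; rewrite ?mulr0.
Qed.

Lemma phomog_sum a (T : Type) (r : seq T) (P : pred T) (F : T -> S) :
  phomog a (\sum_(i <- r | P i) F i) = \sum_(i <- r | P i) phomog a (F i).
Proof.
by apply: (big_morph (phomog a)) => [p q|]; [rewrite phomogD|rewrite phomog0].
Qed.

Lemma phomogM a b p q : mhomog b q -> phomog a (p * q) = phomog (a - b) p * q.
Proof.
move=> /mhomog_cases [->|[w <- ->]]; first by rewrite !mulr0 phomog0.
rewrite -!scalerAr phomogZ; congr (_ *: _).
apply/mpolyP => u; rewrite mcoeff_phomog !mcoeff_mulX.
case: (boolP (w <= u)%MM) => [le_wu|_]; last by rewrite if_same.
by rewrite mcoeff_phomog -{1}(submK le_wu) degmD (can2_eq (addrK _) (subrK _)).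
Qed.

Definition pdegs p : seq deg := undup (map (@degm n) (msupp p)).

(** The list [s] may be longer than [pdegs p], so that several polynomials, or
    the entries of a vector, can be decomposed along a common list. *)
Lemma phomog_decomp p (s : seq deg) : uniq s -> {subset pdegs p <= s} ->
  p = \sum_(a <- s) phomog a p.
Proof.
move=> us sub; apply/mpolyP => u; rewrite raddf_sum /=.
have [up|up] := boolP (u \in msupp p); last first.
  rewrite (memN_msupp_eq0 up) big1 // => a _.
  by rewrite mcoeff_phomog (memN_msupp_eq0 up) if_same.
rewrite (bigD1_seq (degm u)) ?sub ?mem_undup ?map_f //= mcoeff_phomog eqxx.
by rewrite big1 ?addr0 // => a ua; rewrite mcoeff_phomog eq_sym (negPf ua).
Qed.

Section Rows.
Variables (r : nat) (g : 'I_r -> deg).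
Implicit Types (x y : 'rV[S]_r).

(** Row vectors in the free module whose [j]-th basis vector has degree [g j]. *)
Definition rhomog a x : Prop := forall j, mhomog (a - g j) (x 0 j).
Definition hrow a x : 'rV[S]_r := \row_j phomog (a - g j) (x 0 j).

Lemma hrow_homog a x : rhomog a (hrow a x).
Proof. by move=> j; rewrite mxE; apply: phomog_homog. Qed.

Lemma hrow_id a x : rhomog a x -> hrow a x = x.
Proof. by move=> hx; apply/rowP => j; rewrite mxE phomog_id. Qed.

Lemma hrow0 a : hrow a 0 = 0.
Proof. by apply/rowP => j; rewrite !mxE phomog0. Qed.

Definition rdegs x : seq deg :=
  undup (flatten [seq [seq a + g j | a <- pdegs (x 0 j)] | j <- enum 'I_r]).

Lemma mem_rdegs a j x : a - g j \in pdegs (x 0 j) -> a \in rdegs x.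
Proof.
move=> h; rewrite mem_undup; apply/flattenP.
exists [seq a + g j | a <- pdegs (x 0 j)]; first by apply: map_f; rewrite mem_enum.
by apply/mapP; exists (a - g j) => //; rewrite subrK.
Qed.

Lemma hrow_decomp x (s : seq deg) : uniq s -> {subset rdegs x <= s} ->
  x = \sum_(a <- s) hrow a x.
Proof.
move=> us sub; apply/rowP => j; rewrite summxE.
under eq_bigr do rewrite mxE.
rewrite {1}(@phomog_decomp (x 0 j) [seq a - g j | a <- s]).
- by rewrite big_map.
- by rewrite map_inj_uniq //; apply: addIr.
move=> a ha; apply/mapP; exists (a + g j); last by rewrite addrK.
by apply: sub; apply: (@mem_rdegs _ j); rewrite addrK.
Qed.

End Rows.

(** The matrices that represent degree-preserving maps, by right
    multiplication, between the free modules with generator degrees [g] and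
    [h]. *)
Definition hmx r s (g : 'I_r -> deg) (h : 'I_s -> deg) (A : 'M[S]_(r, s)) : Prop :=
  forall i j, mhomog (g i - h j) (A i j).

Section HomogeneousMatrices.
Variables (r s t : nat) (g : 'I_r -> deg) (h : 'I_s -> deg) (l : 'I_t -> deg).

Lemma hmx_row (A : 'M[S]_(r, s)) i : hmx g h A -> rhomog h (g i) (row i A).
Proof. by move=> hA j; rewrite mxE. Qed.

Lemma hmxD (A B : 'M[S]_(r, s)) : hmx g h A -> hmx g h B -> hmx g h (A + B).
Proof. by move=> hA hB i j; rewrite mxE; apply: mhomogD. Qed.

Lemma hmxN (A : 'M[S]_(r, s)) : hmx g h A -> hmx g h (- A).
Proof. by move=> hA i j; rewrite mxE; apply: mhomogN. Qed.

Lemma hmxB (A B : 'M[S]_(r, s)) : hmx g h A -> hmx g h B -> hmx g h (A - B).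
Proof. by move=> hA hB; apply: hmxD => //; apply: hmxN. Qed.

Lemma hmxM (A : 'M[S]_(r, s)) (B : 'M[S]_(s, t)) :
  hmx g h A -> hmx h l B -> hmx g l (A *m B).
Proof.
move=> hA hB i j; rewrite mxE; apply: mhomog_sum => k _.
by rewrite -(subrK (h k) (g i)) -addrA; apply: mhomogM.
Qed.

(** Homogeneous components commute with degree-preserving maps. Through this
    lemma every solution of a homogeneous linear system can be replaced by a
    homogeneous one. *)
Lemma hrow_mul (A : 'M[S]_(r, s)) a x :
  hmx g h A -> hrow h a (x *m A) = hrow g a x *m A.
Proof.
move=> hA; apply/rowP => j; rewrite !mxE phomog_sum; apply: eq_bigr => i _.
rewrite (phomogM _ _ (hA i j)) mxE; congr (phomog _ _ * _).
by rewrite opprB addrA addrNK.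
Qed.

End HomogeneousMatrices.

Lemma hmx1 r (g : 'I_r -> deg) : hmx g g (1%:M : 'M[S]_r).
Proof.
move=> i j; rewrite mxE; case: eqP => [->|_]; last exact: mhomog0.
by rewrite subrr; apply: mhomog1.
Qed.

End Degrees.

(** * Homogeneous lifts *)

Section LinearFacts.
Variables (R : nzRingType) (U V : lmodType R) (f : U -> V).
Hypothesis lf : linear f.

Lemma linfD x y : f (x + y) = f x + f y.
Proof. by have := lf 1 x y; rewrite !scale1r. Qed.

Lemma linf0 : f 0 = 0.
Proof. by apply: (addrI (f 0)); rewrite -linfD !addr0. Qed.

Lemma linfZ c x : f (c *: x) = c *: f x.
Proof. by have := lf c x 0; rewrite !addr0 linf0 addr0. Qed.

Lemma linfN x : f (- x) = - f x.
Proof. by rewrite -scaleN1r linfZ scaleN1r. Qed.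

Lemma linfB x y : f (x - y) = f x - f y.
Proof. by rewrite linfD linfN. Qed.

Lemma linf_sum (T : Type) (r : seq T) (P : pred T) (F : T -> U) :
  f (\sum_(i <- r | P i) F i) = \sum_(i <- r | P i) f (F i).
Proof. exact: (big_morph f linfD linf0). Qed.

End LinearFacts.

Section Lifting.
Variables (K : fieldType) (n : nat).
Local Notation S := {mpoly K[n]}.
Local Notation deg := (multideg n).

Lemma gpiece0 (M : gmodule K n) a : is_graded M -> gpiece a (0 : M).
Proof. by case=> /(_ a) []. Qed.

Lemma gpieceD (M : gmodule K n) a (x y : M) : is_graded M ->
  gpiece a x -> gpiece a y -> gpiece a (x + y).
Proof. by case=> /(_ a) [_ h] _ _ _; apply: h. Qed.

Lemma gpieceM (M : gmodule K n) a b p (x : M) : is_graded M ->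
  mhomog a p -> gpiece b x -> gpiece (a + b) (p *: x).
Proof. by case=> _ h _ _; apply: h. Qed.

Lemma gpieceN (M : gmodule K n) a (x : M) : is_graded M ->
  gpiece a x -> gpiece a (- x).
Proof.
move=> hM hx; rewrite -scaleN1r -[a]add0r; apply: gpieceM => //.
by apply: mhomogN; apply: mhomog1.
Qed.

Lemma gpiece_sum (M : gmodule K n) a (T : Type) (r : seq T) (P : pred T)
    (F : T -> M) : is_graded M ->
  (forall i, P i -> gpiece a (F i)) -> gpiece a (\sum_(i <- r | P i) F i).
Proof.
move=> hM h; elim/big_ind: _ => //; first exact: gpiece0.
by move=> x y; apply: gpieceD.
Qed.

Section Augmentation.
Variables (M : gmodule K n) (hM : is_graded M).
Variables (r : nat) (g : 'I_r -> deg) (e : 'rV[S]_r -> M).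
Hypotheses (le : linear e) (he : forall i, gpiece (g i) (e (delta_mx 0 i))).

Lemma aug_graded a v : rhomog g a v -> gpiece a (e v).
Proof.
move=> hv; rewrite (row_sum_delta v) (linf_sum le); apply: gpiece_sum => // i _.
by rewrite (linfZ le) -(subrK (g i) a); apply: gpieceM.
Qed.

(** A homogeneous element in the image of [e] is the image of a homogeneous
    vector, namely of the right component of any preimage. *)
Lemma aug_component a v : gpiece a (e v) -> e (hrow g a v) = e v.
Proof.
move=> hev; pose s := undup (a :: rdegs g v).
have us : uniq s by apply: undup_uniq.
have as_ : a \in s by rewrite mem_undup mem_head.
have sub : {subset rdegs g v <= s}.
  by move=> b hb; rewrite /s mem_undup inE hb orbT.
(* A vanishing sum of homogeneous elements: the components of [e v], with
   [e v] itself subtracted in degree [a]. *)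
pose y b := if b == a then e (hrow g a v) - e v else e (hrow g b v).
case: hM => _ _ _ /(_ s y us) ind.
have : y a = 0; last by rewrite /y eqxx => /subr0_eq.
apply: ind => // [b|].
  rewrite /y; case: eqP => [->|_]; last exact/aug_graded/hrow_homog.
  by apply: gpieceD => //; [exact/aug_graded/hrow_homog|apply: gpieceN].
have E : e v = \sum_(b <- s) e (hrow g b v).
  by rewrite -(linf_sum le) -hrow_decomp.
rewrite (bigD1_seq a) //= {1}/y eqxx addrAC; apply/eqP; rewrite subr_eq0 E.
rewrite [in X in _ == X](bigD1_seq a) //=; apply/eqP; congr (_ + _).
by apply: eq_bigr => b /negPf ba; rewrite /y ba.
Qed.

End Augmentation.

(** A factorization through a homogeneous matrix, row by row, can be made
    homogeneous: keep only the component of the right degree of each row. *)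
Lemma hmx_factor r s t (g : 'I_r -> deg) (h : 'I_s -> deg) (l : 'I_t -> deg)
    (A : 'M[S]_(r, t)) (B : 'M[S]_(s, t)) : hmx g l A -> hmx h l B ->
  (forall i, exists w, row i A = w *m B) ->
  exists2 F : 'M[S]_(r, s), hmx g h F & A = F *m B.
Proof.
move=> hA hB /choice [w wP]; exists (\matrix_(i, j) hrow h (g i) (w i) 0 j).
  by move=> i j; rewrite mxE; apply: hrow_homog.
apply/row_matrixP => i; rewrite row_mul -(hrow_id (hmx_row (i := i) hA)) wP.
rewrite (hrow_mul _ _ hB); congr (_ *m _).
by apply/rowP => j; rewrite !mxE.
Qed.

Lemma aug_factor (M : gmodule K n) (hM : is_graded M) r s
    (g : 'I_r -> deg) (h : 'I_s -> deg)
    (e0 : 'rV[S]_r -> M) (e : 'rV[S]_s -> M) :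
  linear e0 -> (forall i, gpiece (g i) (e0 (delta_mx 0 i))) ->
  linear e -> (forall i, gpiece (h i) (e (delta_mx 0 i))) ->
  (forall v, exists w, e w = e0 v) ->
  exists2 F : 'M[S]_(r, s), hmx g h F & forall v, e (v *m F) = e0 v.
Proof.
move=> l0 g0 le ge im.
have /choice [w wP] : forall i, exists w, e w = e0 (delta_mx 0 i) by move=> i.
exists (\matrix_(i, j) hrow h (g i) (w i) 0 j).
  by move=> i j; rewrite mxE; apply: hrow_homog.
move=> v; rewrite {2}(row_sum_delta v) mulmx_sum_row (linf_sum le) (linf_sum l0).
apply: eq_bigr => i _; rewrite (linfZ le) (linfZ l0); congr (_ *: _).
transitivity (e (hrow h (g i) (w i))).
  by congr e; apply/rowP => j; rewrite !mxE.
by rewrite -wP; apply: aug_component => //; rewrite wP.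
Qed.

(** The stages of a lift, of a homotopy or of a resolution have types that
    depend on the stage, and each is chosen after the previous one. *)
Lemma dependent_choice (T : nat -> Type) (P : forall k, T k -> Prop)
    (Q : forall k, T k -> T k.+1 -> Prop) (x0 : T 0%N) :
  P 0%N x0 -> (forall k x, P k x -> exists2 y, P k.+1 y & Q k x y) ->
  exists f : forall k, T k,
    [/\ f 0%N = x0, forall k, P k (f k) & forall k, Q k (f k) (f k.+1)].
Proof.
move=> P0 step.
have st k (x : {x : T k | P k x}) :
    {y : {y : T k.+1 | P k.+1 y} | Q k (sval x) (sval y)}.
  apply: cid; case: x => x Px; have [y Py Qxy] := step k x Px.
  by exists (exist _ y Py).
pose F := fix F k : {x : T k | P k x} :=
  match k with 0 => exist _ x0 P0 | k'.+1 => sval (st k' (F k')) end.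
exists (fun k => sval (F k)); split=> // k; first exact: (svalP (F k)).
exact: (svalP (st k (F k))).
Qed.

Lemma resolves_dif2 (M : gmodule K n) (Z : M -> Prop) (C : gfree K n)
    (e : 'rV[S]_(rk C 0) -> M) k :
  resolves Z e -> dif C k.+1 *m dif C k = 0.
Proof.
case=> _ _ _ _ ex; apply/row_matrixP => i; rewrite row_mul row0.
by apply/ex; exists (delta_mx 0 i); rewrite -rowE.
Qed.

Lemma resolves_aug_dif (M : gmodule K n) (Z : M -> Prop) (C : gfree K n)
    (e : 'rV[S]_(rk C 0) -> M) w :
  resolves Z e -> e (w *m dif C 0) = 0.
Proof. by case=> _ _ _ ex _; apply/ex; exists w. Qed.

Section Comparison.
Variables (M : gmodule K n) (hM : is_graded M).
Variables (Z Z' : M -> Prop) (C C' : gfree K n).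
Variables (e : 'rV[S]_(rk C 0) -> M) (e' : 'rV[S]_(rk C' 0) -> M).
Hypotheses (rC : resolves Z e) (rC' : resolves Z' e').

(** The comparison theorem: each stage of the lift only needs that the
    composite with the next differential lands in the right image. *)
Lemma lifting_exists : (forall x, Z x -> Z' x) ->
  exists f : forall k, 'M[S]_(rk C k, rk C' k), lifting e e' f.
Proof.
move=> ZZ'.
have [gC [le ge] eZ _ _] := rC.
have [gC' [le' ge'] eZ' ex0' ex'] := rC'.
have [f0 hf0 f0P] : exists2 F, hmx (gdeg C 0) (gdeg C' 0) F &
    forall v, e' (v *m F) = e v.
  by apply: aug_factor => // v; apply/eZ'/ZZ'/eZ; exists v.
pose P k (F : 'M[S]_(rk C k, rk C' k)) := hmx (gdeg C k) (gdeg C' k) F /\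
  forall w : 'rV_(rk C k.+1), exists w', w *m (dif C k *m F) = w' *m dif C' k.
pose Q k (F : 'M[S]_(rk C k, rk C' k)) G := dif C k *m F = G *m dif C' k.
have P0 : P 0%N f0.
  split=> // w; apply/ex0'; rewrite mulmxA f0P.
  exact: resolves_aug_dif rC.
have [k F [hF im]|f [ff0 Pf Qf]] := dependent_choice (Q := Q) P0.
  have [i|G hG GE] := hmx_factor (hmxM (@gC k) hF) (@gC' k).
    by rewrite rowE; apply: im.
  exists G => //; split=> // w; apply/ex'.
  rewrite -!mulmxA -GE (mulmxA (dif C k.+1)) (resolves_dif2 k rC).
  by rewrite mul0mx mulmx0.
by exists f; split=> [k|v|k]; [case: (Pf k)|rewrite ff0|apply: Qf].
Qed.

(** The difference of two lifts is killed by the augmentation, so exactness of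
    the target writes it stage by stage as a boundary, up to the part that the
    homotopy found before already accounts for. *)
Lemma lifting_homotopy (f1 f2 : forall k, 'M[S]_(rk C k, rk C' k)) :
  lifting e e' f1 -> lifting e e' f2 ->
  exists h : forall k, 'M[S]_(rk C k, rk C' k.+1),
    [/\ forall k, hmx (gdeg C k) (gdeg C' k.+1) (h k),
        f1 0%N - f2 0%N = h 0%N *m dif C' 0
      & forall k, f1 k.+1 - f2 k.+1 = dif C k *m h k + h k.+1 *m dif C' k.+1].
Proof.
move=> [h1 a1 c1] [h2 a2 c2].
have [gC [le ge] eZ _ _] := rC.
have [gC' [le' ge'] eZ' ex0' ex'] := rC'.
pose p k := f1 k - f2 k.
have hp k : hmx (gdeg C k) (gdeg C' k) (p k) by apply: hmxB; [apply: h1|apply: h2].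
have cp k : dif C k *m p k = p k.+1 *m dif C' k.
  by rewrite mulmxBr mulmxBl c1 c2.
pose P k (H : 'M[S]_(rk C k, rk C' k.+1)) := hmx (gdeg C k) (gdeg C' k.+1) H /\
  forall w : 'rV_(rk C k.+1), exists w', w *m (p k.+1 - dif C k *m H) = w' *m dif C' k.+1.
pose Q k (H : 'M[S]_(rk C k, rk C' k.+1)) G :=
  p k.+1 - dif C k *m H = G *m dif C' k.+1.
have [i|H0 hH0 H0E] := hmx_factor (hp 0%N) (@gC' 0%N).
  rewrite rowE; apply/ex0'; rewrite mulmxBr (linfB le') a1 a2 subrr //.
have P0 : P 0%N H0.
  split=> // w; apply/ex'.
  by rewrite -mulmxA mulmxBl -mulmxA -H0E cp subrr mulmx0.
have [k H [hH im]|h [hh0 Ph Qh]] := dependent_choice (Q := Q) P0.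
  have [i|G hG GE] := hmx_factor (hmxB (hp k.+1) (hmxM (@gC k) hH)) (@gC' k.+1).
    by rewrite rowE; apply: im.
  exists G => //; split=> // w; apply/ex'.
  rewrite -mulmxA mulmxBl -mulmxA -GE (mulmxBr (dif C k.+1)) (mulmxA _ _ H) (resolves_dif2 k rC).
  by rewrite mul0mx subr0 cp subrr mulmx0.
exists h; split=> [k||k]; [by case: (Ph k)|by rewrite hh0|].
by rewrite -(Qh k) [RHS]addrC subrK.
Qed.

End Comparison.

Lemma lifting_id (M : gmodule K n) (C : gfree K n) (e : 'rV[S]_(rk C 0) -> M) :
  lifting e e (fun k => 1%:M).
Proof.
split=> [k|v|k]; [exact: hmx1|by rewrite mulmx1|by rewrite mulmx1 mul1mx].
Qed.

Lemma lifting_comp (M : gmodule K n) (C C' C'' : gfree K n)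
    (e : 'rV[S]_(rk C 0) -> M) (e' : 'rV[S]_(rk C' 0) -> M)
    (e'' : 'rV[S]_(rk C'' 0) -> M) f f' :
  lifting e e' f -> lifting e' e'' f' -> lifting e e'' (fun k => f k *m f' k).
Proof.
move=> [h1 a1 c1] [h2 a2 c2]; split=> [k|v|k].
- exact: hmxM (h1 k) (h2 k).
- by rewrite mulmxA a2 a1.
by rewrite mulmxA c1 -mulmxA c2 mulmxA.
Qed.

End Lifting.

(** * Betti numbers do not depend on the resolution *)

(** If [F] maps the pair of spaces (Z, B) to (Z', B'), [G] maps B' back into B
    and [F *m G] is the identity of Z modulo B, then Z / B embeds in Z' / B'. *)
Lemma subquotient_rank (K : fieldType) (r s p q p' q' : nat)
    (Z : 'M[K]_(p, r)) (B : 'M[K]_(q, r)) (Z' : 'M[K]_(p', s))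
    (B' : 'M[K]_(q', s)) (F : 'M[K]_(r, s)) (G : 'M[K]_(s, r)) :
  (B' <= Z')%MS -> (Z *m F <= Z')%MS -> (B' *m G <= B)%MS ->
  (Z *m F *m G - Z <= B)%MS ->
  (\rank Z - \rank B <= \rank Z' - \rank B')%N.
Proof.
move=> B'Z' ZF BG ZFG.
have cokE t v (X : 'M[K]_(t, v)) (Y : 'M_(1, v)) :
  Y *m cokermx X = 0 -> (Y <= X)%MS by move/eqP; rewrite submxE.
apply: (@leq_trans (\rank (Z *m (F *m cokermx B')))); last first.
  apply: (@leq_trans (\rank (Z' *m cokermx B'))).
    by rewrite mulmxA mxrankS // submxMr.
  rewrite -(mxrank_mul_ker Z' (cokermx B')) leq_subRL; last first.
    by rewrite mxrank_mul_ker mxrankS.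
  rewrite addnC leq_add2l mxrankS // sub_capmx B'Z'.
  by apply/sub_kermxP; apply: mulmx_coker.
rewrite leq_subLR -(mxrank_mul_ker Z (F *m cokermx B')) addnC leq_add2r mxrankS //.
apply/rV_subP => z; rewrite sub_capmx => /andP [zZ /sub_kermxP].
rewrite mulmxA => /cokE zF.
have zFG : (z *m F *m G <= B)%MS by apply: submx_trans BG; apply: submxMr.
have /submxP [y zE] := zZ.
have zB : (z *m F *m G - z <= B)%MS.
  apply: submx_trans ZFG.
  by rewrite zE -!mulmxA -mulmxBr submxMl.
by rewrite -[z]opprK eqmx_opp -[- z](addKr (z *m F *m G)) addmx_sub // eqmx_opp.
Qed.

Section Tor.
Variables (K : fieldType) (n : nat).
Local Notation S := {mpoly K[n]}.
Local Notation deg := (multideg n).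
Local Notation red := (map_mx (mcoeff (0%MM : 'X_{1..n}))).
Implicit Types (C : gfree K n) (M : gmodule K n).

Definition deg_diag r (g : 'I_r -> deg) a : 'M[K]_r :=
  diag_mx (\row_i (g i == a)%:R).

Lemma redM r s t (A : 'M[S]_(r, s)) (B : 'M[S]_(s, t)) :
  red (A *m B) = red A *m red B.
Proof. exact: map_mxM. Qed.

(** Reducing a homogeneous matrix modulo the variables keeps only its unit
    entries, and these join generators of equal degree. *)
Lemma red_homog r s (g : 'I_r -> deg) (h : 'I_s -> deg) (A : 'M[S]_(r, s)) a :
  hmx g h A -> deg_diag g a *m red A = red A *m deg_diag h a.
Proof.
move=> hA; apply/matrixP => i j; rewrite mul_diag_mx mul_mx_diag !mxE.
have [/eqP E|] := boolP (g i - h j == 0).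
  by rewrite (subr0_eq E) mulrC.
by move=> /(mhomog_coef0 (hA i j)) ->; rewrite mulr0 mul0r.
Qed.

Lemma rank_deg_diag r (g : 'I_r -> deg) a :
  \rank (deg_diag g a) = #|[set i | g i == a]|.
Proof.
(* The rank is at most the number of nonzero diagonal entries; as the
   complementary diagonal matrix obeys the same bound and the two add up to the
   identity, equality holds. *)
have bound (P : {set 'I_r}) : (\rank (diag_mx (\row_i (i \in P)%:R) : 'M[K]_r) <= #|P|)%N.
  pose A : 'M[K]_(r, #|P|) := \matrix_(i, k) (i == enum_val k)%:R.
  have -> : diag_mx (\row_i (i \in P)%:R) = A *m A^T.
    apply/matrixP => i j; rewrite !mxE.
    under eq_bigr do rewrite !mxE.
    case: (boolP (i \in P)) => iP; last first.
      rewrite mul0rn big1 // => k _; case: eqP => [E|]; last by rewrite mul0r.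
      by rewrite E enum_valP in iP.
    rewrite (bigD1 (enum_rank_in iP i)) //= enum_rankK_in // eqxx mul1r.
    rewrite big1 ?addr0 => [|k nk]; first by rewrite eq_sym -mulr_natr mul1r.
    case: eqP => [E|]; last by rewrite mul0r.
    by case/eqP: nk; apply: enum_val_inj; rewrite enum_rankK_in.
  exact: leq_trans (mxrankM_maxl _ _) (rank_leq_col _).
pose P := [set i | g i == a].
have -> : deg_diag g a = diag_mx (\row_i (i \in P)%:R).
  by congr diag_mx; apply/rowP => i; rewrite !mxE inE.
apply/eqP; rewrite eqn_leq bound /=.
have : (r <= \rank (diag_mx (\row_i (i \in P)%:R) : 'M[K]_r) + #|~: P|)%N.
  apply: leq_trans (leq_add (leqnn _) (bound (~: P))).
  apply: leq_trans (mxrank_add _ _).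
  rewrite -[X in (X <= _)%N](mxrank1 K r) eq_leq //.
  apply: (congr1 (fun A : 'M_r => \rank A)).
  apply/matrixP => i j; rewrite !mxE in_setC.
  by case: (i \in P); rewrite ?mul0rn ?addr0 ?add0r.
by rewrite -[X in (X <= _)%N](card_ord r) -(cardsC P) leq_add2r.
Qed.

Lemma deg_partE C k a : deg_part C k a = deg_diag (gdeg C k) a.
Proof. by []. Qed.

Lemma boundaries_sub_cycles C M Z (e : 'rV[S]_(rk C 0) -> M) k a :
  resolves Z e -> (boundaries C k a <= cycles C k a)%MS.
Proof.
move=> rC; have [gC _ _ _ _] := rC.
have deg_sub : (boundaries C k a <= deg_part C k a)%MS.
  by rewrite /boundaries deg_partE (red_homog _ (@gC k)) submxMl.
case: k deg_sub => // k deg_sub; rewrite /= sub_capmx deg_sub.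
apply/sub_kermxP; rewrite /boundaries -mulmxA /red_dif -redM.
by rewrite (resolves_dif2 k rC) map_mx0 mulmx0.
Qed.

(** The lifts in both directions compose to a map homotopic to the identity,
    so the homology of the first reduced complex embeds in that of the second. *)
Lemma homology_dim_le M C C' (e : 'rV[S]_(rk C 0) -> M)
    (e' : 'rV[S]_(rk C' 0) -> M) k a :
  is_graded M -> resolution e -> resolution e' ->
  (homology_dim C k a <= homology_dim C' k a)%N.
Proof.
move=> hM rC rC'.
have [gC _ _ _ _] := rC; have [gC' _ _ _ _] := rC'.
have [f lf] := lifting_exists hM rC rC' (fun _ => id).
have [f' lf'] := lifting_exists hM rC' rC (fun _ => id).
have [h [hh h0 hS]] :=
  lifting_homotopy rC rC (lifting_comp lf lf') (lifting_id e).
have [hf _ cf] := lf; have [hf' _ cf'] := lf'.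
apply: (@subquotient_rank _ _ _ _ _ _ _ _ _ _ _ (red (f k)) (red (f' k))).
- exact: boundaries_sub_cycles rC'.
- have deg_sub : (cycles C k a *m red (f k) <= deg_part C' k a)%MS.
    apply: submx_trans (_ : deg_part C k a *m red (f k) <= _)%MS.
      by apply: submxMr; case: k => //= k; apply: capmxSl.
    by rewrite deg_partE (red_homog _ (@hf k)) submxMl.
  case: k deg_sub => // k deg_sub; rewrite /= sub_capmx deg_sub.
  apply/sub_kermxP; rewrite -mulmxA /red_dif -redM -cf redM mulmxA.
  by rewrite (sub_kermxP (capmxSr _ _)) mul0mx.
- rewrite /boundaries -mulmxA /red_dif -redM cf' redM mulmxA.
  by rewrite deg_partE (red_homog _ (@hf' _)) -mulmxA submxMl.
rewrite -mulmxA -redM -[X in _ - X]mulmx1 -mulmxBr.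
have -> : red (f k *m f' k) - 1%:M = red (f k *m f' k - 1%:M).
  by rewrite map_mxB map_mx1.
have into_bound t (Y : 'M[K]_(t, rk C k)) : (Y <= deg_part C k a)%MS ->
    (Y *m red (h k *m dif C k) <= boundaries C k a)%MS.
  move=> /submxP [D ->]; rewrite redM -mulmxA (mulmxA (deg_part C k a)).
  by rewrite deg_partE (red_homog _ (@hh k)) -!mulmxA !mulmxA -mulmxA submxMl.
case: k into_bound => [|k] into_bound; first by rewrite h0; apply: into_bound.
rewrite hS map_mxD mulmxDr redM mulmxA.
rewrite (sub_kermxP (capmxSr _ _)) mul0mx add0r.
by apply: into_bound; apply: capmxSl.
Qed.

Lemma betti_resolution M C (e : 'rV[S]_(rk C 0) -> M) k a :
  is_graded M -> resolution e -> betti M (Posz k) a = homology_dim C k a.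
Proof.
move=> hM rC; rewrite /betti.
have [|C' [e' [rC' ->]]] := @classical_sets.xgetPex _ 0%N
    (fun b => exists (C : gfree K n) (e : 'rV[S]_(rk C 0) -> M),
       resolution e /\ b = homology_dim C k a).
  by exists (homology_dim C k a), C, e.
by apply/eqP; rewrite eqn_leq (homology_dim_le _ _ hM rC' rC)
  (homology_dim_le _ _ hM rC rC').
Qed.

Definition gens C k a : nat := #|[set i | gdeg C k i == a]|.

Lemma gensE C k a : gens C k a = (\sum_i (gdeg C k i == a))%N.
Proof.
rewrite /gens cardsE -sum1_card big_mkcond /=; apply: eq_bigr => i _.
by rewrite (_ : (i \in _) = (gdeg C k i == a)) //; case: (_ == _).
Qed.

(** For a minimal complex the reduced differentials vanish. *)
Lemma minimal_homology_dim C k a : minimal C -> homology_dim C k a = gens C k a.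
Proof.
move=> mC; have red0 j : red_dif C j = 0.
  by apply/matrixP => i l; rewrite !mxE mC.
rewrite /homology_dim /boundaries red0 mulmx0 mxrank0 subn0 /gens -rank_deg_diag.
case: k => // k /=; rewrite red0; apply: eqmx_rank; apply/eqmxP.
rewrite -[X in (_ :=: X)%MS]capmx1; by apply: cap_eqmx => //; apply: kermx0.
Qed.

Lemma betti_minimal M C (e : 'rV[S]_(rk C 0) -> M) k a :
  is_graded M -> minimal_resolution e -> betti M (Posz k) a = gens C k a.
Proof.
move=> hM [rC mC]; rewrite (betti_resolution _ _ hM rC).
exact: minimal_homology_dim.
Qed.

(** A resolution, minimal or not, whose generators all satisfy [Q] forces [Q]
    on the generators of every minimal resolution of the same module. *)
Lemma minimal_gens_degrees M C C' (e : 'rV[S]_(rk C 0) -> M)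
    (e' : 'rV[S]_(rk C' 0) -> M) (Q : deg -> Prop) k :
  is_graded M -> minimal_resolution e -> resolution e' ->
  (forall i, Q (gdeg C' k i)) -> forall i, Q (gdeg C k i).
Proof.
move=> hM mC rC' hQ i; apply: contrapT => nQ.
have : (0 < gens C k (gdeg C k i))%N by apply/card_gt0P; exists i; rewrite inE.
rewrite -(betti_minimal _ _ hM mC) (betti_resolution _ _ hM rC').
have D0 : deg_part C' k (gdeg C k i) = 0.
  rewrite /deg_part; apply/matrixP => j l; rewrite !mxE.
  by case: eqP => [E|]; [case: nQ; rewrite -E|rewrite mul0rn].
have : (\rank (cycles C' k (gdeg C k i)) <= \rank (deg_part C' k (gdeg C k i)))%N.
  by apply: mxrankS; case: k {hQ i nQ D0} (gdeg C k i) => //= k a; apply: capmxSl.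
by rewrite D0 mxrank0 leqn0 /homology_dim => /eqP ->; rewrite sub0n.
Qed.

End Tor.

(** * Minimal resolutions with squarefree generator degrees *)

(** Over a field every linear subspace of row vectors is a row space: take a
    matrix of maximal rank among those whose row space it contains. *)
Lemma subspace_matrix (K : fieldType) r (P : 'rV[K]_r -> Prop) :
  P 0 -> (forall c x y, P x -> P y -> P (c *: x + y)) ->
  exists A : 'M[K]_r, forall x, P x <-> (x <= A)%MS.
Proof.
move=> P0 Plin; pose ok (A : 'M[K]_r) := forall x : 'rV_r, (x <= A)%MS -> P x.
pose Q k := `[< exists2 A, ok A & \rank A = k >].
have exQ : exists k, Q k.
  exists 0%N; apply/asboolP; exists 0; last by rewrite mxrank0.
  by move=> x; rewrite submx0 => /eqP ->.
have boundQ k : Q k -> (k <= r)%N by move/asboolP=> [A _ <-]; apply: rank_leq_row.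
case: (ex_maxnP exQ boundQ) => k /asboolP [A okA rA] maxk.
exists A => x; split=> [Px|]; last exact: okA.
have okAx : ok (A + x)%MS.
  move=> y /sub_addsmxP [[u v] /= ->]; rewrite addrC.
  have -> : v *m x = v 0 0 *: x.
    by rewrite [v]mx11_scalar mul_scalar_mx mxE eqxx mulr1n.
  by apply: Plin => //; apply/okA/submxMl.
have : (\rank (A + x)%MS <= \rank A)%N.
  by rewrite rA; apply: maxk; apply/asboolP; exists (A + x)%MS.
move=> le; apply: submx_trans (addsmxSr A x) _.
by have := mxrank_leqif_sup (addsmxSl A x) => -[_ <-]; rewrite eqn_leq le mxrankS ?addsmxSl.
Qed.

Section Squarefree.
Variables (K : fieldType) (n : nat).
Local Notation S := {mpoly K[n]}.
Local Notation deg := (multideg n).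
Implicit Types (s t : {set 'I_n}) (u : 'X_{1..n}).

Definition sqf s : 'X_{1..n} := [multinom (i \in s : nat) | i < n].
Definition sqfdeg r (s : 'I_r -> {set 'I_n}) (i : 'I_r) : deg := degm (sqf (s i)).

Lemma sqfE s i : sqf s i = (i \in s) :> nat.
Proof. by rewrite mnmE. Qed.

Lemma sqf0 : sqf set0 = 0%MM.
Proof. by apply/mnmP => i; rewrite sqfE inE mnm0E. Qed.

Lemma degm_sub u (v w : 'X_{1..n}) : degm u - degm v = degm w -> (v <= u)%MM /\ w = (u - v)%MM.
Proof.
move=> /eqP; rewrite subr_eq -degmD => /eqP /degm_inj ->.
by rewrite lem_addl addmK.
Qed.

Lemma mhomog_sub u (v : 'X_{1..n}) (p : S) : mhomog (degm u - degm v) p ->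
  p = (if (v <= u)%MM then p@_(u - v)%MM else 0) *: 'X_[(u - v)%MM].
Proof.
move=> hp; case: (mhomog_cases hp) => [->|[a /esym /degm_sub [-> <-]] //].
by rewrite mcoeff0 if_same scale0r.
Qed.

(** A graded submodule of a free module with generators in squarefree degrees
    supported in [T] is [determined] when dividing by a variable [i] is
    possible in every degree that is not itself squarefree and supported in [T]
    at [i]. Such a submodule is generated in the finitely many squarefree
    degrees supported in [T], and kernels inherit the property. *)
Record determined (T : {set 'I_n}) r (s : 'I_r -> {set 'I_n})
    (Z : 'rV[S]_r -> Prop) : Prop := Determined {
  det_sub : forall j, s j \subset T;
  det0 : Z 0;
  detD : forall x y, Z x -> Z y -> Z (x + y);
  detZ : forall p x, Z x -> Z (p *: x);
  det_graded : forall a x, Z x -> Z (hrow (sqfdeg s) a x);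
  det_div : forall u i x, (i \notin T) || (0 < u i)%N -> Z x ->
    rhomog (sqfdeg s) (degm (u + U_(i))%MM) x ->
    exists x', [/\ Z x', rhomog (sqfdeg s) (degm u) x' & x = 'X_i *: x'] }.

Definition generates (T : {set 'I_n}) r (s : 'I_r -> {set 'I_n})
    (Z : 'rV[S]_r -> Prop) r' (s' : 'I_r' -> {set 'I_n}) (D : 'M[S]_(r', r)) :=
  [/\ forall j, s' j \subset T, hmx (sqfdeg s') (sqfdeg s) D
    & forall x, Z x <-> exists w, x = w *m D].

Section OneStep.
Variables (T : {set 'I_n}) (r : nat) (s : 'I_r -> {set 'I_n}).
Variable Z : 'rV[S]_r -> Prop.
Hypothesis dZ : determined T s Z.

(** A homogeneous vector of degree [sqf t] is given by one scalar for each basis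
    vector whose degree divides [sqf t]. *)
Definition homogenize t (c : 'rV[K]_r) : 'rV[S]_r :=
  \row_j ((if s j \subset t then c 0 j else 0) *: 'X_[(sqf t - sqf (s j))%MM]).

Lemma sqf_le s1 s2 : (sqf s1 <= sqf s2)%MM = (s1 \subset s2).
Proof.
apply/mnm_lepP/subsetP => h i; last first.
  by rewrite !sqfE; case: (boolP (i \in s1)) => // /h ->.
by move=> i1; have := h i; rewrite !sqfE i1 lt0b.
Qed.

Lemma homogenize_lin t k c c' :
  homogenize t (k *: c + c') = k%:MP *: homogenize t c + homogenize t c'.
Proof.
apply/rowP => j; rewrite !mxE mul_mpolyC scalerA -scalerDl; congr (_ *: _).
by case: ifP; rewrite ?mulr0 ?addr0.
Qed.

Lemma homogenize0 t : homogenize t 0 = 0.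
Proof. by apply/rowP => j; rewrite !mxE if_same scale0r. Qed.

Lemma homogenize_homog t c : rhomog (sqfdeg s) (degm (sqf t)) (homogenize t c).
Proof.
move=> j; rewrite mxE; case: ifP => [st|_]; last by rewrite scale0r; apply: mhomog0.
have E : sqf t = (sqf t - sqf (s j) + sqf (s j))%MM by rewrite submK // sqf_le.
by apply: mhomogZ; rewrite /sqfdeg {1}E degmD addrK; apply: mhomogX.
Qed.

Lemma homogenize_surj t x : rhomog (sqfdeg s) (degm (sqf t)) x ->
  exists c, x = homogenize t c.
Proof.
move=> hx; exists (\row_j (x 0 j)@_(sqf t - sqf (s j))%MM).
apply/rowP => j; rewrite !mxE {1}(mhomog_sub (hx j)) sqf_le.
by congr (_ *: _).
Qed.

(** As long as a degree is not squarefree with support in [T], some variable can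
    be divided out. *)
Lemma homog_span u x : Z x -> rhomog (sqfdeg s) (degm u) x ->
  exists t (p : S) y, [/\ t \subset T, Z y, rhomog (sqfdeg s) (degm (sqf t)) y
                     & x = p *: y].
Proof.
have [k] := ubnP (mdeg u); elim: k u x => // k IH u x ltk Zx hx.
have [/existsP [i]|] := boolP [exists i, ((i \notin T) && (0 < u i)%N) || (1 < u i)%N].
  move=> hi; have u0 : (0 < u i)%N by case/orP: hi => [/andP []//|]; apply: ltnW.
  have uE : u = (u - U_(i) + U_(i))%MM by rewrite submK // lep1mP -lt0n.
  have hi' : (i \notin T) || (0 < (u - U_(i))%MM i)%N.
    by rewrite mnmBE mnm1E eqxx subn_gt0; case/orP: hi => [/andP [->]|->] //; rewrite orbT.
  rewrite uE in hx; have [y [Zy hy ->]] := det_div dZ hi' Zx hx.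
  have [|t [p [z [tT Zz hz ->]]]] := IH _ _ _ Zy hy.
    by move: ltk; rewrite {1}uE mdegD mdeg1 addn1 ltnS.
  by exists t, ('X_i * p), z; split=> //; rewrite scalerA.
move=> /existsPn small; exists [set i | (0 < u i)%N], 1, x.
have -> : sqf [set i | (0 < u i)%N] = u.
  apply/mnmP => i; rewrite sqfE inE.
  have := small i; rewrite negb_or -leqNgt => /andP [_].
  by case: (u i) => [|[|]].
split=> //; last by rewrite scale1r.
apply/subsetP => i; rewrite inE => ui; have := small i.
by rewrite ui andbT negb_or negbK => /andP [].
Qed.

(** Generators: for each support, a matrix that spans the space of scalars of the
    elements in that degree. *)
Lemma determined_fg : exists r' (s' : 'I_r' -> {set 'I_n}) D, @generates T r s Z r' s' D.
Proof.
have /choice [A AP] : forall t, exists A : 'M[K]_r,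
    forall c : 'rV_r, Z (homogenize t c) <-> (c <= A)%MS.
  move=> t; apply: subspace_matrix => [|k x y Zx Zy].
    by rewrite homogenize0; apply: det0 dZ.
  by rewrite homogenize_lin; apply: (detD dZ) => //; apply: (detZ dZ).
pose I := ({set 'I_n} * 'I_r)%type.
pose st (i : 'I_#|{: I}|) := (enum_val i).1 :&: T.
pose rw (i : 'I_#|{: I}|) := homogenize (st i) (row (enum_val i).2 (A (st i))).
have Zrw i : Z (rw i) by apply/AP/row_sub.
have Zsum (J : Type) (q : seq J) (F : J -> 'rV[S]_r) :
    (forall j, Z (F j)) -> Z (\sum_(j <- q) F j).
  by move=> ZF; elim/big_ind: _ => //; [exact: det0 dZ|apply: detD dZ].
exists #|{: I}|, st, (\matrix_(i, j) rw i 0 j); split.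
- by move=> i; apply: subsetIr.
- by move=> i j; rewrite mxE; apply: homogenize_homog.
move=> x; split=> [Zx|[w ->]]; last first.
  rewrite mulmx_sum_row; apply: Zsum => i; apply: (detZ dZ).
  by have -> : row i (\matrix_(i, j) rw i 0 j) = rw i; [apply/rowP => j; rewrite !mxE|].
pose inD (x : 'rV[S]_r) := exists w, x = w *m \matrix_(i, j) rw i 0 j.
have inDD y z : inD y -> inD z -> inD (y + z).
  by move=> [v ->] [w ->]; exists (v + w); rewrite mulmxDl.
have inDZ p y : inD y -> inD (p *: y).
  by move=> [v ->]; exists (p *: v); rewrite scalemxAl.
have inD0 : inD 0 by exists 0; rewrite mul0mx.
have inDrw i : inD (rw i).
  by exists (delta_mx 0 i); rewrite -rowE; apply/rowP => j; rewrite !mxE.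
change (inD x); have us : uniq (rdegs (sqfdeg s) x) by apply: undup_uniq.
rewrite (hrow_decomp us (fun _ => id)).
apply: (big_ind inD) => // a _.
have Zy : Z (hrow (sqfdeg s) a x) by apply: (det_graded dZ).
have hy := @hrow_homog K n r (sqfdeg s) a x.
move: (hrow _ _ _) Zy hy => y Zy hy.
(* A degree in which some nonzero component exists is nonnegative, since the
   generator degrees are. *)
have [[j yj]|y0] := pselect (exists j, y 0 j != 0); last first.
  suff -> : y = 0 by [].
  apply/rowP => j; rewrite mxE; apply/eqP/negPn/negP => yj.
  by apply: y0; exists j.
have [yj0|[u ua _]] := mhomog_cases (hy j); first by rewrite yj0 eqxx in yj.
have aE : a = degm (u + sqf (s j))%MM by rewrite degmD ua subrK.
rewrite aE in hy; have [t [p [z [tT Zz hz ->]]]] := homog_span Zy hy.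
apply: (inDZ); have [c zE] := homogenize_surj hz; rewrite {z}zE in Zz hz |- *.
have /submxP [w ->] := (AP t c).1 Zz.
rewrite mulmx_sum_row.
apply: (big_rec (fun c => inD (homogenize t c))) => [|i c' _ IH]; first by rewrite homogenize0.
rewrite homogenize_lin; apply: (inDD) IH; apply: (inDZ).
have := inDrw (enum_rank (t, i)); rewrite /rw /st enum_rankK /=.
by move/setIidPl: tT => ->.
Qed.

(** With the least possible number of homogeneous generators no relation
    between them has a unit coefficient, since the generator could then be
    dropped. *)
Lemma minimal_generates : exists r' (s' : 'I_r' -> {set 'I_n}) D, @generates T r s Z r' s' D /\
  forall w : 'rV_r', w *m D = 0 -> forall i, (w 0 i)@_0%MM = 0.
Proof.
pose Q k := `[< exists (s' : 'I_k -> {set 'I_n}) D, @generates T r s Z k s' D >].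
have exQ : exists k, Q k.
  by have [k [s' [D h]]] := determined_fg; exists k; apply/asboolP; exists s', D.
case: (ex_minnP exQ) => k /asboolP [s' [D gD]] mink.
exists k, s', D; split=> // w wD i; apply/eqP/negPn/negP => wi.
have [s'T hD ZD] := gD.
(* The homogeneous component of the relation in the degree of the generator
   [i] has the constant coefficient of [w 0 i] as its [i]-th entry. *)
pose v := hrow (sqfdeg s') (sqfdeg s' i) w.
have vD : v *m D = 0 by rewrite -(hrow_mul _ _ hD) wD hrow0.
have vi : v 0 i = ((w 0 i)@_0%MM)%:MP.
  rewrite mxE subrr (mhomog_const (@phomog_homog K n _ _)) mcoeff_phomog degm0 eqxx.
  by rewrite -mul_mpolyC mulr1.
case: k s' D {mink} (mink k.-1) gD w wD i wi s'T hD ZD v vD vi => [|k] s' D mink gD w wD i wi.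
  by case: i wi.
move=> s'T hD ZD v vD vi; suff : (k.+1 <= k)%N by rewrite ltnn.
apply: mink; apply/asboolP; exists (s' \o lift i), (row' i D); split.
- by move=> j; apply: s'T.
- by move=> j l; rewrite mxE; apply: hD.
have E (x : 'rV[S]_k.+1) : x *m D = x 0 i *: row i D + (\row_j x 0 (lift i j)) *m row' i D.
  rewrite mulmx_sum_row; transitivity (x 0 i *: row i D +
    \sum_(j < k) x 0 (lift i j) *: row (lift i j) D); first exact: bigD1_ord.
  rewrite mulmx_sum_row; congr (_ + _); apply: eq_bigr => j _.
  by rewrite mxE; congr (_ *: _); apply/rowP => l; rewrite !mxE.
have rowiE : row i D = (- ((w 0 i)@_0%MM)^-1%:MP) *: ((\row_j v 0 (lift i j)) *m row' i D).
  have := E v; rewrite vD vi => /eqP; rewrite eq_sym addrC addr_eq0 => /eqP ->.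
  by rewrite scalerN scaleNr opprK scalerA -mpolyCM mulVf // scale1r.
move=> x; split=> [/ZD [y ->]|[y ->]]; last first.
  apply/ZD; exists (\row_j oapp (fun l => y 0 l) 0 (unlift i j)).
  rewrite E mxE unlift_none scale0r add0r; congr (_ *m _).
  by apply/rowP => j; rewrite !mxE liftK.
rewrite E rowiE scalerA scalemxAl -mulmxDl.
by eexists.
Qed.

End OneStep.

Lemma mhomog_div u (v : 'X_{1..n}) i (p : S) : (v i < u i)%N -> mhomog (degm u - degm v) p ->
  exists2 q, mhomog (degm u - degm (v + U_(i))%MM) q & p = 'X_i * q.
Proof.
move=> vu hp; have [vleu|nle] := boolP (v <= u)%MM; last first.
  exists 0; first exact: mhomog0.
  by rewrite (mhomog_sub hp) (negPf nle) scale0r mulr0.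
have le1 : (v + U_(i) <= u)%MM.
  apply/mnm_lepP => j; rewrite mnmDE mnm1E; case: eqP => [<-|_].
    by rewrite addn1.
  by rewrite addn0; apply/mnm_lepP.
exists (p@_(u - v)%MM *: 'X_[(u - (v + U_(i)))%MM]).
  by apply: mhomogZ; rewrite -{1}(submK le1) degmD addrK; apply: mhomogX.
rewrite -scalerAr -mpolyXD {1}(mhomog_sub hp) vleu; congr (_ *: 'X_[_]).
apply/mnmP => j; have := mnm_lepP le1 j.
rewrite !(mnmDE, mnmBE, mnm1E) => h.
by rewrite -{1}[u j](subnK h) addnA addnAC addnK addnC.
Qed.

(** An element of the kernel in a degree that exceeds at [i] all the generator
    degrees is divisible by the variable [i], and the quotient is again in the
    kernel since the polynomial ring is a domain. *)
Lemma kernel_determined (T : {set 'I_n}) r (s : 'I_r -> {set 'I_n}) r'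
    (s' : 'I_r' -> {set 'I_n}) (D : 'M[S]_(r', r)) :
  (forall j, s' j \subset T) -> hmx (sqfdeg s') (sqfdeg s) D ->
  determined T s' (fun w => w *m D = 0).
Proof.
move=> s'T hD; split=> //.
- by rewrite mul0mx.
- by move=> x y hx hy; rewrite mulmxDl hx hy addr0.
- by move=> p x hx; rewrite -scalemxAl hx scaler0.
- by move=> a x hx; rewrite -(hrow_mul _ _ hD) hx hrow0.
move=> u i x hi hx hom.
have lt j : (sqf (s' j) i < (u + U_(i))%MM i)%N.
  rewrite mnmDE mnm1E eqxx addn1 ltnS sqfE.
  case/orP: hi => [iT|ui]; last by apply: leq_trans ui; apply: leq_b1.
  by rewrite (negPf (contra (subsetP (s'T j) i) iT)).
have /choice [q qP] : forall j, exists q, mhomog (degm u - sqfdeg s' j) q /\ x 0 j = 'X_i * q.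
  move=> j; have [q hq ->] := mhomog_div (lt j) (hom j); exists q; split=> //.
  by move: hq; rewrite !degmD opprD addrACA addrN addr0.
have xE : x = 'X_i *: \row_j q j by apply/rowP => j; rewrite !mxE; case: (qP j).
exists (\row_j q j); split=> //; last by move=> j; rewrite mxE; case: (qP j).
move: hx; rewrite xE -scalemxAl => /matrixP h; apply/matrixP => a b.
have := h a b; rewrite !mxE => /eqP; rewrite mulf_eq0 => /orP [/eqP X0|/eqP //].
have : ('X_i : S)@_U_(i) = 1 by rewrite mcoeffX eqxx.
by rewrite X0 mcoeff0 => /esym /eqP; rewrite oner_eq0.
Qed.

(** A stage of the construction of a resolution: a free module with squarefree
    generator degrees and the submodule to be generated next. *)
Record state := State {
  st_rk : nat; st_deg : 'I_st_rk -> {set 'I_n}; st_rel : 'rV[S]_st_rk -> Prop }.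

(** Iterating the choice of minimal generators of the kernel. The first
    differential [D0] is kept apart from the complex [C] because its target is
    prescribed. *)
Lemma determined_resolution (T : {set 'I_n}) r (s : 'I_r -> {set 'I_n}) (Z : 'rV[S]_r -> Prop) :
  determined T s Z -> (forall x, Z x -> forall i, (x 0 i)@_0%MM = 0) ->
  exists (C : gfree K n) (D0 : 'M[S]_(rk C 0, r)),
    [/\ graded_gfree C /\ hmx (gdeg C 0) (sqfdeg s) D0,
        minimal C /\ forall i j, (D0 i j)@_0%MM = 0,
        forall k i, exists2 t : {set 'I_n}, t \subset T & gdeg C k i = degm (sqf t),
        (forall x, Z x <-> exists w, x = w *m D0) /\
        (forall v : 'rV_(rk C 0), v *m D0 = 0 <-> exists w, v = w *m dif C 0)
      & forall k (v : 'rV_(rk C k.+1)),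
          v *m dif C k = 0 <-> exists w, v = w *m dif C k.+1].
Proof.
move=> dZ mZ.
pose P (k : nat) (x : state) := determined T (@st_deg x) (@st_rel x) /\
  (forall y, @st_rel x y -> forall i, (y 0 i)@_0%MM = 0).
pose Q (k : nat) (x y : state) := exists D : 'M[S]_(st_rk y, st_rk x),
  generates T (@st_deg x) (@st_rel x) (@st_deg y) D /\
  @st_rel y = (fun w => w *m D = 0).
have step k x : P k x -> exists2 y, P k.+1 y & Q k x y.
  move=> [dx mx]; have [r' [s' [D [gD mD]]]] := minimal_generates dx.
  exists (State s' (fun w => w *m D = 0)); last by exists D.
  by split=> //=; case: gD => s'T hD _; apply: kernel_determined hD.
have [x1 P1 Q1] := step 0%N (State s Z) (conj dZ mZ).
have [f [f0 Pf Qf]] := dependent_choice (Q := fun=> Q 0%N) (P1 : P 0%N x1) step.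
have {Q1} : Q 0%N (State s Z) (f 0%N) by rewrite f0.
move=> [D0 [/= [sT hD0 ZD0] kD0]].
have D k := cid (Qf k).
have gD k : generates T (@st_deg (f k)) (@st_rel (f k)) (@st_deg (f k.+1)) (sval (D k)).
  by case: (svalP (D k)).
have rD k : @st_rel (f k.+1) = (fun w => w *m sval (D k) = 0).
  by case: (svalP (D k)).
pose C := GFree (fun k => sqfdeg (@st_deg (f k))) (fun k => sval (D k)).
exists C, D0; split.
- by split=> // k; case: (gD k).
- split=> [k i j|i j]; last first.
    have := mZ (row i D0) _ j; rewrite mxE; apply.
    by apply/ZD0; exists (delta_mx 0 i); rewrite -rowE.
  case: (Pf k) => _ mk; have := mk (row i (sval (D k))) _ j; rewrite mxE; apply.
  by case: (gD k) => _ _ ->; exists (delta_mx 0 i); rewrite -rowE.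
- move=> k i; exists (@st_deg (f k) i) => //.
  by case: (Pf k) => dk _; apply: (det_sub dk).
- split=> // v; case: (gD 0%N) => _ _ <-.
  by rewrite kD0.
move=> k v; case: (gD k.+1) => _ _ <-.
by rewrite rD.
Qed.

End Squarefree.

(** * Graded quotients and resolutions of sums of cyclic modules *)

Section Quotients.
Variables (R : nzRingType) (V : lmodType R) (W : V -> Prop).

Definition qcl (v : V) : mquot W := \pi_(mquot W) v.

Lemma qclE x : exists v, x = qcl v.
Proof. exact: mq_piE. Qed.

Lemma qcl_repr x : qcl (repr x) = x.
Proof. exact: reprK. Qed.

Lemma qcl_linear : linear qcl.
Proof.
move=> c u v; rewrite /qcl mq_piD; congr (_ + _).
by rewrite -mq_scale_pi.
Qed.

Record submodp : Prop := Submodp {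
  submod0 : W 0;
  submodD : forall u v, W u -> W v -> W (u + v);
  submodZ : forall c v, W v -> W (c *: v) }.

Hypothesis sW : submodp.

Lemma submodN v : W v -> W (- v).
Proof. by rewrite -scaleN1r; apply: submodZ. Qed.

Lemma submod_sum (T : Type) (r : seq T) (P : pred T) (F : T -> V) :
  (forall i, P i -> W (F i)) -> W (\sum_(i <- r | P i) F i).
Proof.
by move=> h; elim/big_ind: _ => //; [exact: submod0|exact: submodD].
Qed.

Lemma spanned_submod v : spanned W v <-> W v.
Proof.
split=> [[n [a [w [Ww ->]]]]|Wv]; last first.
  exists 1%N, (fun=> 1), (fun=> v); split=> //.
  by rewrite big_ord1 scale1r.
by apply: submod_sum => i _; apply: submodZ.
Qed.

Lemma qcl_eq u v : qcl u = qcl v <-> W (u - v).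
Proof. by rewrite -spanned_submod; apply: mq_piP. Qed.

Lemma qcl_eq0 v : qcl v = 0 <-> W v.
Proof. by rewrite -(linf0 qcl_linear) qcl_eq subr0. Qed.

End Quotients.

Lemma quotient_map (R : nzRingType) (V V' : lmodType R) (W : V -> Prop)
    (W' : V' -> Prop) (F : V -> V') :
  submodp W -> submodp W' -> linear F -> (forall v, W v -> W' (F v)) ->
  exists f : {linear mquot W -> mquot W'}, forall v, f (qcl W v) = qcl W' (F v).
Proof.
move=> sW sW' lF FW; pose f (x : mquot W) := qcl W' (F (repr x)).
have fE v : f (qcl W v) = qcl W' (F v).
  apply/(qcl_eq sW'); rewrite -(linfB lF); apply: FW; apply/(qcl_eq sW).
  exact: qcl_repr.
have lf : linear f.
  move=> c x y; have [u ->] := qclE x; have [v ->] := qclE y.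
  by rewrite -qcl_linear !fE lF qcl_linear.
pose fL := GRing.isLinear.Build R (mquot W) (mquot W') *:%R f lf.
pose g : {linear mquot W -> mquot W'} := HB.pack f fL.
by exists g.
Qed.

Section GradedQuotient.
Variables (K : fieldType) (n : nat).
Local Notation S := {mpoly K[n]}.
Local Notation deg := (multideg n).

(** A module with a grading given by its homogeneous elements and the
    projections onto the components. Working with projections makes gradedness
    of a quotient a matter of the relations being stable under them. *)
Record graded_lmod (V : lmodType S) (hmg : deg -> V -> Prop)
    (pr : deg -> V -> V) : Prop := GradedLmod {
  homog0 : forall a, hmg a 0;
  homogD : forall a x y, hmg a x -> hmg a y -> hmg a (x + y);
  homogZ : forall a b p x, mhomog a p -> hmg b x -> hmg (a + b) (p *: x);
  pr_homog : forall a x, hmg a (pr a x);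
  prD : forall a x y, pr a (x + y) = pr a x + pr a y;
  pr_id : forall a x, hmg a x -> pr a x = x;
  pr_neq : forall a b x, hmg a x -> a != b -> pr b x = 0;
  pr_decomp : forall x, exists s : seq deg, x = \sum_(a <- s) pr a x }.

Section PrFacts.
Variables (V : lmodType S) (hmg : deg -> V -> Prop) (pr : deg -> V -> V).
Hypothesis gV : graded_lmod hmg pr.

Lemma pr0 a : pr a 0 = 0.
Proof. by apply: (pr_id gV); apply: homog0 gV _. Qed.

Lemma pr_sum a (T : Type) (r : seq T) (P : pred T) (F : T -> V) :
  pr a (\sum_(i <- r | P i) F i) = \sum_(i <- r | P i) pr a (F i).
Proof. exact: (big_morph (pr a) (prD gV a) (pr0 a)). Qed.

Lemma graded_quotient (W : V -> Prop) : submodp W ->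
  (forall a x, W x -> W (pr a x)) ->
  is_graded (@GModule K n (mquot W)
               (fun a x => exists2 f : V, hmg a f & x = \pi_(mquot W) f)).
Proof.
move=> sW prW; split=> [a|a b p x hp [f hf ->]|x|s y us hy sum0] /=.
- split=> [|x y [f hf ->] [f' hf' ->]].
    by exists 0; [apply: homog0 gV _|rewrite -(linf0 (@qcl_linear _ _ W))].
  by exists (f + f'); [apply: (homogD gV)|rewrite mq_piD].
- by exists (p *: f); [apply: (homogZ gV)|rewrite -mq_scale_pi].
- have [f ->] := qclE x; have [s sE] := pr_decomp gV f.
  exists s, (fun a => qcl W (pr a f)); split.
    by move=> a; exists (pr a f) => //; apply: (pr_homog gV).
  by rewrite -(linf_sum (@qcl_linear _ _ W)) -sE.
have /choice [f fP] : forall a, exists f, hmg a f /\ y a = qcl W f.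
  by move=> a; have [f hf yf] := hy a; exists f.
move=> b bs; have [hb ->] := fP b; apply/(qcl_eq0 sW).
have {sum0} : qcl W (\sum_(a <- s) f a) = 0.
  rewrite (linf_sum (@qcl_linear _ _ W)) -[RHS]sum0; apply: eq_bigr => a _.
  by case: (fP a).
move=> /(qcl_eq0 sW) /(prW b); rewrite pr_sum (bigD1_seq b) //=.
rewrite (pr_id gV hb) big1 ?addr0 // => a ab.
by apply: (pr_neq gV (fP a).1).
Qed.

End PrFacts.

Lemma poly_graded : @graded_lmod S^o (@mhomog K n) (@phomog K n).
Proof.
split.
- exact: mhomog0.
- exact: mhomogD.
- by move=> a b p x; apply: mhomogM.
- exact: phomog_homog.
- exact: phomogD.
- exact: phomog_id.
- exact: phomog_neq.
- by move=> p; exists (pdegs p); apply: phomog_decomp; rewrite ?undup_uniq.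
Qed.

Section Families.
Variables (U : finType) (sh : U -> deg).

Definition fhomog (a : deg) (f : {ffun U -> S^o}) : Prop :=
  forall u, mhomog (a - sh u) (f u).
Definition fpr (a : deg) (f : {ffun U -> S^o}) : {ffun U -> S^o} :=
  [ffun u => phomog (a - sh u) (f u)].

Lemma family_graded : @graded_lmod {ffun U -> S^o} fhomog fpr.
Proof.
split.
- by move=> a u; rewrite ffunE; apply: mhomog0.
- by move=> a f g hf hg u; rewrite ffunE; apply: mhomogD.
- by move=> a b p f hp hf u; rewrite ffunE -addrA; apply: mhomogM.
- by move=> a f u; rewrite ffunE; apply: phomog_homog.
- by move=> a f g; apply/ffunP => u; rewrite !ffunE phomogD.
- by move=> a f hf; apply/ffunP => u; rewrite !ffunE phomog_id.
- move=> a b f hf ab; apply/ffunP => u; rewrite !ffunE (phomog_neq (hf u)) //.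
  by rewrite (can_eq (subrK _)).
move=> f; pose s := undup (flatten [seq [seq a + sh u | a <- pdegs (f u : S)] | u <- enum U]).
exists s; apply/ffunP => u; rewrite sum_ffunE.
under eq_bigr do rewrite ffunE.
rewrite {1}(@phomog_decomp K n (f u) [seq a - sh u | a <- s]).
- by rewrite big_map.
- by rewrite map_inj_uniq ?undup_uniq //; apply: addIr.
move=> a ha; apply/mapP; exists (a + sh u); last by rewrite addrK.
rewrite mem_undup; apply/flattenP.
exists [seq a + sh u | a <- pdegs (f u : S)]; first by apply: map_f; rewrite mem_enum.
by apply/mapP; exists a.
Qed.

End Families.

(** Monomial ideals, as the ideals that are graded for the fine grading. *)
Record monomialp (J : S -> Prop) : Prop := Monomialp {
  monomial_submod : @submodp S S^o J;
  monomial_graded : forall a p, J p -> J (phomog a p) }.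

Section MonomialIdeals.
Variables (J : S -> Prop) (mJ : monomialp J).

Lemma monomialM p q : J q -> J (p * q).
Proof. exact: (submodZ (monomial_submod mJ)). Qed.

Lemma monomialZ (c : K) p : J p -> J (c *: p).
Proof. by rewrite -mul_mpolyC; apply: monomialM. Qed.

Lemma monomialZ_inv (c : K) p : c != 0 -> J (c *: p) -> J p.
Proof. by move=> c0 /(monomialZ c^-1); rewrite scalerA mulVf // scale1r. Qed.

End MonomialIdeals.

Lemma cyclic_graded (J : S -> Prop) : monomialp J -> is_graded (cyclic_mod J).
Proof. by move=> [sJ gJ]; apply: (graded_quotient poly_graded sJ gJ). Qed.

Section Sums.
Variables (U : finType) (J : U -> S -> Prop) (sh : U -> deg).
Hypothesis mJ : forall u, monomialp (J u).

Lemma sum_rel_submod : submodp (sum_rel J).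
Proof.
split=> [u|f g hf hg u|c f hf u]; rewrite ffunE; case: (mJ u) => -[J0 JD JZ] _ //.
  exact: JD.
exact: JZ.
Qed.

Lemma sum_cyclic_graded : is_graded (sum_cyclic J sh).
Proof.
apply: (graded_quotient (family_graded sh) sum_rel_submod) => a f hf u.
by rewrite ffunE; apply: (monomial_graded (mJ u)).
Qed.

End Sums.

(** Prolongs a complex by one stage at its lower end. *)
Definition gfree_cons r (g : 'I_r -> deg) (C : gfree K n) (D : 'M[S]_(rk C 0, r)) :
    gfree K n :=
  @GFree K n (fun k => match k with 0 => r | k'.+1 => rk C k' end)
    (fun k => match k with 0 => g | k'.+1 => gdeg C k' end)
    (fun k => match k with 0 => D | k'.+1 => dif C k' end).

(** For a monomial ideal this says that its minimal generators are squarefree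
    and involve only the variables in [T]. *)
Definition squarefree_on (T : {set 'I_n}) (J : S -> Prop) : Prop :=
  forall (u : 'X_{1..n}) i, (i \notin T) || (0 < u i)%N ->
    J 'X_[(u + U_(i))%MM] -> J 'X_[u].

Lemma ord_bool_eq (b : bool) (i j : 'I_b) : i = j.
Proof.
by apply: val_inj; case: b i j => -[] // [|i] // hi [[|j]].
Qed.

(** The relations of the generator 1 form a [determined] submodule of a free
    module of rank one. For [J] the unit ideal the minimal resolution is zero,
    hence the rank of the starting free module. *)
Lemma cyclic_resolution (T : {set 'I_n}) (J : S -> Prop) :
  monomialp J -> squarefree_on T J ->
  exists (C : gfree K n) (e : 'rV[S]_(rk C 0) -> cyclic_mod J),
    minimal_resolution e /\
    forall k i, exists2 t : {set 'I_n}, t \subset T & gdeg C k i = degm (sqf t).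
Proof.
move=> mJ sqJ; have [[J0 JD JZ] gJ] := mJ.
pose r : nat := ~~ `[< J 1 >]; pose s (_ : 'I_r) : {set 'I_n} := set0.
have r1 (i : 'I_r) : ~ J 1.
  by case: i => i; rewrite /r; case: asboolP.
have s0 i : sqfdeg s i = 0 by rewrite /sqfdeg sqf0 degm0.
pose Z (v : 'rV[S]_r) := forall i, J (v 0 i).
have dZ : determined T s Z.
  split.
  - by move=> j; apply: sub0set.
  - by move=> i; rewrite mxE.
  - by move=> x y hx hy i; rewrite mxE; apply: JD.
  - by move=> p x hx i; rewrite mxE; apply: JZ.
  - by move=> a x hx i; rewrite mxE; apply: gJ.
  move=> u i x hi hx hom; exists (\row_j ((x 0 j)@_(u + U_(i))%MM *: 'X_[u])).
  split.
  - move=> j; rewrite mxE; have := hx j.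
    have := hom j; rewrite s0 subr0 => /mhomog_degm ->.
    rewrite mcoeffZ mcoeffX eqxx mulr1.
    have [->|c0] := eqVneq (x 0 j)@_(u + U_(i))%MM 0; first by rewrite !scale0r.
    by move=> /(monomialZ_inv mJ c0) /(sqJ _ _ hi); apply: monomialZ.
  - by move=> j; rewrite mxE s0 subr0; apply: mhomogZ; apply: mhomogX.
  apply/rowP => j; rewrite !mxE -scalerAr -mpolyXD (addmC U_(i)%MM u).
  by apply: mhomog_degm; have := hom j; rewrite s0 subr0.
have mZ x : Z x -> forall i, (x 0 i)@_0%MM = 0.
  move=> hx i; apply/eqP/negPn/negP => c0; apply: (r1 i).
  have := gJ 0 _ (hx i); rewrite (mhomog_const (@phomog_homog K n _ _)).
  by rewrite mcoeff_phomog degm0 eqxx; apply: monomialZ_inv.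
have [C [D [[gC hD] [mC mD] dC [ZD D0] ex]]] := determined_resolution dZ mZ.
pose M := cyclic_mod J.
pose e (v : 'rV[S]_r) : M := qcl (J : S^o -> Prop) (\sum_i v 0 i).
exists (@gfree_cons r (fun=> 0) C D), e; split; last first.
  move=> [|k] i /=; last exact: dC.
  by exists set0; rewrite ?sub0set // sqf0 degm0.
split; last by move=> [|k] i j; [apply: mD|apply: mC].
split.
- by move=> [|k] i j /=; [have := hD i j; rewrite s0|apply: gC].
- split=> [c v w|i].
    rewrite /e -(@qcl_linear _ _ (J : S^o -> Prop)); congr (qcl _ _).
    rewrite scaler_sumr -big_split; apply: eq_bigr => i _.
    by rewrite !mxE.
  exists 1; first exact: mhomog1.
  rewrite /e; congr (qcl _ _); rewrite (bigD1 i) //= mxE !eqxx big1 ?addr0 // => j ji.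
  by rewrite mxE (negPf ji) andbF.
- move=> x; split=> // _; have [p ->] := qclE x.
  have [J1|nJ1] := pselect (J 1).
    exists 0; apply/(qcl_eq (monomial_submod mJ)).
    by rewrite -[_ - _]mulr1; apply: JZ.
  have [i0] : inhabited 'I_r by rewrite /r asboolF //; constructor; apply: ord0.
  exists (const_mx p); rewrite /e (bigD1 i0) //= mxE big1 ?addr0 // => i.
  by rewrite (ord_bool_eq i i0) eqxx.
- move=> v; rewrite -ZD; rewrite /e (qcl_eq0 (monomial_submod mJ)).
  split=> [Jv i|Zv]; last by apply: (submod_sum (monomial_submod mJ)) => i _.
  move: Jv; rewrite (bigD1 i) //= big1 ?addr0 // => j.
  by rewrite (ord_bool_eq j i) eqxx.
by move=> [|k] v; [apply: D0|apply: ex].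
Qed.

End GradedQuotient.

Section DirectSum.
Variables (K : fieldType) (n : nat).
Local Notation S := {mpoly K[n]}.
Local Notation deg := (multideg n).
Variables (U : finType) (J : U -> S -> Prop) (sh : U -> deg).
Hypothesis mJ : forall u, monomialp (J u).

Definition component (u : U) (x : sum_cyclic J sh) : cyclic_mod (J u) :=
  qcl (J u : S^o -> Prop) (repr x u).

Lemma component_qcl u f :
  component u (qcl (sum_rel J) f) = qcl (J u : S^o -> Prop) (f u).
Proof.
apply/(qcl_eq (monomial_submod (mJ u))).
have : sum_rel J (repr (qcl (sum_rel J) f) - f).
  by apply/(qcl_eq (sum_rel_submod mJ)); rewrite qcl_repr.
by move=> /(_ u); rewrite !ffunE.
Qed.

Lemma component_linear u : linear (component u).
Proof.
move=> c x y; have [f ->] := qclE x; have [g ->] := qclE y.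
rewrite -(@qcl_linear _ _ (sum_rel J)) !component_qcl !ffunE.
by rewrite -(@qcl_linear _ _ (J u : S^o -> Prop)).
Qed.

(** An element of [sum_cyclic] is the same as the family of its components in
    the cyclic summands. *)
Lemma component_inj x y : (forall u, component u x = component u y) -> x = y.
Proof.
have [f ->] := qclE x; have [g ->] := qclE y => h.
apply/(qcl_eq (sum_rel_submod mJ)) => u; rewrite !ffunE.
by apply/(qcl_eq (monomial_submod (mJ u))); rewrite -!component_qcl; apply: h.
Qed.

Lemma of_components (y : forall u, cyclic_mod (J u)) :
  exists x : sum_cyclic J sh, forall u, component u x = y u.
Proof.
exists (qcl (sum_rel J) [ffun u => repr (y u)]) => u.
by rewrite component_qcl ffunE qcl_repr.
Qed.

Lemma component_piece a (x : sum_cyclic J sh) :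
  (forall u, gpiece (a - sh u) (component u x)) -> gpiece a x.
Proof.
move=> h; have /choice [f fP] : forall u, exists p : S^o,
    mhomog (a - sh u) p /\ component u x = qcl (J u : S^o -> Prop) p.
  by move=> u; have [p hp xp] := h u; exists p.
exists [ffun u => f u]; first by move=> u; rewrite ffunE; case: (fP u).
apply: component_inj => u; rewrite (component_qcl u [ffun u => f u]) ffunE.
by case: (fP u).
Qed.

Variables (C : U -> gfree K n) (e : forall u, 'rV[S]_(rk (C u) 0) -> cyclic_mod (J u)).

Definition ds_index k : finType := {u : U & 'I_(rk (C u) k)}.

Definition ds_entry k (s : ds_index k.+1) (t : ds_index k) : S :=
  untag 0 (fun l => dif (C (tag s)) k (tagged s) l) t.

(** The direct sum of the complexes [C u], shifted by [sh u]. The basis is the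
    disjoint union of the bases, enumerated; a vector is then the same as the
    family of its projections [ds_pr u], through which exactness is tested. *)
Definition dsum : gfree K n :=
  @GFree K n (fun k => #|{: ds_index k}|)
    (fun k i => gdeg (C (tag (enum_val i))) k (tagged (enum_val i))
                + sh (tag (enum_val i)))
    (fun k => \matrix_(i, j) ds_entry (enum_val i) (enum_val j)).

Definition ds_pr k u (v : 'rV[S]_(rk dsum k)) : 'rV[S]_(rk (C u) k) :=
  \row_l v 0 (enum_rank (Tagged _ l : ds_index k)).

Lemma ds_entry_diag k u l l' :
  ds_entry (Tagged _ l : ds_index k.+1) (Tagged (fun u => 'I_(rk (C u) k)) l') =
  dif (C u) k l l'.
Proof. by rewrite /ds_entry (untagE _ _ (erefl u : tag (Tagged _ l') = u)). Qed.

Lemma ds_entry_off k (s : ds_index k.+1) (t : ds_index k) :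
  tag s != tag t -> ds_entry s t = 0.
Proof. by rewrite eq_sym; apply: untag_dflt. Qed.

Lemma ds_entry_ind (P : forall k, ds_index k.+1 -> ds_index k -> S -> Prop) :
  (forall k s t, P k s t 0) ->
  (forall k u l l', P k (Tagged _ l) (Tagged (fun u => 'I_(rk (C u) k)) l')
                        (dif (C u) k l l')) ->
  forall k s t, P k s t (ds_entry s t).
Proof.
move=> P0 Pd k [u l] [u' l']; have [E|ne] := eqVneq u u'; last first.
  by rewrite ds_entry_off.
by subst u'; rewrite ds_entry_diag; apply: Pd.
Qed.

Lemma ds_pr_dif k u (v : 'rV[S]_(rk dsum k.+1)) :
  ds_pr u (v *m dif dsum k) = ds_pr u v *m dif (C u) k.
Proof.
apply/rowP => l'; rewrite !mxE.
rewrite (reindex (@enum_rank (ds_index k.+1))) /=; last first.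
  by apply: onW_bij; apply: enum_rank_bij.
transitivity (\sum_(u0 : U) \sum_(l : 'I_(rk (C u0) k.+1))
    v 0 (enum_rank (Tagged (fun u => 'I_(rk (C u) k.+1)) l)) *
    ds_entry (Tagged (fun u => 'I_(rk (C u) k.+1)) l) (Tagged (fun u => 'I_(rk (C u) k)) l')).
  rewrite sig_big_dep; apply: eq_bigr => -[u0 l] _ /=.
  by rewrite mxE !enum_rankK.
rewrite (bigD1 u) //= [X in _ + X]big1 ?addr0 => [|u0 nu].
  by apply: eq_bigr => l _; rewrite ds_entry_diag mxE.
by rewrite big1 // => l _; rewrite ds_entry_off ?mulr0.
Qed.

Lemma ds_pr_inj k (v w : 'rV[S]_(rk dsum k)) :
  (forall u, ds_pr u v = ds_pr u w) -> v = w.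
Proof.
move=> h; apply/rowP => i; rewrite -(enum_valK i).
case: (enum_val i) => u l; have /rowP/(_ l) := h u.
by rewrite !mxE.
Qed.

Lemma ds_pr_surj k (x : forall u, 'rV[S]_(rk (C u) k)) :
  exists v : 'rV[S]_(rk dsum k), forall u, ds_pr u v = x u.
Proof.
exists (\row_i x (tag (enum_val i)) 0 (tagged (enum_val i))) => u.
by apply/rowP => l; rewrite !mxE enum_rankK.
Qed.

Lemma ds_pr_linear k u : linear (@ds_pr k u).
Proof. by move=> c v w; apply/rowP => l; rewrite !mxE. Qed.

Lemma ds_exact k : (forall u (v : 'rV_(rk (C u) k.+1)),
    v *m dif (C u) k = 0 <-> exists w, v = w *m dif (C u) k.+1) ->
  forall v : 'rV_(rk dsum k.+1),
    v *m dif dsum k = 0 <-> exists w, v = w *m dif dsum k.+1.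
Proof.
move=> ex v; split=> [v0|[w ->]]; last first.
  apply: ds_pr_inj => u; rewrite !ds_pr_dif (linf0 (@ds_pr_linear _ u)).
  by apply/ex; exists (ds_pr u w).
have h u : {w | ds_pr u v = w *m dif (C u) k.+1}.
  by apply/cid/ex; rewrite -ds_pr_dif v0 (linf0 (@ds_pr_linear _ u)).
have [w wE] := ds_pr_surj (fun u => sval (h u)).
exists w; apply: ds_pr_inj => u; rewrite ds_pr_dif wE.
exact: svalP (h u).
Qed.

Lemma dsum_resolution : (forall u, resolution (@e u)) ->
  exists f : 'rV[S]_(rk dsum 0) -> sum_cyclic J sh, resolution f.
Proof.
move=> rC.
have F v := cid (of_components (fun u => e (ds_pr u v))).
pose f v := sval (F v); have fE v u : component u (f v) = e (ds_pr u v).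
  exact: (svalP (F v)).
have le u : linear (@e u) by case: (rC u) => _ [].
have prD := ds_pr_linear.
exists f; split.
- move=> k i j; rewrite /= mxE.
  apply: (@ds_entry_ind (fun k s t p => mhomog (gdeg (C (tag s)) k.+1 (tagged s)
    + sh (tag s) - (gdeg (C (tag t)) k (tagged t) + sh (tag t))) p)).
    by move=> *; apply: mhomog0.
  move=> k0 u l l' /=; rewrite opprD addrACA addrN addr0.
  by case: (rC u) => gC _ _ _ _; apply: gC.
- split=> [c v w|i].
    apply: component_inj => u; rewrite fE (component_linear u) !fE prD.
    by rewrite (le u).
  apply: component_piece => u; rewrite fE.
  have [_ [_ ge] _ _ _] := rC u.
  apply: (aug_graded (cyclic_graded (mJ u)) (le u) ge) => l.
  rewrite !mxE eqxx /=; case: eqP => [<-|_]; last exact: mhomog0.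
  by rewrite enum_rankK /= addrK subrr; apply: mhomog1.
- move=> x; split=> // _.
  have h u : {w | e w = component u x}.
    by apply: cid; case: (rC u) => _ _ /(_ (component u x)) [h _] _ _; apply: h.
  have [v vE] := ds_pr_surj (fun u => sval (h u)).
  exists v; apply: component_inj => u; rewrite fE vE.
  exact: svalP (h u).
- move=> v; split=> [v0|[w ->]]; last first.
    apply: component_inj => u; rewrite fE ds_pr_dif (linf0 (component_linear u)).
    exact: resolves_aug_dif (rC u).
  have h u : {w | ds_pr u v = w *m dif (C u) 0}.
    apply: cid; case: (rC u) => _ _ _ /(_ (ds_pr u v)) [h _] _; apply: h.
    by rewrite -fE v0 (linf0 (component_linear u)).
  have [w wE] := ds_pr_surj (fun u => sval (h u)).
  exists w; apply: ds_pr_inj => u; rewrite ds_pr_dif wE.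
  exact: svalP (h u).
by move=> k; apply: ds_exact => u; case: (rC u).
Qed.

Lemma dsum_minimal : (forall u, minimal (C u)) -> minimal dsum.
Proof.
move=> mC k i j; rewrite /= mxE.
apply: (@ds_entry_ind (fun k s t p => p@_0%MM = 0)).
  by move=> *; rewrite mcoeff0.
by move=> k0 u l l'; apply: mC.
Qed.

Lemma dsum_gens k (a : deg) :
  gens dsum k a = (\sum_u gens (C u) k (a - sh u)%R)%N.
Proof.
rewrite gensE (reindex (@enum_rank (ds_index k))) /=; last first.
  by apply: onW_bij; apply: enum_rank_bij.
transitivity (\sum_(u : U) \sum_(l : 'I_(rk (C u) k))
    (gdeg (C u) k l == (a - sh u)%R))%N; last first.
  by apply: eq_bigr => u _; rewrite gensE.
rewrite sig_big_dep; apply: eq_bigr => -[u l] _ /=.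
by rewrite enum_rankK /= eq_sym -subr_eq eq_sym.
Qed.

End DirectSum.

(** * Mapping cones *)

Section Cones.
Variables (K : fieldType) (n : nat).
Local Notation S := {mpoly K[n]}.
Local Notation deg := (multideg n).

Section OneCone.
Variables (R C : gfree K n) (f : forall k, 'M[S]_(rk R k, rk C k)).

Lemma cone_gens_ind (Q : nat -> deg -> Prop) :
  (forall k i, Q k (gdeg C k i)) -> (forall k i, Q k.+1 (gdeg R k i)) ->
  forall k i, Q k (gdeg (cone f) k i).
Proof. by move=> hC hR [|k] i //=; case: (split i). Qed.

Lemma cone_gens0 a : gens (cone f) 0 a = gens C 0 a.
Proof. by []. Qed.

Lemma cone_gensS k a : gens (cone f) k.+1 a = (gens C k.+1 a + gens R k a)%N.
Proof.
rewrite !gensE big_split_ord /=; congr (_ + _)%N; apply: eq_bigr => i _.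
  by rewrite -[lshift _ i]/(unsplit (inl i)) unsplitK.
by rewrite -[rshift _ i]/(unsplit (inr i)) unsplitK.
Qed.

Lemma cone_minimal : minimal R -> minimal C ->
  (forall k i j, (f k i j)@_0%MM = 0) -> minimal (cone f).
Proof.
move=> mR mC mf [|k] i j; rewrite /= !mxE; case: (split i) => l //.
  by rewrite !mxE; case: (split j) => l' //; rewrite mxE mcoeff0.
rewrite !mxE; case: (split j) => l' //.
by rewrite mxE mcoeffN mR oppr0.
Qed.

Variables (M N : gmodule K n) (D : {linear M -> N}).
Variables (g : 'rV[S]_(rk R 0) -> M) (e : 'rV[S]_(rk C 0) -> M).

(** With R resolving the kernel of D and C resolving its source, a cycle of the
    cone has a second component that is a cycle of R, hence a boundary;
    subtracting the image of a preimage leaves a cycle of C. *)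
Lemma cone_resolves : graded_map D -> resolves (fun x => D x = 0) g ->
  resolution e -> lifting g e f ->
  @resolves K n N (fun y => exists x, D x = y) (cone f) (fun v => D (e v)).
Proof.
move=> gD rR rC [hf ef cf].
have [gR [lg gg] gZ gex Rex] := rR; have [gC [le ge] eZ eex Cex] := rC.
have hfD k i j : mhomog (gdeg R k i - gdeg C k j) (f k i j) by apply: hf.
split.
- move=> [|k] i j; rewrite /= mxE; case: (split i) => l //.
    by rewrite mxE; case: (split j) => l' //; rewrite mxE; apply: mhomog0.
  rewrite mxE; case: (split j) => l' //.
  by rewrite mxE; apply: mhomogN.
- by split=> [c u v|i]; [rewrite le linearP|apply/gD/ge].
- move=> y; split=> [[x <-]|[v <-]]; last by exists (e v).
  by have [/(_ Logic.I) [v <-] _] := eZ x; exists v.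
- move=> v; split=> [/gZ [w wE]|[w ->]] /=.
    have : e (v - w *m f 0%N) = 0 by rewrite (linfB le) ef wE subrr.
    move=> /eex [w' w'E]; exists (row_mx w' w).
    by rewrite mul_row_col -w'E subrK.
  rewrite -[w]hsubmxK mul_row_col (linfD le) (resolves_aug_dif _ rC) add0r ef.
  by apply/gZ; exists (rsubmx w).
(* The kernel condition on the second component: the augmentation at the
   bottom stage, the differential above. *)
pose ker2 k := match k return 'rV[S]_(rk R k) -> Prop with
               | 0 => fun x => g x = 0 | k'.+1 => fun x => x *m dif R k' = 0 end.
have dE k (v1 : 'rV[S]_(rk C k.+1)) (v2 : 'rV[S]_(rk R k)) :
    row_mx v1 v2 *m dif (cone f) k = 0 <->
    v1 *m dif C k + v2 *m f k = 0 /\ ker2 k v2.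
  case: k v1 v2 => [|k] v1 v2 /=.
    rewrite mul_row_col; split=> [h|[] //]; split=> //.
    have : e (v1 *m dif C 0 + v2 *m f 0%N) = 0 by rewrite h (linf0 le).
    by rewrite (linfD le) (resolves_aug_dif _ rC) add0r ef.
  rewrite (@mul_row_block _ _ (rk C k.+2) (rk R k.+1)) mulmx0 add0r mulmxN.
  rewrite -[X in _ = X]row_mx0; split=> [/eq_row_mx [-> h2]|[-> ->]].
    by split=> //; apply/eqP; rewrite -oppr_eq0 h2.
  by rewrite oppr0.
have ex2 k v2 : ker2 k v2 <-> exists w, v2 = w *m dif R k.
  by case: k v2 => [|k] v2; [apply: gex|apply: Rex].
move=> k v; pose v1 : 'rV[S]_(rk C k.+1) := lsubmx v.
pose v2 : 'rV[S]_(rk R k) := rsubmx v.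
have vE : v = row_mx v1 v2 by rewrite hsubmxK.
have wE (w1 : 'rV[S]_(rk C k.+2)) (w2 : 'rV[S]_(rk R k.+1)) :
    row_mx w1 w2 *m dif (cone f) k.+1 =
    row_mx (w1 *m dif C k.+1 + w2 *m f k.+1) (- (w2 *m dif R k)).
  by rewrite /= (@mul_row_block _ _ (rk C k.+2) (rk R k.+1)) mulmx0 add0r mulmxN.
rewrite {1}vE dE; split=> [[h1 /ex2 [w2 w2E]]|[w wv]].
  have : (v1 + w2 *m f k.+1) *m dif C k = 0.
    by rewrite mulmxDl -mulmxA -cf mulmxA -w2E.
  move=> /Cex [w1 w1E]; exists (row_mx w1 (- w2)).
  by rewrite vE wE !mulNmx opprK -w2E -w1E addrK.
have [v1E v2E] : v1 = lsubmx w *m dif C k.+1 + rsubmx w *m f k.+1 /\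
                 v2 = - (rsubmx w *m dif R k).
  by apply: eq_row_mx; rewrite -vE -wE wv; congr (_ *m _); rewrite hsubmxK.
split; last by apply/ex2; exists (- rsubmx w); rewrite v2E mulNmx.
rewrite v1E v2E mulmxDl -!mulmxA (resolves_dif2 k rC) mulmx0 add0r.
by rewrite -cf mulNmx mulmxA subrr.
Qed.

End OneCone.

(** Along an exact sequence with resolved terms every iterated cone resolves
    the image of the next map. The weight [wt] bounds the generator degrees of
    the cone from below; it keeps units out of the lifts, because a lift goes
    from generators of larger weight to generators of weight exactly [k]. *)
Section Iterated.
Variables (M : nat -> gmodule K n) (D : forall k, {linear M k.+1 -> M k}).
Variables (C : nat -> gfree K n) (e : forall k, 'rV[S]_(rk (C k) 0) -> M k).
Variables (len : nat) (wt : deg -> int).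
Hypotheses (gM : forall k, is_graded (M k)) (gD : forall k, graded_map (D k)).
Hypothesis exD : exact_sequence D len.
Hypothesis mC : forall k, (0 < k <= len)%N -> minimal_resolution (@e k).
Hypothesis wC : forall k, (k < len)%N ->
  forall j i, wt (gdeg (C k.+1) j i) = k%:Z.

Lemma iterated_cone_resolves k R (g : 'rV[S]_(rk R 0) -> M k) :
  iterated_cone D e len g ->
  [/\ (k < len)%N, resolves (fun y => exists x, D k x = y) g, minimal R
    & forall j i, (k%:Z <= wt (gdeg R j i))%R].
Proof.
elim=> {k R g} [k lenE|k R g f _ [ltk rg mR wR] lf].
  have ltk : (k < len)%N by rewrite lenE.
  have [rC mCk] := mC (k := k.+1) ltk; have [gC [le ge] eZ eex Cex] := rC.
  have [injD _ _] := exD; rewrite lenE /= in injD.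
  split=> //; last by move=> j i; rewrite wC.
  split=> //.
  - by split=> [c u v|i]; [rewrite le linearP|apply/gD/ge].
  - move=> y; split=> [[x <-]|[v <-]]; last by exists (e v).
    by have [/(_ Logic.I) [v <-] _] := eZ x; exists v.
  by move=> v; rewrite -eex -[X in _ = X](linear0 (D k)); split=> [/injD|->].
have ltk' : (k < len)%N by apply: ltnW.
have [rC mCk] := mC (k := k.+1) ltk'.
have [_ exk _] := exD.
split=> //.
- apply: cone_resolves (rC) (lf) => //.
  suff <- : (fun y => exists x, D k.+1 x = y) = (fun x => D k x = 0) by [].
  by apply/funext => x; apply/propext; split=> /(exk k ltk).
- apply: cone_minimal => // j i l; have [hf _ _] := lf.
  apply: mhomog_coef0 (hf j i l) _; rewrite subr_eq0; apply/eqP => E.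
  by have := wR j i; rewrite E wC // lez_nat ltnn.
apply: (cone_gens_ind (Q := fun _ a => (k%:Z <= wt a)%R)) => j i.
  by rewrite wC.
by apply: le_trans (wR j i); rewrite lez_nat.
Qed.

Lemma iterated_cone_exists k : (k < len)%N ->
  exists R (g : 'rV[S]_(rk R 0) -> M k), iterated_cone D e len g.
Proof.
move=> ltk; have [j jE] : exists j, (k + j).+1 = len.
  by exists (len - k.+1)%N; rewrite -addSn subnKC.
elim: j k ltk jE => [|j IH] k ltk jE.
  by exists (C k.+1), (fun v => D k (e v)); apply: iterated_cone_top; rewrite -jE addn0.
have ltk' : (k.+1 < len)%N by rewrite -jE addnS ltnS ltnS leq_addr.
have [|R [g it]] := IH k.+1 ltk'; first by rewrite addSnnS.
have [_ rg _ _] := iterated_cone_resolves it.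
have [rC _] := mC (k := k.+1) (ltnW ltk').
have [f lf] := lifting_exists (gM k.+1) rg rC (fun _ _ => Logic.I).
by exists (cone f), (fun v => D k (e v)); apply: iterated_cone_step it lf.
Qed.

Lemma iterated_cone_gens k R (g : 'rV[S]_(rk R 0) -> M k) j a :
  iterated_cone D e len g ->
  gens R j a = (\sum_(i < len - k | (i <= j)%N) gens (C (k + i).+1) (j - i) a)%N.
Proof.
move=> it; elim: it j => {k R g} [k lenE|k R g f it IH lf] j.
  by rewrite lenE subSnn big_mkcond big_ord1 /= addn0 subn0.
have [ltk _ _ _] := iterated_cone_resolves it.
have -> : (len - k = (len - k.+1).+1)%N by rewrite -subSn // ltnW.
rewrite big_mkcond big_ord_recl /= addn0 subn0.
case: j => [|j]; first by rewrite big1 ?addn0 // cone_gens0.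
rewrite cone_gensS IH big_mkcond /=; congr (_ + _)%N; apply: eq_bigr => i _.
by rewrite /bump /= add1n ltnS addnS addSn subSS.
Qed.

End Iterated.

End Cones.

(** * The chain complex of a simplex *)

Section Simplex.
Variables (R : pzRingType) (T : finType) (ord : T -> nat) (X : {set T}).
Hypothesis ord_inj : {in X &, injective ord}.
Implicit Types (B : {set T}) (phi : {set T} -> R).

Definition below t B : nat := #|[set s in B | (ord s < ord t)%N]|.

(** The simplicial boundary, in the dual description by coefficients: [phi]
    gives the coefficient of each face. *)
Definition bdry phi B : R :=
  \sum_(t in X :\: B) (-1) ^+ below t B * phi (t |: B).

Lemma belowU s t B : t \notin B ->
  below s (t |: B) = ((ord t < ord s)%N + below s B)%N.
Proof.
move=> tB; rewrite /below; have [lt|ge] := boolP (ord t < ord s)%N.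
  rewrite -[(true + _)%N]/(_.+1) -[RHS]add1n.
  have -> : [set s0 in t |: B | (ord s0 < ord s)%N] =
            t |: [set s0 in B | (ord s0 < ord s)%N].
    by apply/setP => x; rewrite !inE; case: eqP => [->|_] //=; rewrite lt.
  by rewrite cardsU1 inE (negPf tB).
congr #|pred_of_set _|; apply/setP => x; rewrite !inE.
by case: eqP => [->|_] //=; rewrite (negPf ge) andbF.
Qed.

(** The faces obtained by adding two vertices to [B] occur once for each order
    of the two vertices, with opposite signs. *)
Lemma bdry_bdry phi B : bdry (bdry phi) B = 0.
Proof.
pose F t s := (-1) ^+ (below t B + below s B) * phi (s |: (t |: B)).
have Fsym t s : F t s = F s t.
  by rewrite /F addnC; congr (_ * phi _); rewrite !setUA (setUC [set s]).
pose Y := X :\: B.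
have -> : bdry (bdry phi) B =
    \sum_(t in Y) \sum_(s in Y | (ord s < ord t)%N) F t s
    - \sum_(t in Y) \sum_(s in Y | (ord t < ord s)%N) F t s.
  rewrite -sumrB; apply: eq_bigr => t tY; rewrite /bdry mulr_sumr.
  have tB : t \notin B by case/setDP: tY.
  have tX : t \in X by case/setDP: tY.
  rewrite (bigID (fun s => (ord s < ord t)%N)) /=; congr (_ + _).
    apply: eq_big => [s|s /andP [_ lt]].
      rewrite !inE negb_or; case: eqP => [->|] //=; by rewrite ltnn !andbF.
    rewrite mulrA -exprD belowU // ltnNge (ltnW lt) add0n //.
  rewrite -sumrN; apply: eq_big => [s|s /andP [sY ge]].
    rewrite !inE negb_or -leqNgt leq_eqVlt; case: (eqVneq s t) => [->|st] /=.
      by rewrite ltnn andbF.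
    case sX : (s \in X); rewrite ?andbF //=; case: eqP => [E|] //.
    by rewrite (ord_inj tX sX E) eqxx in st.
  have sX : s \in X by case/setDP: sY.
  have lt : (ord t < ord s)%N.
    rewrite ltn_neqAle leqNgt ge andbT; apply/eqP => E.
    by move: sY; rewrite (ord_inj tX sX E) !inE eqxx.
  by rewrite mulrA -exprD belowU // lt addnCA exprS mulN1r mulNr.
apply/eqP; rewrite subr_eq0; apply/eqP.
rewrite !pair_big_dep /= (reindex (fun p : T * T => (p.2, p.1))) /=; last first.
  by exists (fun p => (p.2, p.1)) => -[].
apply: eq_big => [[t s]|[t s] _] /=; last exact: Fsym.
by rewrite andbCA.
Qed.

(** A simplex is a cone over its first vertex, hence acyclic. *)
Lemma bdry_exact phi t0 : t0 \in X -> (forall t, t \in X -> (ord t0 <= ord t)%N) ->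
  (forall B, B \subset X -> bdry phi B = 0) ->
  forall B, B \subset X ->
    bdry (fun A => if t0 \in A then phi (A :\ t0) else 0) B = phi B.
Proof.
move=> t0X min cyc B BX.
have below0 (A : {set T}) : A \subset X -> below t0 A = 0%N.
  move=> AX; apply: eq_card0 => s; rewrite !inE; apply/negP => /andP [sA].
  by rewrite ltnNge min // (subsetP AX).
have [t0B|t0B] := boolP (t0 \in B); last first.
  rewrite /bdry (bigD1 t0) /=; last by rewrite inE t0B.
  rewrite setU11 setU1K // below0 // mul1r.
  rewrite big1 ?addr0 // => t /andP [_ tt0].
  by rewrite !inE eq_sym (negPf tt0) (negPf t0B) /= mulr0.
have BX' : B :\ t0 \subset X by apply: subset_trans BX; apply: subD1set.
have := cyc _ BX'; rewrite /bdry (bigD1 t0) /=; last by rewrite !inE eqxx t0X.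
rewrite below0 // mul1r setD1K // => /eqP; rewrite addr_eq0 => /eqP ->.
rewrite -sumrN; apply: eq_big => [t|t].
  rewrite !inE; case: (eqVneq t t0) => [->|_]; first by rewrite t0B andbF.
  by rewrite andbT.
move=> /setDP [tX tB].
have tt0 : t != t0 by apply: contraNneq tB => ->.
rewrite (setU1r _ t0B); have -> : (t |: B) :\ t0 = t |: B :\ t0.
  apply/setP => x; rewrite !inE; case: (eqVneq x t) => [->|] //=.
  by rewrite tt0.
have lt : (ord t0 < ord t)%N.
  rewrite ltn_neqAle min // andbT; apply: contraNneq tt0 => E.
  by rewrite (ord_inj t0X tX E).
have -> : below t B = (below t (B :\ t0)).+1.
  by rewrite -{1}(setD1K t0B) belowU ?setD11 // lt.
by rewrite exprS mulN1r mulNr.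
Qed.

End Simplex.

(** * The sequence of the color-squarefree monomials *)

Section Variables.
Variables (d : nat) (m : 'I_d -> nat).
Local Notation mon := 'X_{1..nvar m}.
Local Notation mon' := 'X_{1..nvar (msucc m)}.
Implicit Types (A B : {set var m}) (s t : var m) (i : 'I_d).

Definition ov t : 'I_(nvar (msucc m)) := vidx (old_var t).
Definition nv i : 'I_(nvar (msucc m)) := vidx (new_var m i).

Lemma old_var_inj : injective (@old_var d m).
Proof.
move=> [i j] [i' j'] E; have Ei : i = i' := congr1 tag E.
subst i'; move/eqP: E; rewrite /old_var /= eq_Tagged /= => /eqP /(congr1 val) /= E.
by congr Tagged; apply: val_inj.
Qed.

Lemma ov_inj : injective ov.
Proof. by move=> s t /enum_rank_inj /old_var_inj. Qed.

Lemma nv_inj : injective nv.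
Proof. by move=> i j /enum_rank_inj /(congr1 tag). Qed.

Lemma ov_neq_nv t i : (ov t == nv i) = false.
Proof.
apply/eqP => /enum_rank_inj E.
have := congr1 (fun v : var (msucc m) => nat_of_ord (tagged v)) E.
have /= <- := congr1 tag E => /= h.
by have := ltn_ord (tagged t); rewrite h ltnn.
Qed.

Lemma nv_neq_ov t i : (nv i == ov t) = false.
Proof. by rewrite eq_sym ov_neq_nv. Qed.

Lemma index_cases (P : 'I_(nvar (msucc m)) -> Prop) :
  (forall t, P (ov t)) -> (forall i, P (nv i)) -> forall x, P x.
Proof.
move=> Po Pn x; rewrite -[x]enum_valK; case: (enum_val x) => i j.
have [lt|ge] := ltnP j (m i).
  have E : Tagged (fun i => 'I_(msucc m i)) j =
           old_var (Tagged (fun i => 'I_(m i)) (Ordinal lt)).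
    by rewrite /old_var /=; congr Tagged; apply: val_inj.
  exact: (eq_ind_r (fun y => P (enum_rank y)) (Po _) E).
suff E : Tagged (fun i => 'I_(msucc m i)) j = new_var m i.
  exact: (eq_ind_r (fun y => P (enum_rank y)) (Pn i) E).
congr Tagged; apply: val_inj; apply/eqP; rewrite eqn_leq ge andbT.
by rewrite -ltnS; apply: (ltn_ord j).
Qed.

Lemma mnm_ext (u v : mon') : (forall t, u (ov t) = v (ov t)) ->
  (forall i, u (nv i) = v (nv i)) -> u = v.
Proof. by move=> ho hn; apply/mnmP; apply: index_cases. Qed.

Lemma incl_mon_ov (u : mon) t : incl_mon u (ov t) = u (vidx t).
Proof.
rewrite /incl_mon mnm_sumE (bigD1 t) //= mulmnE mnm1E eqxx mul1n.
rewrite big1 ?addn0 // => s st.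
by rewrite mulmnE mnm1E (inj_eq ov_inj) (negPf st).
Qed.

Lemma incl_mon_nv (u : mon) i : incl_mon u (nv i) = 0%N.
Proof.
rewrite /incl_mon mnm_sumE big1 // => s _.
by rewrite mulmnE mnm1E [_ == _]ov_neq_nv.
Qed.

Definition nmon (A : {set 'I_d}) : mon' := \big[@mnm_add _/0%MM]_(i in A) U_(nv i)%MM.
Definition omon A : mon' := \big[@mnm_add _/0%MM]_(t in A) U_(ov t)%MM.
Definition smon A : mon' := (omon A + nmon (tag @: A))%MM.

Lemma nmon_ov (A : {set 'I_d}) t : nmon A (ov t) = 0%N.
Proof. by rewrite /nmon mnm_sumE big1 // => i _; rewrite mnm1E nv_neq_ov. Qed.

Lemma nmon_nv (A : {set 'I_d}) i : nmon A (nv i) = (i \in A) :> nat.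
Proof.
rewrite /nmon mnm_sumE big_mkcond /= (bigD1 i) //= mnm1E eqxx.
rewrite big1 ?addn0; first by case: (i \in A).
by move=> j ji; rewrite mnm1E (inj_eq nv_inj) (negPf ji) if_same.
Qed.

Lemma omon_ov A t : omon A (ov t) = (t \in A) :> nat.
Proof.
rewrite /omon mnm_sumE big_mkcond /= (bigD1 t) //= mnm1E eqxx.
rewrite big1 ?addn0; first by case: (t \in A).
by move=> s st; rewrite mnm1E (inj_eq ov_inj) (negPf st) if_same.
Qed.

Lemma omon_nv A i : omon A (nv i) = 0%N.
Proof. by rewrite /omon mnm_sumE big1 // => s _; rewrite mnm1E ov_neq_nv. Qed.

Lemma smon_ov A t : smon A (ov t) = (t \in A) :> nat.
Proof. by rewrite mnmDE omon_ov nmon_ov addn0. Qed.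

Lemma smon_nv A i : smon A (nv i) = (i \in tag @: A) :> nat.
Proof. by rewrite mnmDE omon_nv nmon_nv. Qed.

Lemma smonU t B : t \notin B -> tag t \notin tag @: B ->
  smon (t |: B) = (smon B + U_(ov t) + U_(nv (tag t)))%MM.
Proof.
move=> tB cB; apply: mnm_ext => [s|i].
  rewrite 2!mnmDE !smon_ov !mnm1E nv_neq_ov (inj_eq ov_inj) addn0 in_setU1 eq_sym.
  by case: (eqVneq t s) => [<-|] /=; rewrite ?(negPf tB) ?addn0.
rewrite 2!mnmDE !smon_nv !mnm1E ov_neq_nv (inj_eq nv_inj) addn0.
rewrite imsetU1 in_setU1 eq_sym.
by case: (eqVneq (tag t) i) => [<-|] /=; rewrite ?(negPf cB) ?addn0.
Qed.

(** The variables [t] such that both [t] and the new variable of its color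
    divide [w]: the vertices of the simplex that is the strand of the sequence
    in degree [w]. *)
Definition vertices (w : mon') : {set var m} :=
  [set t | (0 < w (ov t))%N && (0 < w (nv (tag t)))%N].

Lemma smon_le A w : (smon A <= w)%MM = (A \subset vertices w).
Proof.
apply/mnm_lepP/subsetP => [h t tA|h].
  rewrite inE; have := h (ov t); have := h (nv (tag t)).
  by rewrite smon_ov smon_nv tA imset_f // => -> ->.
apply: index_cases => [t|i].
  by rewrite smon_ov; case: (boolP (t \in A)) => // /h; rewrite inE => /andP [].
rewrite smon_nv; case: (boolP (i \in _)) => // /imsetP [t /h tA ->].
by move: tA; rewrite inE => /andP [].
Qed.

Definition csset k (u : csmon m k) : {set var m} := [set t | (0 < csval u (vidx t))%N].

Lemma csvalE k (u : csmon m k) t : csval u (vidx t) = (t \in csset u) :> nat.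
Proof.
have /andP [_ /andP [/forallP/(_ t)]] := valP u; rewrite inE -/(csval u).
by case: (csval u (vidx t)) => [|[|]].
Qed.

Lemma csset_tag k (u : csmon m k) : {in csset u &, injective (@tag 'I_d (fun i => 'I_(m i)))}.
Proof.
move=> s t; rewrite !inE => hs ht E; have /andP [_ /andP [_ /forallP h]] := valP u.
by have /forallP/(_ t)/implyP := h s; rewrite E eqxx hs ht => /(_ isT) /eqP.
Qed.

Lemma mdeg_sum_var (u : mon) : mdeg u = (\sum_t u (vidx t))%N.
Proof.
rewrite mdegE (reindex (@enum_rank (var m))) //=.
by apply: onW_bij; apply: enum_rank_bij.
Qed.

Lemma csset_card k (u : csmon m k) : #|csset u| = k.
Proof.
have /andP [/eqP dk _] := valP u; transitivity (mdeg (csval u)) => //.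
rewrite mdeg_sum_var.
by rewrite -sum1_card big_mkcond; apply: eq_bigr => t _; rewrite csvalE; case: ifP.
Qed.

(** A color-squarefree monomial is determined by its set of variables, and
    [cssetP] describes the sets that occur. *)
Lemma csset_inj k : injective (@csset k).
Proof.
move=> u v E; apply: val_inj; apply: val_inj; apply/mnmP => x.
rewrite -(enum_valK x); have := csvalE u (enum_val x).
by rewrite E -csvalE.
Qed.

Lemma cssetP k A : #|A| = k -> {in A &, injective (@tag 'I_d (fun i => 'I_(m i)))} ->
  exists u : csmon m k, csset u = A.
Proof.
move=> cA iA; pose w : mon := [multinom (enum_val x \in A : nat) | x < nvar m].
have wE t : w (vidx t) = (t \in A) :> nat by rewrite mnmE enum_rankK.
have dw : mdeg w = k.
  rewrite mdeg_sum_var -cA -sum1_card [RHS]big_mkcond.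
  by apply: eq_bigr => t _; rewrite wE; case: ifP.
have ltw : (mdeg w < k.+1)%N by rewrite dw.
have ok : (mdeg (bmnm (BMultinom ltw)) == k) && csqfree (bmnm (BMultinom ltw)).
  rewrite /= dw eqxx /=; apply/andP; split; first by apply/forallP => t; rewrite wE leq_b1.
  apply/forallP => s; apply/forallP => t; rewrite !wE !lt0b.
  by apply/implyP => /and3P [/eqP E sA tA]; apply/eqP; apply: iA.
pose u : csmon m k := exist _ (BMultinom ltw) ok.
have uE : csval u = w by [].
by exists u; apply/setP => t; rewrite inE uE wE lt0b.
Qed.

Lemma cs_step k (u : csmon m k.+1) (v : csmon m k) t :
  (csval u == csval v + U_(vidx t))%MM = (t \notin csset v) && (csset u == t |: csset v).
Proof.
apply/eqP/andP => [E|[tv /eqP E]].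
  have E' s : ((s \in csset u) = (s \in csset v) + (t == s) :> nat)%N.
    by rewrite -!csvalE E mnmDE mnm1E (inj_eq enum_rank_inj).
  have tv : t \notin csset v.
    by have := E' t; rewrite eqxx; case: (t \in csset v); case: (t \in csset u).
  split=> //; apply/eqP/setP => s; have := E' s; rewrite in_setU1 eq_sym.
  case: (eqVneq s t) => [->|_]; first by rewrite (negPf tv); case: (t \in _).
  by rewrite addn0 /=; case: (s \in csset u); case: (s \in csset v).
apply/mnmP => x; rewrite -(enum_valK x) mnmDE mnm1E.
rewrite -[enum_rank _]/(vidx (enum_val x)) !csvalE E in_setU1 (inj_eq enum_rank_inj) eq_sym.
by case: (eqVneq t (enum_val x)) => [<-|] /=; rewrite ?(negPf tv) ?addn0.
Qed.

Lemma incl_csval k (u : csmon m k) : incl_mon (csval u) = omon (csset u).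
Proof.
apply: mnm_ext => [t|i]; first by rewrite incl_mon_ov omon_ov csvalE.
by rewrite incl_mon_nv omon_nv.
Qed.

Lemma cSupp_csset k (u : csmon m k) : cSupp (csval u) = tag @: csset u.
Proof.
by apply/setP => i; apply/imsetP/imsetP => -[t ht ->]; exists t => //; move: ht; rewrite !inE.
Qed.

(** The shift of the summand of [u] is the degree of the monomial whose
    divisibility is tested by [smon_le]. *)
Lemma cshiftE k (u : csmon m k) : cshift u = degm (smon (csset u)).
Proof. by rewrite /cshift incl_csval cSupp_csset. Qed.

End Variables.

(** Allows exactness to be checked on homogeneous chains only. *)
Lemma graded_additive (K : fieldType) (n : nat) (V V' : lmodType {mpoly K[n]}) hm pr hm' pr'
    (F : V -> V') (a : multideg n) x :
  @graded_lmod K n V hm pr -> @graded_lmod K n V' hm' pr' -> linear F ->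
  (forall a x, hm a x -> hm' a (F x)) -> pr' a (F x) = F (pr a x).
Proof.
move=> gV gV' lF hF; have [s E] := pr_decomp gV x.
rewrite {1}E {2}E (linf_sum lF) (pr_sum gV') (pr_sum gV) (linf_sum lF).
apply: eq_bigr => b _; have hb := pr_homog gV b x.
have [<-|ba] := eqVneq b a.
  by rewrite (pr_id gV' (hF _ _ hb)) (pr_id gV hb).
by rewrite (pr_neq gV' (hF _ _ hb)) // (pr_neq gV hb) // (linf0 lF).
Qed.

Section ChainMap.
Variables (K : fieldType) (d : nat) (m : 'I_d -> nat).
Local Notation mon' := 'X_{1..nvar (msucc m)}.
Local Notation S := {mpoly K[nvar (msucc m)]}.
Local Notation chain k := {ffun csmon m k -> S^o}.
Local Notation color t := (nat_of_ord (tag t)).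
Implicit Types (A B : {set var m}) (s t : var m) (i : 'I_d) (w W : mon').

Definition dcoef k (u : csmon m k) t : S :=
  (-1) ^+ #|[set i in cSupp (csval u) | (i < tag t)%N]| *
  xvar K (old_var t) * xvar K (new_var m (tag t)).

(** The differential before the colon ideals are divided out, on the free
    modules with bases the color-squarefree monomials of each degree. The same
    map induces the sequences for all ideals. *)
Definition dmap k (f : chain k.+1) : chain k :=
  [ffun v : csmon m k =>
    \sum_t \sum_(u : csmon m k.+1 | csval u == (csval v + U_(vidx t))%MM)
      dcoef u t * f u].

Lemma dmap_linear k : linear (@dmap k).
Proof.
move=> c f g; apply/ffunP => v; rewrite !ffunE.
rewrite /GRing.scale /= mulr_sumr -big_split; apply: eq_bigr => t _ /=.
rewrite mulr_sumr -big_split; apply: eq_bigr => u _ /=.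
by rewrite !ffunE mulrDr mulrCA.
Qed.

(** The chain with coefficient [phi A] on the color-squarefree monomial with
    support [A], put in degree [W]. *)
Definition strand W k (phi : {set var m} -> K) : chain k :=
  [ffun u => if csset u \subset vertices W
             then phi (csset u) *: 'X_[(W - smon (csset u))%MM] else 0].

Lemma csset_step_notin k (u : csmon m k.+1) B t :
  csset u = t |: B -> t \notin B -> tag t \notin tag @: B.
Proof.
move=> uE tB; apply/imsetP => -[s sB E]; case/negP: tB.
rewrite (_ : t = s) //; apply: (@csset_tag _ _ _ u) => //; rewrite uE.
  exact: setU11.
exact: setU1r.
Qed.

Lemma sign_scale N (p : S) : (-1) ^+ N * p = ((-1) ^+ N : K) *: p.
Proof. by rewrite -mul_mpolyC rmorph_sign. Qed.

Lemma dcoef_strand W k (u : csmon m k.+1) B t (c : K) :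
  csset u = t |: B -> t \notin B -> csset u \subset vertices W ->
  dcoef u t * (c *: 'X_[(W - smon (csset u))%MM]) =
  ((-1) ^+ below (fun t => color t) t B * c) *: 'X_[(W - smon B)%MM].
Proof.
move=> uE tB uW; have cB := csset_step_notin uE tB.
have sE : smon (csset u) = (smon B + U_(ov t) + U_(nv m (tag t)))%MM.
  by rewrite uE smonU.
have le : (smon (csset u) <= W)%MM by rewrite smon_le.
have -> : (W - smon B = U_(ov t) + U_(nv m (tag t)) + (W - smon (csset u)))%MM.
  apply/mnmP => x; have := mnm_lepP le x.
  rewrite sE; move: (smon B) => b; rewrite !(mnmBE, mnmDE) -(addnA (b x)) => h.
  rewrite subnDA subnKC //.
  by rewrite leq_subRL // (leq_trans (leq_addr _ _) h).
rewrite /dcoef -!mulrA -scalerAr -scalerAr -scalerA -!mpolyXD addmA.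
have -> : #|[set i in cSupp (csval u) | (i < tag t)%N]| =
          below (fun t => color t) t B.
  rewrite cSupp_csset uE /below.
  rewrite -(card_in_imset (f := @tag _ _) (D := [set s in B | (color s < color t)%N])).
    apply: eq_card => i; rewrite !inE imsetU1 !inE; apply/andP/imsetP.
      move=> [/orP [/eqP ->|/imsetP [s sB ->]] lt]; first by rewrite ltnn in lt.
      by exists s; rewrite // inE sB.
    by move=> [s /[!inE] /andP [sB lt] ->]; rewrite imset_f ?orbT.
  move=> s s'; rewrite !inE => /andP [sB _] /andP [s'B _].
  by apply: (@csset_tag _ _ _ u); rewrite uE setU1r.
by rewrite -sign_scale -scalerAr.
Qed.

Section OneDegree.
Variable W : mon'.
Hypothesis tagW : {in vertices W &, injective (@tag 'I_d (fun i => 'I_(m i)))}.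

Lemma colorW : {in vertices W &, injective (fun t => color t)}.
Proof. by move=> s t hs ht /val_inj; apply: tagW. Qed.

(** In degree [W] the differential is the boundary of the simplex on the
    vertices of [W]: the coefficient [dcoef u t] makes up for the difference
    between the shifts of the two monomials. *)
Lemma dmap_strand k phi :
  dmap (strand W k.+1 phi) = strand W k (bdry (fun t => color t) (vertices W) phi).
Proof.
apply/ffunP => v; rewrite !ffunE; case: ifP => [vW|vW]; last first.
  rewrite big1 // => t _; rewrite big1 // => u; rewrite cs_step ffunE.
  move=> /andP [_ /eqP E]; rewrite E subUset vW andbF.
  by rewrite mulr0.
rewrite /bdry scaler_suml (bigID (fun t => t \in vertices W :\: csset v)) /=.
rewrite [X in _ + X]big1 ?addr0; last first.
  move=> t; rewrite inE negb_and negbK => ht; rewrite big1 // => u.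
  rewrite cs_step ffunE => /andP [tv /eqP ->].
  rewrite (negPf tv) /= in ht.
  by rewrite subUset sub1set (negPf ht) mulr0.
apply: eq_bigr => t; rewrite inE => /andP [tv tW].
have [||u uE] := @cssetP _ m k.+1 (t |: csset v).
- by rewrite cardsU1 tv csset_card.
- have sub : t |: csset v \subset vertices W by rewrite subUset sub1set tW.
  by move=> x y xA yA; apply: tagW; apply: (subsetP sub).
have uW : csset u \subset vertices W by rewrite uE subUset sub1set tW.
rewrite (bigD1 u) /=; last by rewrite cs_step tv uE eqxx.
rewrite big1 ?addr0 => [|u' /andP []]; last first.
  rewrite cs_step => /andP [_ /eqP E] /eqP []; apply: csset_inj.
  by rewrite E.
by rewrite ffunE uW (dcoef_strand _ uE tv uW) uE.
Qed.

Lemma dmap_dmap_strand k phi : dmap (dmap (strand W k.+2 phi)) = 0.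
Proof.
rewrite !dmap_strand; apply/ffunP => u; rewrite !ffunE.
by case: ifP => // _; rewrite (bdry_bdry colorW) scale0r.
Qed.

Lemma eq_strand k phi psi :
  (forall u : csmon m k, csset u \subset vertices W -> phi (csset u) = psi (csset u)) ->
  strand W k phi = strand W k psi.
Proof. by move=> h; apply/ffunP => u; rewrite !ffunE; case: ifP => // /h ->. Qed.

(** The last hypothesis says that the strand is a cycle; for [k = 0] it is void,
    and the strand is then a boundary because there is a vertex. *)
Lemma strand_exact k phi : vertices W != set0 ->
  (forall v : csmon m k.-1, (0 < k)%N -> csset v \subset vertices W ->
     bdry (fun t => color t) (vertices W) phi (csset v) = 0) ->
  exists psi, strand W k phi = dmap (strand W k.+1 psi).
Proof.
move=> /set0Pn [t1 t1W] cyc.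
(* Only the faces of cardinality [k] matter; on the others [phi] is made zero,
   which turns the cycle condition into an identity for all faces. *)
pose phi' A := if (A \subset vertices W) && (#|A| == k) then phi A else 0.
have -> : strand W k phi = strand W k phi'.
  by apply: eq_strand => u uW; rewrite /phi' uW csset_card eqxx.
case: (arg_minnP (fun t => color t) t1W) => t0 t0W min.
exists (fun A => if t0 \in A then phi' (A :\ t0) else 0).
rewrite dmap_strand; apply: eq_strand => u uW.
rewrite (bdry_exact colorW t0W min) // => B BW.
have [Bk|nBk] := eqVneq #|B|.+1 k; last first.
  rewrite /bdry big1 // => t /setDP [_ tB].
  by rewrite /phi' cardsU1 tB add1n (negPf nBk) andbF mulr0.
have [||v vE] := @cssetP _ m k.-1 B; first by rewrite -Bk.
  by move=> x y xB yB; apply: tagW; apply: (subsetP BW).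
rewrite -vE in BW *; rewrite -(cyc v) //; last by rewrite -Bk.
have ck : #|csset v|.+1 == k by rewrite vE Bk.
apply: eq_bigr => t /setDP [tW tB]; congr (_ * _).
by rewrite /phi' cardsU1 tB add1n ck subUset sub1set tW BW.
Qed.

End OneDegree.

(** Every homogeneous chain lies in a strand, by one-dimensionality of the
    pieces of the polynomial ring. *)
Lemma fhomog_strand W k (f : chain k) :
  fhomog (fun u => cshift u) (degm W) f -> exists phi, f = strand W k phi.
Proof.
move=> hf; exists (fun A => \sum_(u : csmon m k | csset u == A) (f u : S)@_(W - smon A)%MM).
apply/ffunP => u; rewrite ffunE (bigD1 u) //= big1 ?addr0; last first.
  by move=> u' /andP [/eqP /csset_inj ->]; rewrite eqxx.
have := hf u; rewrite cshiftE => /mhomog_sub; rewrite smon_le => {1}->.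
by case: ifP => //; rewrite scale0r.
Qed.

Lemma fhomog_cases a k (f : chain k) : fhomog (fun u => cshift u) a f ->
  f = 0 \/ exists W, a = degm W.
Proof.
move=> hf; have [[u fu]|f0] := pselect (exists u, f u != 0); last first.
  left; apply/ffunP => u; rewrite ffunE; apply/eqP/negPn/negP => fu.
  by apply: f0; exists u.
right; have [E|[w wa _]] := mhomog_cases (hf u); first by rewrite E eqxx in fu.
by exists (w + smon (csset u))%MM; rewrite degmD wa cshiftE subrK.
Qed.

Lemma dmap_graded k a (f : chain k.+1) :
  fhomog (fun u => cshift u) a f -> fhomog (fun u => cshift u) a (dmap f).
Proof.
move=> hf v; rewrite ffunE; apply: mhomog_sum => t _; apply: mhomog_sum => u.
rewrite cs_step => /andP [tv /eqP uE].
have -> : a - cshift v = degm (U_(ov t) + U_(nv m (tag t)))%MM + (a - cshift u).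
  rewrite !cshiftE uE smonU ?(csset_step_notin uE) // -addmA (degmD (smon _)) opprD.
  by rewrite [RHS]addrC -!addrA addNr addr0.
apply: mhomogM (hf u); rewrite degmD -[degm U_(ov t)]add0r.
apply: mhomogM; last exact: mhomogX.
apply: mhomogM; last exact: mhomogX.
have -> : (-1 : S) ^+ #|[set i in cSupp (csval u) | (i < tag t)%N]| =
          (-1 : K) ^+ #|[set i in cSupp (csval u) | (i < tag t)%N]| *: 1.
  by rewrite -sign_scale mulr1.
by apply: mhomogZ; apply: mhomog1.
Qed.

Definition daug (f : chain 0) : S^o := \sum_u f u.

Lemma daug_linear : linear daug.
Proof.
move=> c f g; rewrite /daug scaler_sumr -big_split.
by apply: eq_bigr => u _; rewrite !ffunE.
Qed.

Lemma csset0 (u : csmon m 0) : csset u = set0.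
Proof. by apply/eqP; rewrite -cards_eq0 csset_card. Qed.

Lemma smon0 : smon (set0 : {set var m}) = 0%MM.
Proof.
by apply: mnm_ext => [t|i]; rewrite ?smon_ov ?smon_nv ?imset0 inE mnm0E.
Qed.

Lemma cshift0 (u : csmon m 0) : cshift u = 0.
Proof. by rewrite cshiftE csset0 smon0 degm0. Qed.

Lemma daug_graded a (f : chain 0) :
  fhomog (fun u => cshift u) a f -> mhomog a (daug f).
Proof.
by move=> hf; apply: mhomog_sum => u _; have := hf u; rewrite cshift0 subr0.
Qed.

Section Relations.
Variables (J : S -> Prop).
Hypothesis mJ : monomialp J.

Definition relations k : chain k -> Prop :=
  sum_rel (fun u : csmon m k => colon J (incl_mon (csval u))).

Lemma colon_monomialp w : monomialp (colon J w).
Proof.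
split=> [|a p]; rewrite /colon; last first.
  move=> /(monomial_graded mJ (a + degm w)).
  by rewrite (phomogM _ _ (@mhomogX K _ w)) addrK.
split=> [|p q hp hq|c p hp].
- by rewrite mul0r; apply: (submod0 (monomial_submod mJ)).
- by rewrite mulrDl; apply: (submodD (monomial_submod mJ)).
by rewrite -mulrA; apply: monomialM.
Qed.

Lemma rel_submod k : submodp (@relations k).
Proof. by apply: sum_rel_submod => u; apply: colon_monomialp. Qed.

(** Going from [u] to [u] divided by a variable weakens the colon condition by
    that variable, which the coefficient of the differential supplies. *)
Lemma dmap_rel k (f : chain k.+1) : relations f -> relations (dmap f).
Proof.
move=> hf v; rewrite ffunE /colon mulr_suml.
apply: (submod_sum (monomial_submod mJ)) => t _; rewrite mulr_suml.
apply: (submod_sum (monomial_submod mJ)) => u /eqP uE.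
have -> : dcoef u t * f u * 'X_[incl_mon (csval v)] =
    ((-1) ^+ #|[set i in cSupp (csval u) | (i < tag t)%N]| * xvar K (new_var m (tag t)))
     * (f u * 'X_[incl_mon (csval u)]).
  have -> : incl_mon (csval u) = (U_(ov t) + incl_mon (csval v))%MM.
    apply: mnm_ext => [s|i]; rewrite mnmDE ?incl_mon_ov ?incl_mon_nv mnm1E.
      by rewrite uE mnmDE mnm1E addnC (inj_eq (@ov_inj _ _)) (inj_eq enum_rank_inj).
    by rewrite ov_neq_nv.
  rewrite mpolyXD /dcoef -!mulrA; congr (_ * _).
  by rewrite mulrCA; congr (_ * _); rewrite [RHS]mulrCA.
by apply: monomialM => //; apply: hf.
Qed.

Hypothesis J_new : forall w i, J 'X_[(w + U_(nv m i))%MM] -> J 'X_[w].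
Hypothesis J_sq : forall w s t, tag s = tag t -> s != t ->
  (0 < w (ov s))%N -> (0 < w (ov t))%N -> J 'X_[w].

Lemma J_nmon w (A : {set 'I_d}) : J 'X_[(w + nmon m A)%MM] -> J 'X_[w].
Proof.
rewrite /nmon; elim/big_rec: _ w => [|i x _ IH] w; first by rewrite addm0.
by rewrite addmA [(w + _)%MM]addmC -addmA [(U_(_) + _)%MM]addmC => /J_new /IH.
Qed.

Lemma tag_vertices W : ~ J 'X_[W] ->
  {in vertices W &, injective (@tag 'I_d (fun i => 'I_(m i)))}.
Proof.
move=> nJ s t; rewrite !inE => /andP [sW _] /andP [tW _] E.
by apply/eqP/negPn/negP => st; apply: nJ; apply: (J_sq E st).
Qed.

Lemma incl_smon_sub W k (u : csmon m k) : csset u \subset vertices W ->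
  (W - smon (csset u) + incl_mon (csval u) + nmon m (tag @: csset u))%MM = W.
Proof. by rewrite -smon_le incl_csval -addmA => /submK. Qed.

(** In degree [W] the whole sequence vanishes if the monomial of [W] lies in
    [J], and otherwise no element of the strand is a relation. *)
Lemma strand_rel W k phi : J 'X_[W] -> relations (strand W k phi).
Proof.
move=> JW u; rewrite ffunE /colon; case: ifP => [uW|_]; last first.
  by rewrite mul0r; apply: (submod0 (monomial_submod mJ)).
rewrite -scalerAl -mpolyXD; apply: (monomialZ mJ).
by apply: (@J_nmon _ (tag @: csset u)); rewrite incl_smon_sub.
Qed.

Lemma strand_rel_eq0 W k phi (u : csmon m k) : ~ J 'X_[W] ->
  relations (strand W k phi) -> csset u \subset vertices W -> phi (csset u) = 0.
Proof.
move=> nJ /(_ u); rewrite ffunE /colon => h uW; rewrite uW in h.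
apply/eqP/negPn/negP => c0; apply: nJ.
rewrite -(incl_smon_sub uW) mpolyXD mulrC; apply: (monomialM mJ).
by rewrite mpolyXD; apply: (monomialZ_inv mJ c0); rewrite scalerAl.
Qed.

Local Notation gch k := (family_graded K (fun u : csmon m k => cshift u)).

(** Modulo relations, only degrees whose vertices have distinct colors need to
    be considered: in the others every chain is a relation. *)
Lemma dmap_dmap_rel k (f : chain k.+2) : relations (dmap (dmap f)).
Proof.
have [s ->] := pr_decomp (gch k.+2) f.
rewrite !(linf_sum (@dmap_linear _)); apply: (submod_sum (rel_submod k)) => a _.
move: (fpr _ _ _) (pr_homog (gch k.+2) a f) => {s}f hf.
have [->|[W aE]] := fhomog_cases hf.
  by rewrite !(linf0 (@dmap_linear _)); apply: submod0 (rel_submod k).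
rewrite aE in hf; have [phi ->] := fhomog_strand hf.
have [JW|nJ] := pselect (J 'X_[W]); last first.
  by rewrite (dmap_dmap_strand (tag_vertices nJ)); apply: submod0 (rel_submod k).
by do 2 apply: dmap_rel; apply: strand_rel.
Qed.

(** A cycle modulo relations is, in each degree, either a relation or an actual
    cycle of a simplex with at least one vertex, since the faces in question are
    nonempty. *)
Lemma dmap_exact k (f : chain k.+1) : relations (dmap f) ->
  exists g : chain k.+2, relations (f - dmap g).
Proof.
move=> cyc.
have /choice [g gP] : forall a, exists g : chain k.+2,
    relations (fpr (fun u => cshift u) a f - dmap g).
  move=> a; have hf := pr_homog (gch k.+1) a f.
  have {cyc} : relations (dmap (fpr (fun u => cshift u) a f)).
    rewrite -(graded_additive _ _ (gch k.+1) (gch k) (@dmap_linear k)); last first.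
      exact: dmap_graded.
    by move=> u; rewrite ffunE; apply: (monomial_graded (colon_monomialp _)).
  move: (fpr _ _ _) hf => {}f hf cyc.
  have ex0 : relations f -> exists g : chain k.+2, relations (f - dmap g).
    by move=> rf; exists 0; rewrite (linf0 (@dmap_linear _)) subr0.
  have [f0|[W aE]] := fhomog_cases hf.
    by apply: ex0; rewrite f0; apply: submod0 (rel_submod _).
  rewrite aE in hf; have [phi E] := fhomog_strand hf; rewrite {}E {f hf} in cyc ex0 *.
  have [JW|nJ] := pselect (J 'X_[W]); first exact/ex0/strand_rel.
  have tagW := tag_vertices nJ.
  have [X0|X0] := eqVneq (vertices W) set0.
    apply: ex0 => u; rewrite ffunE X0 subset0 -cards_eq0 csset_card /=.
    exact: (submod0 (monomial_submod (colon_monomialp _))).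
  have [v _ vW|psi ->] := @strand_exact W tagW k.+1 phi X0.
    by apply: (strand_rel_eq0 nJ) vW; rewrite -dmap_strand.
  by exists (strand W k.+2 psi); rewrite subrr; apply: submod0 (rel_submod _).
have [s fE] := pr_decomp (gch k.+1) f; exists (\sum_(a <- s) g a).
rewrite {1}fE (linf_sum (@dmap_linear _)) -sumrB.
by apply: (submod_sum (rel_submod _)) => a _; apply: gP.
Qed.

Lemma daug_rel (J' : S -> Prop) (f : chain 0) : @submodp S S^o J' ->
  (forall p, J p -> J' p) -> relations f -> J' (daug f).
Proof.
move=> sJ' JJ' hf; apply: (submod_sum sJ') => u _; apply: JJ'.
have := hf u; rewrite /colon incl_csval csset0.
have -> : omon (set0 : {set var m}) = 0%MM.
  by apply: mnm_ext => [t|i]; rewrite ?omon_ov ?omon_nv ?inE mnm0E.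
by rewrite mpolyX0 mulr1.
Qed.

Lemma daug_dmap (J' : S -> Prop) (f : chain 1) : @submodp S S^o J' ->
  (forall t, J' (xvar K (new_var m (tag t)) * xvar K (old_var t))) ->
  J' (daug (dmap f)).
Proof.
move=> sJ' J'_gen; apply: (submod_sum sJ') => v _; rewrite ffunE.
do 2 apply: (submod_sum sJ') => ? _.
rewrite mulrC; apply: (submodZ sJ'); rewrite /dcoef -mulrA.
by apply: (submodZ sJ'); rewrite mulrC; apply: J'_gen.
Qed.

Section Augmentation.
Variable J' : S -> Prop.
Hypothesis mJ' : monomialp J'.
Hypothesis J'_mon : forall w, J' 'X_[w] ->
  J 'X_[w] \/ exists t, (0 < w (ov t))%N /\ (0 < w (nv m (tag t)))%N.

(** In a degree without vertices a monomial of [J'] already lies in [J], which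
    settles the one strand that is not a simplex with a vertex. *)
Lemma daug_exact (f : chain 0) : J' (daug f) -> exists g : chain 1, relations (f - dmap g).
Proof.
move=> cyc.
have /choice [g gP] : forall a, exists g : chain 1,
    relations (fpr (fun u => cshift u) a f - dmap g).
  move=> a; have hf := pr_homog (gch 0) a f.
  have {cyc} : J' (daug (fpr (fun u => cshift u) a f)).
    rewrite -(graded_additive _ _ (gch 0) (poly_graded K _) daug_linear) //.
      exact: (monomial_graded mJ').
    exact: daug_graded.
  move: (fpr _ _ _) hf => {}f hf cyc.
  have ex0 : relations f -> exists g : chain 1, relations (f - dmap g).
    by move=> rf; exists 0; rewrite (linf0 (@dmap_linear _)) subr0.
  have [f0|[W aE]] := fhomog_cases hf.
    by apply: ex0; rewrite f0; apply: submod0 (rel_submod _).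
  rewrite aE in hf; have [phi E] := fhomog_strand hf; rewrite {}E {f hf} in cyc ex0 *.
  have [JW|nJ] := pselect (J 'X_[W]); first exact/ex0/strand_rel.
  have tagW := tag_vertices nJ.
  have [X0|X0] := eqVneq (vertices W) set0; last first.
    have [v //|psi ->] := @strand_exact W tagW 0 phi X0.
    by exists (strand W 1 psi); rewrite subrr; apply: submod0 (rel_submod _).
  have [|u0 u0E] := @cssetP _ m 0 set0 (cards0 _); first by move=> x y; rewrite inE.
  have u0P u : u = u0 by apply: csset_inj; rewrite !csset0.
  have augE : daug (strand W 0 phi) = phi set0 *: 'X_[W].
    rewrite /daug (bigD1 u0) //= big1 => [|u]; last by rewrite [u]u0P eqxx.
    rewrite addr0 ffunE csset0 sub0set; congr (_ *: 'X_[_]).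
    by rewrite smon0 subm0.
  rewrite augE in cyc.
  have phi0 : phi set0 = 0.
    apply/eqP/negPn/negP => c0.
    have [//|[t [t1 t2]]] := J'_mon (monomialZ_inv mJ' c0 cyc).
    have : t \in vertices W by rewrite inE t1 t2.
    by rewrite X0 inE.
  apply: ex0 => u; rewrite ffunE csset0 sub0set phi0 scale0r.
  exact: (submod0 (monomial_submod (colon_monomialp _))).
have [s fE] := pr_decomp (gch 0) f; exists (\sum_(a <- s) g a).
rewrite {1}fE (linf_sum (@dmap_linear _)) -sumrB.
by apply: (submod_sum (rel_submod _)) => a _; apply: gP.
Qed.

End Augmentation.

End Relations.

End ChainMap.

(** * The monomial ideals of the statement *)

Section IdealGen.
Variables (K : fieldType) (n : nat).
Local Notation S := {mpoly K[n]}.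
Implicit Types (G : S -> Prop) (p q : S) (v w : 'X_{1..n}).

Lemma ideal_gen_submod G : @submodp S S^o (ideal_gen G).
Proof.
split; [exact: spanned0|exact: spannedD|exact: spannedZ].
Qed.

Lemma ideal_gen_mem G p : G p -> ideal_gen G p.
Proof.
move=> Gp; exists 1%N, (fun=> 1), (fun=> p); split=> //.
by rewrite big_ord1 scale1r.
Qed.

Lemma ideal_gen_mul G p q : ideal_gen G q -> ideal_gen G (p * q).
Proof. exact: (submodZ (ideal_gen_submod G)). Qed.

(** Membership in a monomial ideal is read off on the monomials of a
    polynomial, [N] being the set of monomials of the ideal. *)
Lemma ideal_gen_monomials G (N : 'X_{1..n} -> Prop) :
  (forall g, G g -> forall w, w \in msupp g -> N w) ->
  (forall w, N w -> ideal_gen G 'X_[w]) ->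
  (forall v w, N w -> N (v + w)%MM) ->
  forall p, ideal_gen G p <-> forall w, w \in msupp p -> N w.
Proof.
move=> GN NG up p; split; last first.
  move=> h; rewrite (mpolyE p) big_seq.
  apply: (submod_sum (ideal_gen_submod G)) => w wp.
  by rewrite -mul_mpolyC; apply/ideal_gen_mul/NG/h.
move=> [k [a [g [Gg ->]]]] w /msupp_sum_le; rewrite filter_predT.
move=> /flattenP [_ /mapP [i _ ->]] /msuppM_le /allpairsP [[u v] /= [_ vg ->]].
exact/up/(GN _ (Gg i)).
Qed.

Section Consequences.
Variables (G : S -> Prop) (N : 'X_{1..n} -> Prop).
Hypothesis GN : forall p, ideal_gen G p <-> forall w, w \in msupp p -> N w.

Lemma ideal_genX w : ideal_gen G 'X_[w] <-> N w.
Proof.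
rewrite GN; split=> [|Nw v]; first by apply; rewrite msuppX mem_head.
by rewrite msuppX inE => /eqP ->.
Qed.

Lemma ideal_gen_monomialp : monomialp (ideal_gen G).
Proof.
split; first exact: ideal_gen_submod.
move=> a p /GN h; apply/GN => w; rewrite mcoeff_msupp mcoeff_phomog.
by case: (degm w =P a) => _; rewrite ?eqxx // -mcoeff_msupp => /h.
Qed.

End Consequences.

End IdealGen.

Section ColoredIdeals.
Variables (K : fieldType) (d : nat) (m : 'I_d -> nat).
Local Notation P := (cpoly K m).
Local Notation mon := 'X_{1..nvar m}.
Local Notation mon' := 'X_{1..nvar (msucc m)}.
Local Notation S := {mpoly K[nvar (msucc m)]}.
Implicit Types (s t : var m) (i : 'I_d) (u v : mon) (w : mon').

Lemma inclE (q : P) :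
  incl q = \sum_(u <- msupp q) q@_u *: 'X_[incl_mon u].
Proof.
rewrite /incl comp_mpolyE; apply: eq_bigr => u _; congr (_ *: _).
rewrite /incl_mon -mprodXnE [RHS](reindex (@enum_val _ (mem (var m)))) /=; last first.
  by apply: onW_bij; apply: enum_val_bij.
apply: eq_bigr => x _; rewrite tnth_mktuple; congr (_ ^+ u _).
by rewrite /vidx enum_valK.
Qed.

Lemma inclX u : incl ('X_[u] : P) = 'X_[incl_mon u].
Proof. by rewrite inclE msuppX big_seq1 mcoeffX eqxx scale1r. Qed.

Lemma incl_mon_le u v : (u <= v)%MM -> (incl_mon u <= incl_mon v)%MM.
Proof.
move=> /mnm_lepP h; apply/mnm_lepP; apply: index_cases => [t|i].
  by rewrite !incl_mon_ov.
by rewrite !incl_mon_nv.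
Qed.

Definition two_of_color w : Prop := exists s t,
  [/\ s != t, tag s = tag t, (0 < w (ov s))%N & (0 < w (ov t))%N].

Lemma msupp_sq_gen (g : S) w : sq_gen g -> w \in msupp g -> two_of_color w.
Proof.
move=> [i [j [k [jk ->]]]]; rewrite -mpolyXD msuppX inE => /eqP ->.
exists (Tagged (fun i => 'I_(m i)) j), (Tagged (fun i => 'I_(m i)) k); split=> //.
- by rewrite eq_Tagged /=; apply: contraTneq jk => ->; rewrite ltnn.
- by rewrite mnmDE [X in (X + _)%N]mnm1E eqxx.
by rewrite mnmDE [X in (_ + X)%N]mnm1E eqxx addn1.
Qed.

Lemma ideal_gen_dvd (G : S -> Prop) w w' : (w' <= w)%MM ->
  ideal_gen G 'X_[w'] -> ideal_gen G 'X_[w].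
Proof. by move=> /submK <-; rewrite mpolyXD; apply: ideal_gen_mul. Qed.

Lemma two_of_color_mem (G : S -> Prop) w : (forall g, sq_gen g -> G g) ->
  two_of_color w -> ideal_gen G 'X_[w].
Proof.
move=> sG [[i j] [[i' k] [st /= E wj wk]]]; subst i'.
have {st} jk : j != k by rewrite eq_Tagged in st.
wlog lt : j k jk wj wk / (j < k)%N => [wl|].
  case: (ltngtP j k) => [lt|lt|/val_inj E]; [exact: (wl j k)| |].
    by apply: (wl k j) => //; rewrite eq_sym.
  by rewrite E eqxx in jk.
pose w' := (U_(ov (Tagged (fun i => 'I_(m i)) j)) + U_(ov (Tagged (fun i => 'I_(m i)) k)))%MM.
apply: (@ideal_gen_dvd _ _ w'); last first.
  by apply/ideal_gen_mem/sG; exists i, j, k; rewrite mpolyXD.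
apply/mnm_lepP => x; rewrite mnmDE !mnm1E.
case: eqP => [<-|_]; last by case: eqP => [<-|].
by rewrite (inj_eq (@ov_inj _ _)) eq_Tagged /= eq_sym (negPf jk) addn0.
Qed.

Lemma two_of_colorD w' w : two_of_color w -> two_of_color (w' + w)%MM.
Proof.
by move=> [s [t [st E hs ht]]]; exists s, t; rewrite !mnmDE !addn_gt0 hs ht !orbT.
Qed.

Lemma sq_ideal_monomialp : monomialp (@sq_ideal K d m).
Proof.
apply: (@ideal_gen_monomialp _ _ _ two_of_color); apply: ideal_gen_monomials.
- by move=> g sg w; apply: msupp_sq_gen.
- by move=> w; apply: two_of_color_mem.
by move=> w' w; apply: two_of_colorD.
Qed.

Variable I : P -> Prop.
Hypothesis hI : csqfree_ideal I.

Lemma csqfree_ideal_msupp q u : I q -> u \in msupp q -> I 'X_[u].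
Proof.
have [[[I0 ID IM] gI] _] := hI.
have up v1 v2 : I 'X_[v2] -> I 'X_[(v1 + v2)%MM].
  by rewrite mpolyXD; apply: IM.
move=> /gI Iq uq.
have mI := @ideal_gen_monomials _ _ (fun q => I q /\ exists u : mon, q = 'X_[u])
  (fun u => I 'X_[u]).
apply: ((mI _ _ up q).1 Iq u uq) => [g [Ig [v E]] w|w Iw].
  by rewrite E msuppX inE => /eqP ->; rewrite -E.
by apply: ideal_gen_mem; split=> //; exists w.
Qed.

(** Divisibility of monomials is well founded. *)
Lemma minimal_generator_exists u : I 'X_[u] ->
  exists2 v, minimal_generator I v & (v <= u)%MM.
Proof.
have [k] := ubnP (mdeg u); elim: k u => // k IH u ltk Iu.
have [mu|] := pselect (minimal_generator I u).
  by exists u => //; apply: lepm_refl.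
move=> nmin; have [v [Iv vu nvu]] : exists v, [/\ I 'X_[v], (v <= u)%MM & v <> u].
  apply: contrapT => h; apply: nmin; split=> // v Iv vu.
  by apply: contrapT => nvu; apply: h; exists v.
have [|v' mv' v'v] := IH v _ Iv; last first.
  by exists v' => //; apply: lepm_trans v'v vu.
rewrite ltnS in ltk; apply: leq_trans ltk.
rewrite -(submK vu) mdegD -add1n leq_add2r lt0n mdeg_eq0.
by apply/eqP => E; apply: nvu; rewrite -[RHS](submK vu) E add0m.
Qed.

(** The monomials of [sq_extension I]. Asking for a color-squarefree [u] in the
    first case is what makes the minimal generators squarefree. *)
Definition sq_ext_mon w : Prop :=
  (exists u, [/\ I 'X_[u], csqfree u & (incl_mon u <= w)%MM]) \/ two_of_color w.

Lemma sq_extensionP (p : S) :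
  sq_extension I p <-> forall w, w \in msupp p -> sq_ext_mon w.
Proof.
apply: ideal_gen_monomials => [g|w|w' w].
- move=> [[q Iq ->]|sg] w; last by move=> wg; right; apply: msupp_sq_gen wg.
  rewrite inclE => /msupp_sum_le; rewrite filter_predT.
  move=> /flattenP [_ /mapP [u uq ->]] /msuppZ_le; rewrite msuppX inE => /eqP ->.
  have [v mv vu] := minimal_generator_exists (csqfree_ideal_msupp Iq uq).
  by left; exists v; split; [case: mv|apply: hI.2|apply: incl_mon_le].
- move=> [[u [Iu _ uw]]|]; last by apply: two_of_color_mem => g sg; right.
  apply: (ideal_gen_dvd uw); apply: ideal_gen_mem; left; exists 'X_[u] => //.
  by rewrite inclX.
move=> [[u [Iu cu uw]]|]; last by right; apply: two_of_colorD.
by left; exists u; split=> //; apply: lepm_trans uw _; apply: lem_addl.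
Qed.

Lemma sq_extensionX w : sq_extension I 'X_[w] <-> sq_ext_mon w.
Proof. exact: ideal_genX sq_extensionP _. Qed.

Lemma sq_extension_monomialp : monomialp (sq_extension I).
Proof. exact: ideal_gen_monomialp sq_extensionP. Qed.

Definition old_indices : {set 'I_(nvar (msucc m))} := [set ov t | t : var m].

Lemma old_indices_nv i : nv m i \notin old_indices.
Proof. by apply/imsetP => -[t _ /eqP]; rewrite nv_neq_ov. Qed.

(** The minimal generators of [sq_extension I] are squarefree and involve no
    new variable. *)
Lemma sq_extension_squarefree : squarefree_on old_indices (sq_extension I).
Proof.
move=> w x hx; rewrite !sq_extensionX.
have pos t : (0 < (w + U_(x))%MM (ov t))%N -> (0 < w (ov t))%N.
  rewrite mnmDE mnm1E; case: eqP => [xt|_]; last by rewrite addn0.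
  by move: hx; rewrite xt imset_f.
move=> [[u [Iu cu uw]]|[s [t [st E hs ht]]]]; last first.
  by right; exists s, t; split=> //; apply: pos.
left; exists u; split=> //; apply/mnm_lepP; apply: index_cases => [t|i].
  rewrite incl_mon_ov; have [ut|ut] := leqP (u (vidx t)) 0; first exact: leq_trans ut _.
  have u1 : (u (vidx t) <= 1)%N by case/andP: cu => /forallP.
  apply: leq_trans u1 _; apply: pos; apply: leq_trans ut _.
  by have := mnm_lepP uw (ov t); rewrite incl_mon_ov.
by rewrite incl_mon_nv.
Qed.

(** Multiplying by [w] only raises exponents, so the divisibility criterion for
    the original ideal applies to the products with [w]. *)
Lemma colon_squarefree w : squarefree_on old_indices (colon (sq_extension I) w).
Proof.
move=> v x hx; rewrite /colon -!mpolyXD -addmA [(U_(x) + _)%MM]addmC addmA.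
apply: sq_extension_squarefree; case/orP: hx => [->//|v0].
by rewrite mnmDE addn_gt0 v0 orbT.
Qed.

Lemma sq_extension_two_of_color w : two_of_color w -> sq_extension I 'X_[w].
Proof. by move=> h; apply/sq_extensionX; right. Qed.

Definition add_new_mon w : Prop :=
  sq_ext_mon w \/ exists t, (0 < w (ov t))%N /\ (0 < w (nv m (tag t)))%N.

Lemma sq_ext_monD w' w : sq_ext_mon w -> sq_ext_mon (w' + w)%MM.
Proof.
rewrite -!sq_extensionX mpolyXD.
exact: ideal_gen_mul.
Qed.

Lemma add_newP (p : S) :
  add_new (sq_extension I) p <-> forall w, w \in msupp p -> add_new_mon w.
Proof.
apply: ideal_gen_monomials => [g|w|w' w].
- move=> [Jg w wg|[t ->] w]; first by left; apply: (sq_extensionP g).1 wg.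
  rewrite -mpolyXD msuppX inE => /eqP ->; right; exists t.
  by rewrite !mnmDE !mnm1E !eqxx addn1.
- move=> [/sq_extensionX Jw|[t [t1 t2]]].
    by apply: ideal_gen_mem; left.
  apply: (@ideal_gen_dvd _ _ (U_(nv m (tag t)) + U_(ov t))%MM); last first.
    by apply: ideal_gen_mem; right; exists t; rewrite mpolyXD.
  apply/mnm_lepP => x; rewrite mnmDE !mnm1E.
  case: (eqVneq (nv m (tag t)) x) => [<-|_]; first by rewrite ov_neq_nv.
  by case: eqP => [<-|].
move=> [h|[t [t1 t2]]]; first by left; apply: sq_ext_monD.
by right; exists t; rewrite !mnmDE !addn_gt0 t1 t2 !orbT.
Qed.

Lemma add_new_monomialp : monomialp (add_new (sq_extension I)).
Proof. exact: ideal_gen_monomialp add_newP. Qed.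

End ColoredIdeals.

(** * The exact sequence and its iterated mapping cones *)

Section Sequence.
Variables (K : fieldType) (d : nat) (m : 'I_d -> nat).
Local Notation S := {mpoly K[nvar (msucc m)]}.
Local Notation deg := (multideg (nvar (msucc m))).
Local Notation chain k := {ffun csmon m k -> S^o}.

(** The maps of the sequence for the ideal [J] are those induced by [daug] and
    [dmap]. *)
Definition seq_map_spec (J : S -> Prop) k : {linear aug_seq J k.+1 -> aug_seq J k} -> Prop :=
  match k with
  | 0 => fun D => forall f, D (sq_class J f) = aug_class J (daug f)
  | k'.+1 => fun D => forall f, D (sq_class J f) = sq_class J (dmap f)
  end.

Lemma seq_maps_exist (J : S -> Prop) : monomialp J ->
  exists D : maps_of J, forall k, seq_map_spec (D k).
Proof.
move=> mJ; have ex k : exists D : {linear aug_seq J k.+1 -> aug_seq J k}, seq_map_spec D.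
  case: k => [|k].
    apply: (quotient_map (rel_submod mJ 0) (ideal_gen_submod _) (@daug_linear K d m)).
    move=> f; apply: daug_rel; first exact: ideal_gen_submod.
    by move=> p Jp; apply: ideal_gen_mem; left.
  apply: (quotient_map (rel_submod mJ k.+1) (rel_submod mJ k) (@dmap_linear K d m k)).
  by move=> f; apply: dmap_rel.
by exists (fun k => sval (cid (ex k))) => k; apply: svalP (cid (ex k)).
Qed.

Lemma F_maps_spec (D : maps_of (@sq_ideal K d m)) :
  (forall k, seq_map_spec (D k)) -> F_maps D.
Proof.
move=> DP; split=> [k u|u].
  rewrite (DP k.+1 (basis_elt K u)) /sq_class.
  pose L := @qcl_linear _ _ (sum_rel (fun u : csmon m k => colon (@sq_ideal K d m) (incl_mon (csval u)))).
  rewrite -[LHS]/(qcl _ _).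
  transitivity (qcl (sum_rel (fun u : csmon m k => colon (@sq_ideal K d m) (incl_mon (csval u))))
    (\sum_t \sum_(v : csmon m k | csval u == (csval v + U_(vidx t))%MM)
        dcoef K u t *: basis_elt K v)).
    congr (qcl _ _); apply/ffunP => v; rewrite ffunE sum_ffunE.
    apply: eq_bigr => t _; rewrite sum_ffunE.
    transitivity (if csval u == (csval v + U_(vidx t))%MM then dcoef K u t else 0).
      rewrite big_mkcond (bigD1 u) //= big1 ?addr0 => [|u' /negPf uu'].
        by case: ifP => // _; rewrite ffunE eqxx mulr1.
      by case: ifP => // _; rewrite ffunE uu' mulr0.
    rewrite [RHS]big_mkcond (bigD1 v) //= big1 ?addr0 => [|v' /negPf vv'].
      by case: ifP => // _; rewrite !ffunE eqxx /GRing.scale /= mulr1.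
    by case: ifP => // _; rewrite !ffunE eq_sym vv' scaler0.
  rewrite (linf_sum L); apply: eq_bigr => t _; rewrite (linf_sum L).
  by apply: eq_bigr => v _; rewrite (linfZ L).
rewrite (DP 0%N (basis_elt K u)); congr aug_class.
rewrite /daug (bigD1 u) //= ffunE eqxx big1 ?addr0 // => v /negPf vu.
by rewrite ffunE vu.
Qed.

Lemma induced_maps_spec (J : S -> Prop) (mJ : monomialp J)
    (DF : maps_of (@sq_ideal K d m)) (DG : maps_of J) :
  (forall p, sq_ideal p -> J p) ->
  (forall k, seq_map_spec (DF k)) -> (forall k, seq_map_spec (DG k)) ->
  induced_maps DF DG.
Proof.
move=> sJ DFP DGP; have m0 := sq_ideal_monomialp K m; split=> [k f g|f p].
  rewrite (DFP k.+1 f) (DGP k.+1 f) => /(qcl_eq (rel_submod m0 k)) h.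
  by apply/(qcl_eq (rel_submod mJ k)) => u; apply: sJ; apply: h.
rewrite (DFP 0%N f) (DGP 0%N f) => /(qcl_eq (ideal_gen_submod _)) h.
apply/(qcl_eq (ideal_gen_submod _)).
move: h => [n [a [w [hw ->]]]]; exists n, a, w; split=> // i.
by case: (hw i) => [/sJ|]; [left|right].
Qed.

Variable I : cpoly K m -> Prop.
Hypothesis hI : csqfree_ideal I.
Let J : S -> Prop := sq_extension I.
Let mJ : monomialp J := sq_extension_monomialp hI.
Let mJ' : monomialp (add_new J) := add_new_monomialp hI.

Lemma aug_seq_graded k : is_graded (aug_seq J k).
Proof.
case: k => [|k]; first exact: cyclic_graded.
by apply: sum_cyclic_graded => u; apply: colon_monomialp.
Qed.

Lemma sq_ideal_sub p : @sq_ideal K d m p -> J p.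
Proof. by move=> [n [a [w [hw ->]]]]; exists n, a, w; split=> // i; right. Qed.

Variable DG : maps_of J.
Hypothesis DGP : forall k, seq_map_spec (DG k).

Lemma seq_map_graded k : graded_map (DG k).
Proof.
move=> a x; case: k x => [|k] x [f hf ->].
  rewrite -[\pi_ _ _]/(sq_class J f) (DGP 0%N f).
  by exists (daug f) => //; apply: daug_graded.
rewrite -[\pi_ _ _]/(sq_class J f) (DGP k.+1 f).
by exists (dmap f) => //; apply: dmap_graded.
Qed.

Lemma sq_extension_new w i : J 'X_[(w + U_(nv m i))%MM] -> J 'X_[w].
Proof. by apply: sq_extension_squarefree => //; rewrite old_indices_nv. Qed.

Lemma sq_extension_color (w : 'X_{1..nvar (msucc m)}) (s t : var m) : tag s = tag t -> s != t ->
  (0 < w (ov s))%N -> (0 < w (ov t))%N -> J 'X_[w].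
Proof. by move=> E st hs ht; apply: (sq_extension_two_of_color hI); exists s, t. Qed.

Lemma seq_kernel k (f : chain k.+1) : DG k.+1 (sq_class J f) = 0 ->
  exists g : chain k.+2, relations J (f - dmap g).
Proof.
rewrite (DGP k.+1 f) => /(qcl_eq0 (rel_submod mJ k)) h.
exact: (dmap_exact mJ sq_extension_new sq_extension_color).
Qed.

Lemma csmon_bound k : csmon m k -> (k <= d)%N.
Proof.
move=> u; rewrite -(csset_card u) -(card_in_imset (@csset_tag _ _ _ u)).
by rewrite -[X in (_ <= X)%N]card_ord max_card.
Qed.

(** The term after the top one vanishes, as there are only [d] colors. *)
Lemma seq_top_injective k : k.+1 = d -> injective (DG k.+1).
Proof.
move=> kd x y; have [f ->] := qclE x; have [g ->] := qclE y => E.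
have : DG k.+1 (sq_class J (f - g)) = 0.
  rewrite /sq_class -[\pi_ _ _]/(qcl _ _) (linfB (@qcl_linear _ _ _)).
  by rewrite linearB E subrr.
move=> /seq_kernel [h]; have -> : dmap h = 0.
  apply/ffunP => u; rewrite !ffunE big1 // => t _; rewrite big1 // => v.
  by have := leq_trans (csmon_bound v) (eq_leq (esym kd)); rewrite ltnn.
by rewrite subr0 => /(qcl_eq (rel_submod mJ _)).
Qed.

Lemma seq_exact : (0 < d)%N -> exact_sequence DG d.+1.
Proof.
move=> d0; split=> [|k _ x|x].
- suff h k : k = d -> injective (DG k) by apply: h.
  by case: k => [E|k]; [rewrite -E in d0|apply: seq_top_injective].
- have [f ->] := qclE x; rewrite -[qcl _ _]/(sq_class J f).
  case: k f {x} => [|k] f; last first.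
    split=> [/seq_kernel [g fg]|[y <-]].
      exists (sq_class J g); rewrite (DGP k.+2 g).
      apply/(qcl_eq (rel_submod mJ _)); rewrite -opprB.
      exact: (submodN (rel_submod mJ _)).
    have [g ->] := qclE y; rewrite -[qcl _ _]/(sq_class J g).
    rewrite (DGP k.+2 g) (DGP k.+1 (dmap g)).
    apply/(qcl_eq0 (rel_submod mJ _)).
    exact: (dmap_dmap_rel mJ sq_extension_new sq_extension_color).
  rewrite (DGP 0%N f); split=> [/(qcl_eq0 (ideal_gen_submod _)) h|[y]].
    have [|g fg] := daug_exact mJ sq_extension_new sq_extension_color mJ' _ h.
      move=> w /(ideal_genX (add_newP hI)) [Jw|]; last by right.
      by left; apply/(sq_extensionX hI).
    exists (sq_class J g); rewrite (DGP 1%N g).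
    apply/(qcl_eq (rel_submod mJ _)); rewrite -opprB.
    exact: (submodN (rel_submod mJ _)).
  have [g ->] := qclE y; rewrite -[qcl _ _]/(sq_class J g) (DGP 1%N g) -(DGP 0%N f).
  move=> <-; rewrite (DGP 0%N (dmap g)); apply/(qcl_eq0 (ideal_gen_submod _)).
  apply: daug_dmap; first exact: ideal_gen_submod.
  by move=> t; apply: ideal_gen_mem; right; exists t.
have [p ->] := qclE x.
have [|u0 u0E] := @cssetP _ m 0 set0 (cards0 _); first by move=> s t; rewrite inE.
exists (sq_class J [ffun=> p]); rewrite (DGP 0%N [ffun=> p]) /aug_class.
congr (\pi_ _ _); rewrite /daug (bigD1 u0) //= big1 ?addr0 ?ffunE // => u.
by move=> /eqP []; apply: csset_inj; rewrite !csset0.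
Qed.

(** The total degree in the new variables. It separates the terms of the
    sequence: the generators that resolve the [k]-th one have weight [k]. *)
Definition wt (a : deg) : int := \sum_(i < d) a (nv m i).

Lemma wtD a b : wt (a + b) = wt a + wt b.
Proof. by rewrite /wt -big_split; apply: eq_bigr => i _; rewrite ffunE. Qed.

Lemma wt_sqf (t : {set 'I_(nvar (msucc m))}) : t \subset old_indices m -> wt (degm (sqf t)) = 0.
Proof.
move=> tT; rewrite /wt big1 // => i _; rewrite ffunE sqfE.
by rewrite (negPf (contra (subsetP tT _) (@old_indices_nv d m i))).
Qed.

Lemma wt_cshift k (u : csmon m k) : wt (cshift u) = k%:Z.
Proof.
rewrite cshiftE /wt -{2}(csset_card u) -(card_in_imset (@csset_tag _ _ _ u)).
under eq_bigr do rewrite ffunE smon_nv.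
rewrite -sum1_card [in RHS]big_mkcond /= (big_morph Posz PoszD (erefl (Posz 0))).
by apply: eq_bigr => i _; case: ifP.
Qed.

Definition cs_cyclic k (u : csmon m k) := cyclic_mod (colon J (incl_mon (csval u))).

Lemma cs_resolution k (u : csmon m k) :
  exists (C : gfree K _) (e : 'rV[S]_(rk C 0) -> cs_cyclic u),
    minimal_resolution e /\ forall j i, wt (gdeg C j i) = 0.
Proof.
have [C [e [mC dC]]] := cyclic_resolution (colon_monomialp mJ (incl_mon (csval u)))
  (colon_squarefree hI (w := incl_mon (csval u))).
by exists C, e; split=> // j i; have [t tT ->] := dC j i; apply: wt_sqf.
Qed.

(** Every term of the sequence has a minimal resolution, whose generators are
    those of the resolutions of the summands, shifted. *)
Lemma term_resolution k : exists (C : gfree K _) (e : 'rV[S]_(rk C 0) -> sq_mod J k),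
  [/\ minimal_resolution e, forall j i, wt (gdeg C j i) = k%:Z
    & forall j a, gens C j a =
        (\sum_(u : csmon m k) betti (cs_cyclic u) j%:Z (a - cshift u)%R)%N].
Proof.
have C u := cid (@cs_resolution k u).
have e u := cid (svalP (C u)).
have mJu (u : csmon m k) : monomialp (colon J (incl_mon (csval u))) by apply: colon_monomialp.
have [f rf] := dsum_resolution (fun u : csmon m k => cshift u) mJu
  (fun u => (svalP (e u)).1.1).
exists (dsum (fun u : csmon m k => cshift u) (fun u => sval (C u))), f; split.
- split=> //; apply: dsum_minimal => u.
  by case: (svalP (e u)) => -[].
- move=> j i /=; rewrite wtD wt_cshift.
  by have [_ ->] := svalP (e (tag (enum_val i))); rewrite add0r.
move=> j a; rewrite dsum_gens; apply: eq_bigr => u _.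
have [mC _] := svalP (e u).
by rewrite (betti_minimal _ _ (cyclic_graded (mJu u)) mC).
Qed.

(** The weights are known for one resolution, hence for all minimal ones. *)
Lemma minimal_term_weight k (C : gfree K _) (e : 'rV[S]_(rk C 0) -> sq_mod J k) :
  minimal_resolution e -> forall j i, wt (gdeg C j i) = k%:Z.
Proof.
move=> mC j; have [C' [e' [[rC' _] wC' _]]] := term_resolution k.
exact: (minimal_gens_degrees (Q := fun a => wt a = k%:Z) (aug_seq_graded k.+1) mC rC' (wC' j)).
Qed.

Lemma term_resolutions :
  exists (C : nat -> gfree K _) (e : forall k, 'rV[S]_(rk (C k) 0) -> aug_seq J k),
    (forall k, (0 < k <= d.+1)%N -> minimal_resolution (e k)) /\
    (forall k j a, gens (C k.+1) j a =
        (\sum_(u : csmon m k) betti (cs_cyclic u) j%:Z (a - cshift u)%R)%N).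
Proof.
have C k := cid (term_resolution k); have e k := cid (svalP (C k)).
exists (fun k => sval (C k.-1)), (fun k =>
  match k return 'rV[S]_(rk (sval (C k.-1)) 0) -> aug_seq J k with
  | 0 => fun=> 0 | k'.+1 => sval (e k') end).
split=> [[|k] // _|k j a]; first by case: (svalP (e k)).
by case: (svalP (e k)).
Qed.

Section Cones.
Hypothesis d0 : (0 < d)%N.
Variables (C : nat -> gfree K (nvar (msucc m))).
Variable e : forall k, 'rV[S]_(rk (C k) 0) -> aug_seq J k.
Hypothesis mC : forall k, (0 < k <= d.+1)%N -> minimal_resolution (@e k).

Lemma term_weight k : (k < d.+1)%N -> forall j i, wt (gdeg (C k.+1) j i) = k%:Z.
Proof. by move=> ltk; apply: (@minimal_term_weight k _ (@e k.+1)); apply: mC. Qed.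

Lemma seq_cone_exists : exists R (g : 'rV[S]_(rk R 0) -> aug_seq J 0),
  iterated_cone DG e d.+1 g.
Proof.
by apply: (iterated_cone_exists aug_seq_graded seq_map_graded (seq_exact d0) mC term_weight).
Qed.

Lemma seq_cone_minimal R (g : 'rV[S]_(rk R 0) -> aug_seq J 0) :
  iterated_cone DG e d.+1 g -> minimal_resolution g.
Proof.
move=> /(iterated_cone_resolves seq_map_graded (seq_exact d0) mC term_weight).
move=> [_ rg mR _]; split=> //; have [_ _ surj] := seq_exact d0.
rewrite /resolution; suff <- : (fun y => exists x, DG 0%N x = y) = (fun=> True) by [].
by apply/funext => y; apply/propext; split.
Qed.

Lemma seq_cone_gens R (g : 'rV[S]_(rk R 0) -> aug_seq J 0) k a :
  iterated_cone DG e d.+1 g ->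
  gens R k a = (\sum_(i < d.+1 | (i <= k)%N) gens (C i.+1) (k - i) a)%N.
Proof.
by move=> it; apply: (iterated_cone_gens seq_map_graded (seq_exact d0) mC term_weight _ _ it).
Qed.

End Cones.

Lemma betti_neg (M : gmodule K (nvar (msucc m))) (z : int) a : z < 0 -> betti M z a = 0%N.
Proof. by case: z. Qed.

Lemma betti_sum (d0 : (0 < d)%N) (k : int) (a : deg) :
  betti (cyclic_mod (add_new J)) k a =
  (\sum_(j < d.+1) \sum_(u : csmon m j)
     betti (cs_cyclic u) (k - j%:Z)%R (a - cshift u)%R)%N.
Proof.
case: k => k; last first.
  rewrite betti_neg // big1 // => j _; rewrite big1 // => u _.
  by rewrite betti_neg // NegzE -opprD oppr_lt0.
have [C [e [mC gC]]] := term_resolutions.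
have [R [g it]] := seq_cone_exists d0 mC.
rewrite (betti_minimal _ _ (aug_seq_graded 0) (seq_cone_minimal d0 mC it)).
rewrite (seq_cone_gens d0 mC _ _ it) big_mkcond; apply: eq_bigr => j _.
case: leqP => [jk|kj]; last first.
  by rewrite big1 // => u _; rewrite betti_neg // subr_lt0.
by rewrite gC; apply: eq_bigr => u _; rewrite subzn.
Qed.

End Sequence.

Theorem theorem5p8 (K : fieldType) (d : nat) (m : 'I_d -> nat)
    (I : cpoly K m -> Prop) (hd : (0 < d)%N) (hI : csqfree_ideal I) :
  let J := sq_extension I in
  (exists (DF : maps_of (@sq_ideal K d m)) (DG : maps_of J),
     (* (a) *)
     [/\ F_maps DF,
         induced_maps DF DG,
         forall k, is_graded (aug_seq J k),
         forall k, graded_map (DG k)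
       & exact_sequence DG d.+1] /\
     (* (b) *)
     minimally_resolved_by_iterated_cones DG d.+1) /\
  (* (c) *)
  (forall (k : int) (a : multideg (nvar (msucc m))),
     betti (cyclic_mod (add_new J)) k a =
     (\sum_(j < d.+1) \sum_(u : csmon m j)
        betti (cyclic_mod (colon J (incl_mon (csval u))))
              (k - j%:Z)%R (a - cshift u)%R)%N).
Proof.
move=> J; have mJ : monomialp J := sq_extension_monomialp hI.
have [DF DFP] := seq_maps_exist (sq_ideal_monomialp K m).
have [DG DGP] := seq_maps_exist mJ.
split; last by move=> k a; apply: (betti_sum hI DGP hd).
exists DF, DG; split; first split.
- exact: F_maps_spec.
- by apply: (induced_maps_spec mJ) => // p; apply: sq_ideal_sub.
- exact: aug_seq_graded.
- exact: seq_map_graded.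
- exact: seq_exact.
split=> [|C e mC].
  by have [C [e [mC _]]] := term_resolutions hI; exists C, e.
split; first exact: (seq_cone_exists hI DGP hd mC).
by move=> R g; apply: (seq_cone_minimal hI DGP hd mC).
Qed.
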